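(* For every $1<p<\infty$ there is a finite constant $C_p$ depending only on $p$, with $C_p=O(p)$ as $p\to\infty$ and $C_p=O((p-1)^{-1})$ as $p\to1$, such that the following holds. Let $n_1,n_2,n_3,\ldots\in\{0,1\}$ and $m_2,m_3,m_4,\ldots\in\{0,1\}$, and let $m$ be the infinite matrix $$m=\left[\begin{array}{ccccc}n_1&m_2&m_3&m_4&\ldots\\ m_2&n_2&m_3&m_4&\ldots\\ m_3&m_3&n_3&m_4&\ldots\\ m_4&m_4&m_4&n_4&\ldots\\ \ldots&\ldots&\ldots&\ldots&\ldots\end{array}\right],$$ i.e. the $(i,i)$ entry is $n_i$ and, for $i\ne j$, the $(i,j)$ entry is $m_{\max(i,j)}$. Then $m$ is a Schur multiplier on $S^p$ for all $1<p<\infty$, and $$\|m*a\|_p\leq C_p\|a\|_p\qquad\text{for all }a\in S^p.$$ Both orders are optimal: there is $c>0$ such that the best constant $C_p$ (over all infinite matrices $m$ whose $(i,i)$ entry is $n_i$ and whose $(i,j)$ entry, for $i\ne j$, is $m_{\max(i,j)}$, where $n_1,n_2,n_3,\ldots\in\{0,1\}$ and $m_2,m_3,m_4,\ldots\in\{0,1\}$ are arbitrary) is at least $cp$ for $p$ sufficiently large and at least $c(p-1)^{-1}$ for $p>1$ sufficiently close to $1$.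
   Context: $S^p$ denotes the Schatten $p$-class, i.e. the noncommutative $L^p$-space associated with $B(\ell^2)$ and its usual trace, with norm $\|\cdot\|_p$; its elements are identified with infinite matrices $(a_{ij})_{i,j\ge1}$. The symbol $*$ denotes the Schur (Hadamard, entrywise) product: $(m_{ij})*(a_{ij})=(m_{ij}a_{ij})$. An infinite matrix $m$ is a Schur multiplier on $S^p$ if there is a finite constant $K_p$ with $\|m*a\|_p\le K_p\|a\|_p$ for all $a\in S^p$. *)

(* Defs.v *)
From mathcomp Require Import all_boot all_order all_algebra.
From mathcomp Require Import complex.
From mathcomp Require Import all_classical all_reals all_analysis.

Set Implicit Arguments.
Unset Strict Implicit.
Unset Printing Implicit Defensive.

Import Order.TTheory GRing.Theory Num.Theory.
Import numFieldNormedType.Exports.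

Local Open Scope classical_set_scope.
Local Open Scope ring_scope.
Local Open Scope complex_scope.

(* Rows and columns are numbered from 0. *)
Definition imatrix (R : realType) := nat -> nat -> R[i].

Section Operators.
Context {R : realType}.
Implicit Types (a b T S m : imatrix R) (x : nat -> R[i]).

(* R[i]^o carries the usual topology of the complex plane. *)
Definition cseries (u : nat -> R[i]) : nat -> R[i]^o :=
  series (u : nat -> R[i]^o).

Definition csum (u : nat -> R[i]) : R[i] := limn (cseries u).

Definition l2norm x : \bar R :=
  ((\sum_(0 <= k <oo) ((Normc.normc (x k)) ^+ 2)%:E) `^ 2^-1)%E.

Definition imulv a x : nat -> R[i] := fun i => csum (fun k => a i k * x k).

(* a is the matrix of a bounded operator on l^2 of norm at most M. *)
Definition op_bound a : set R := [set M | 0 <= M /\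
  forall x, (l2norm x < +oo)%E ->
    (forall i, cvgn (cseries (fun k => a i k * x k))) /\
    (l2norm (imulv a x) <= M%:E * l2norm x)%E].

(* +oo when a does not define a bounded operator on l^2. *)
Definition opnorm a : \bar R := ereal_inf [set M%:E | M in op_bound a].

Definition iadj a : imatrix R := fun i j => (a j i)^*.

Definition ione : imatrix R := fun i j => (i == j)%:R.

Definition imul a b : imatrix R := fun i j => csum (fun k => a i k * b k j).

Definition ipow T k : imatrix R := iter k (imul T) ione.

Definition ihorner (q : {poly R}) T : imatrix R :=
  fun i j => \sum_(k < size q) (q`_k)%:C * ipow T k i j.

(* Continuous functional calculus f(T) for a bounded positive operator T, whose
   spectrum lies in [0, ||T||]: the limit in operator norm of q(T), for
   polynomials q tending to f uniformly on [0, ||T||]. This limit exists and is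
   unique when f is continuous on that interval. *)
Definition fun_calc (f : R -> R) T : imatrix R :=
  xget (0 : imatrix R) [set S : imatrix R | forall eps : R, 0 < eps ->
    exists q : {poly R},
      (forall t : R, 0 <= t -> (t%:E <= opnorm T)%E -> `|q.[t] - f t| <= eps) /\
      (opnorm (fun i j => ihorner q T i j - S i j)%R <= eps%:E)%E].

Definition iabs a : imatrix R := fun_calc Num.sqrt (imul (iadj a) a).

(* Only meant for positive operators, whose diagonal is nonnegative. *)
Definition itrace T : \bar R :=
  (\sum_(0 <= i <oo) (complex.Re (T i i))%:E)%E.

(* (Tr |a|^p)^(1/p), with value +oo when a is not a bounded operator. *)
Definition schatten_norm (p : R) a : \bar R :=
  if (opnorm a < +oo)%E
  then (itrace (fun_calc (@powR R ^~ p) (iabs a)) `^ p^-1)%E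
  else +oo%E.

Definition schatten (p : R) : set (imatrix R) :=
  [set a | (schatten_norm p a < +oo)%E].

Definition ischur m a : imatrix R := fun i j => m i j * a i j.

(* ||m * a||_p <= K ||a||_p on S^p; as K is finite, m * a is again in S^p. *)
Definition schur_bound (p : R) m (K : R) : Prop := forall a, schatten p a ->
  (schatten_norm p (ischur m a) <= K%:E * schatten_norm p a)%E.

Definition schur_multiplier (p : R) m : Prop := exists K : R, schur_bound p m K.

(* With indices from 0, the (i, j) entry is m (max i j) off the diagonal; the
   value m 0 is never used. *)
Definition max_mx (n m : nat -> bool) : imatrix R := fun i j =>
  (if i == j then n i else m (maxn i j))%:R.

Definition best_constant (p : R) : \bar R := ereal_inf
  [set K%:E | K in [set K : R |
    forall n m : nat -> bool, schur_bound p (max_mx n m) K]].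

End Operators.

(* Main.v *)
(* Off the diagonal, m * a = U(a) D + D L(a), where U and L are the strictly
   upper and lower triangular parts and D = diag(m_k), so that everything rests
   on the bound of H(Y) = i (L(Y) - U(Y)) for matrices Y >= 0 and 1 < p < 2.  As
   1 + s Y - i s H(Y) is triangular, its determinant is prod_j (1 + s Y_jj); on
   the other hand, its modulus is bounded below in terms of the eigenvalues y_k
   of Y and x_k of H(Y).  The comparison gives the weak type estimate
     #{k : |x_k| >= 2 / s} <= 4 sum_k min (s y_k, (s y_k)^2),
   which is summed over dyadic s.  The case p = 2 is the Hilbert-Schmidt norm,
   and p > 2 follows by duality.  The bounds pass to infinite matrices because
   the Schatten norm is the supremum of the norms of the corners.

   For the lower bounds, on the rank one matrix (1_{i even, j odd}) of size 2 N a
   multiplier of the class acts as the triangular truncation of the N x N matrix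
   of ones; its diagonal entries in the Fourier basis are 1 / (1 - w^k), w a
   primitive N-th root of unity.  This gives sum_{k < N} k^-p <= (2 pi C_p)^p, and
   large p reduce to p close to 1 by duality. *)

From mathcomp Require Import spectral sesquilinear.
Require Import Defs.
From HB Require Import structures.
From mathcomp Require Import all_boot all_order all_algebra.
From mathcomp Require Import complex.
From mathcomp Require Import all_classical all_reals all_analysis.
From mathcomp Require Import ring lra.
Import Order.TTheory GRing.Theory Num.Theory.
Import numFieldNormedType.Exports.
Set Implicit Arguments.
Unset Strict Implicit.
Unset Printing Implicit Defensive.
Local Open Scope classical_set_scope.
Local Open Scope ring_scope.

(* Singular values are never ordered. By [spow_pinching] and [spow_attained], the sum of their p-th
   powers is the largest value of sum_j |(U A V)_jj|^p over contractions U and V; this takes the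
   place of majorization.

   The weak type estimate is of second order where s y is small, so the sum over dyadic s of s^-p
   min (s y, (s y)^2) converges exactly for 1 < p < 2. Its divergence at p = 1 produces the order 1
   / (p - 1). Its divergence at p = 2 does no harm: the orders concern p near 1 and, by duality, p
   near infinity, and p = 2 has its own argument.

   On the infinite side, |a| and |a|^p are defined as operator norm limits of polynomials. They are
   made accessible by one fact: for T >= 0 with N-th corner T_N, each entry of f(T) is the limit of
   the same entry of f(T_N). Bounds that are uniform in N then pass from matrices to operators. *)
Reserved Notation "A ^H" (at level 8, format "A ^H").

(** * Powers *)

Section PowerInequalities.
Context {R : realType}.
Implicit Types (x y p q : R).

Lemma powRVK p x : 0 < p -> 0 <= x -> (x `^ p) `^ p^-1 = x.
Proof. by move=> p0 x0; rewrite -powRrM mulfV ?gt_eqF// powRr1. Qed.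

Lemma powRKV p x : 0 < p -> 0 <= x -> (x `^ p^-1) `^ p = x.
Proof. by move=> p0 x0; rewrite -powRrM mulVf ?gt_eqF// powRr1. Qed.

Lemma powR_mono r x y : 0 <= r -> 0 <= x -> x <= y -> x `^ r <= y `^ r.
Proof. by move=> r0 x0 xy; rewrite ge0_ler_powR// nnegrE// (le_trans x0). Qed.

(** Young's inequality for x and y^(p - 1) with q = p / (p - 1), for which (p - 1) q = p. The
    convexity of t^p enters the proof in this form. *)
Lemma powR_tangent p x y : 1 <= p -> 0 <= x -> 0 <= y ->
  y `^ p + p * y `^ (p - 1) * (x - y) <= x `^ p.
Proof.
rewrite le_eqVlt => /predU1P[<-|p1] x0 y0.
  by rewrite subrr powRr0 !powRr1// !mul1r subrKC.
have p0 : 0 < p by lra.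
have pm : 0 < p - 1 by lra.
pose q := p / (p - 1).
have q0 : 0 < q by rewrite divr_gt0.
have pq : p^-1 + q^-1 = 1 by rewrite /q invf_div; field; lra.
have := @conjugate_powR R x (y `^ (p - 1)) p q x0 (powR_ge0 _ _) p0 q0 pq.
rewrite -powRrM.
have -> : (p - 1) * q = p by rewrite /q; field; lra.
move=> H.
have yy : y * y `^ (p - 1) = y `^ p by rewrite mulr_powRB1.
have e : q^-1 = (p - 1) / p by rewrite /q invf_div.
have -> : p * y `^ (p - 1) * (x - y) = p * (x * y `^ (p - 1)) - p * y `^ p.
  by rewrite -yy; ring.
have : p * (x * y `^ (p - 1)) <= p * (x `^ p / p + y `^ p / q) by rewrite ler_pM2l.
rewrite e.
have -> : p * (x `^ p / p + y `^ p * ((p - 1) / p)) = x `^ p + (p - 1) * y `^ p.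
  by field; lra.
lra.
Qed.

(** Sum the tangent inequality at the mean m. The weights only have total mass D <= 1, as for
    entries of contractions; the missing mass contributes (p - 1) (1 - D) m^p >= 0. *)
Lemma powR_jensen (I : finType) (d s : I -> R) p : 1 <= p ->
  (forall i, 0 <= d i) -> (forall i, 0 <= s i) -> \sum_i d i <= 1 ->
  (\sum_i d i * s i) `^ p <= \sum_i d i * s i `^ p.
Proof.
move=> p1 d0 s0 d1.
set m := \sum_i d i * s i.
have m0 : 0 <= m by apply: sumr_ge0 => i _; rewrite mulr_ge0.
have p0 : 0 < p by lra.
have [mE|mn] := eqVneq m 0.
  by rewrite mE powR0 ?gt_eqF//; apply: sumr_ge0 => i _; rewrite mulr_ge0 ?powR_ge0.
set D := \sum_i d i in d1 *.
have : \sum_i d i * (m `^ p + p * m `^ (p - 1) * (s i - m)) <=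
       \sum_i d i * s i `^ p.
  by apply: ler_sum => i _; rewrite ler_wpM2l// powR_tangent.
apply: le_trans.
have -> : \sum_i d i * (m `^ p + p * m `^ (p - 1) * (s i - m)) =
  D * m `^ p + p * m `^ (p - 1) * (m - D * m).
  rewrite {2}/m /D !mulr_suml -sumrB mulr_sumr -big_split/=.
  by apply: eq_bigr => i _; ring.
have -> : p * m `^ (p - 1) * (m - D * m) = p * (m * m `^ (p - 1)) * (1 - D).
  by ring.
rewrite mulr_powRB1//.
have : 0 <= (p - 1) * (1 - D) * m `^ p by rewrite !mulr_ge0 ?powR_ge0// subr_ge0.
lra.
Qed.

Lemma lp_norm_eq0 (I : finType) (f : I -> R) p : 0 < p -> (forall i, 0 <= f i) ->
  (\sum_i f i `^ p) `^ p^-1 = 0 -> forall i, f i = 0.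
Proof.
move=> p0 f0 /powR_eq0_eq0/eqP; rewrite psumr_eq0; last by move=> i _; exact: powR_ge0.
by move=> /allP H i; apply: (@powR_eq0_eq0 _ _ p); apply/eqP/H; rewrite mem_index_enum.
Qed.

Lemma lp_normalize (I : finType) (f : I -> R) p : 0 < p -> (forall i, 0 <= f i) ->
  0 < (\sum_i f i `^ p) `^ p^-1 ->
  \sum_i (f i / (\sum_i f i `^ p) `^ p^-1) `^ p = 1.
Proof.
move=> p0 f0; have F0 : 0 <= \sum_i f i `^ p by apply: sumr_ge0 => i _; exact: powR_ge0.
have := powRKV p0 F0; move: ((\sum_i f i `^ p) `^ p^-1) => X XE X0.
under eq_bigr do rewrite powRM ?invr_ge0 ?(ltW X0)//.
by rewrite -mulr_suml -XE -powRM ?invr_ge0 ?(ltW X0)// divff ?gt_eqF// powR1.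
Qed.

Lemma hoelder_sum (I : finType) (x y : I -> R) p q :
  (forall i, 0 <= x i) -> (forall i, 0 <= y i) ->
  0 < p -> 0 < q -> p^-1 + q^-1 = 1 ->
  \sum_i x i * y i <=
  (\sum_i x i `^ p) `^ p^-1 * (\sum_i y i `^ q) `^ q^-1.
Proof.
move=> x0 y0 p0 q0 pq.
have := lp_norm_eq0 p0 x0; have := lp_norm_eq0 q0 y0.
have := lp_normalize p0 x0; have := lp_normalize q0 y0.
have := powR_ge0 (\sum_i x i `^ p) p^-1; have := powR_ge0 (\sum_i y i `^ q) q^-1.
set X := (\sum_i x i `^ p) `^ p^-1; set Y := (\sum_i y i `^ q) `^ q^-1.
clearbody X Y; rewrite le_eqVlt => /predU1P[<- _ _ _ /(_ erefl) h _|Yp].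
  by rewrite mulr0 big1// => i _; rewrite h mulr0.
rewrite le_eqVlt => /predU1P[<- _ _ _ /(_ erefl) h|Xp].
  by rewrite mul0r big1// => i _; rewrite h mul0r.
move=> /(_ Yp) yE /(_ Xp) xE _ _.
suff : \sum_i (x i / X) * (y i / Y) <= 1.
  move=> H; have : (\sum_i (x i / X) * (y i / Y)) * (X * Y) <= 1 * (X * Y).
    by rewrite ler_wpM2r// mulr_ge0// ltW.
  rewrite mul1r; apply: le_trans; rewrite mulr_suml; apply: ler_sum => i _.
  by rewrite le_eqVlt; apply/predU1P; left; field; rewrite !gt_eqF.
apply: (@le_trans _ _ (\sum_i ((x i / X) `^ p / p + (y i / Y) `^ q / q))).
  by apply: ler_sum => i _; apply: conjugate_powR => //; rewrite divr_ge0// ltW.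
by rewrite big_split/= -!mulr_suml xE yE !mul1r pq.
Qed.

Lemma minkowski_sum (I : finType) (x y : I -> R) p : 1 <= p ->
  (forall i, 0 <= x i) -> (forall i, 0 <= y i) ->
  (\sum_i (x i + y i) `^ p) `^ p^-1 <=
  (\sum_i x i `^ p) `^ p^-1 + (\sum_i y i `^ p) `^ p^-1.
Proof.
move=> p1 x0 y0; have p0 : 0 < p by lra.
have [X0|X0] := eqVneq ((\sum_i x i `^ p) `^ p^-1) 0.
  by under eq_bigr do rewrite (lp_norm_eq0 p0 x0 X0) add0r; rewrite X0 add0r.
have [Y0|Y0] := eqVneq ((\sum_i y i `^ p) `^ p^-1) 0.
  by under eq_bigr do rewrite (lp_norm_eq0 p0 y0 Y0) addr0; rewrite Y0 addr0.
have Xp := powR_ge0 (\sum_i x i `^ p) p^-1; rewrite le_eqVlt eq_sym (negbTE X0)/= in Xp.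
have Yp := powR_ge0 (\sum_i y i `^ p) p^-1; rewrite le_eqVlt eq_sym (negbTE Y0)/= in Yp.
have xE := lp_normalize p0 x0 Xp; have yE := lp_normalize p0 y0 Yp.
move: ((\sum_i x i `^ p) `^ p^-1) ((\sum_i y i `^ p) `^ p^-1) Xp Yp xE yE {X0 Y0}.
move=> X Y Xp Yp xE yE; have XYp : 0 < X + Y by rewrite addr_gt0.
suff H : \sum_i (x i + y i) `^ p <= (X + Y) `^ p.
  rewrite -[leRHS](powRVK p0) ?(ltW XYp)//; apply: powR_mono _ _ H.
    by rewrite invr_ge0 ltW.
  by apply: sumr_ge0 => i _; exact: powR_ge0.
(* x_i + y_i is X + Y times the mean, with weights X / (X + Y) and Y / (X + Y), of the normalized
   entries x_i / X and y_i / Y. *)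
pose d (b : bool) := (if b then X else Y) / (X + Y).
have dsum : \sum_b d b <= 1 by rewrite big_bool /d/= -mulrDl divff ?gt_eqF.
have d0 b : 0 <= d b by rewrite /d divr_ge0 ?(ltW XYp)//; case: b; exact/ltW.
apply: (@le_trans _ _ (\sum_i (X + Y) `^ p * (X / (X + Y) * (x i / X) `^ p +
                       Y / (X + Y) * (y i / Y) `^ p))).
  apply: ler_sum => i _.
  have -> : x i + y i = (X + Y) * (\sum_b d b * (if b then x i / X else y i / Y)).
    by rewrite big_bool /d/=; field; rewrite !gt_eqF.
  have z0 b : 0 <= if b then x i / X else y i / Y by case: b; rewrite divr_ge0// ltW.
  rewrite powRM ?(ltW XYp)//; last by apply: sumr_ge0 => b _; rewrite mulr_ge0.
  rewrite ler_wpM2l ?powR_ge0//.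
  by apply: le_trans (powR_jensen p1 d0 z0 dsum) _; rewrite big_bool.
rewrite -mulr_sumr big_split/= -!mulr_sumr xE yE.
by rewrite !mulr1 -mulrDl divff ?gt_eqF// mulr1.
Qed.

Lemma sum_powR_le (I : finType) (t : I -> R) p : 1 <= p ->
  (forall i, 0 <= t i) -> \sum_i t i `^ p <= (\sum_i t i) `^ p.
Proof.
move=> p1 t0; have p0 : 0 < p by lra.
set T := \sum_i t i.
have T0 : 0 <= T by apply: sumr_ge0.
rewrite -mulr_powRB1// /T mulr_suml; apply: ler_sum => i _.
rewrite -mulr_powRB1// ler_wpM2l//.
have : t i <= \sum_i t i by rewrite (bigD1 i)//= lerDl sumr_ge0.
by move=> ?; rewrite ge0_ler_powR ?nnegrE// subr_ge0.
Qed.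

End PowerInequalities.

(** * The Loewner order *)

Section Loewner.
Context {C : numClosedFieldType}.

Definition adjmx m n (A : 'M[C]_(m, n)) : 'M[C]_(n, m) := map_mx Num.conj A^T.
Local Notation "A ^H" := (adjmx A).

Lemma adjmxE m n (A : 'M[C]_(m, n)) i j : A^H i j = (A j i)^*.
Proof. by rewrite !mxE. Qed.

Lemma adjmxK m n (A : 'M[C]_(m, n)) : A^H^H = A.
Proof. by apply/matrixP => i j; rewrite !adjmxE conjCK. Qed.

Lemma adjmxM m n p (A : 'M[C]_(m, n)) (B : 'M[C]_(n, p)) : (A *m B)^H = B^H *m A^H.
Proof. by rewrite /adjmx trmx_mul map_mxM. Qed.

Lemma adjmxD m n (A B : 'M[C]_(m, n)) : (A + B)^H = A^H + B^H.
Proof. by rewrite /adjmx linearD/= map_mxD. Qed.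

Lemma adjmxN m n (A : 'M[C]_(m, n)) : (- A)^H = - A^H.
Proof. by rewrite /adjmx linearN/= map_mxN. Qed.

Lemma adjmxB m n (A B : 'M[C]_(m, n)) : (A - B)^H = A^H - B^H.
Proof. by rewrite adjmxD adjmxN. Qed.

Lemma adjmxZ m n a (A : 'M[C]_(m, n)) : (a *: A)^H = a^* *: A^H.
Proof. by apply/matrixP => i j; rewrite !mxE rmorphM. Qed.

Lemma adjmx1 n : (1%:M : 'M[C]_n)^H = 1%:M.
Proof. by rewrite /adjmx trmx1 map_mx1. Qed.

Lemma adjmx0 m n : (0 : 'M[C]_(m, n))^H = 0.
Proof. by rewrite /adjmx trmx0 map_mx0. Qed.

Lemma adjmx_diag n (d : 'rV[C]_n) : (forall i, (d 0 i)^* = d 0 i) ->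
  (diag_mx d)^H = diag_mx d.
Proof.
move=> dr; apply/matrixP => i j; rewrite adjmxE !mxE eq_sym.
by case: eqP => [->|_]; rewrite ?mulr1n ?mulr0n ?rmorph0.
Qed.

Lemma addmxE m n (A B : 'M[C]_(m, n)) i j : (A + B) i j = A i j + B i j.
Proof. by rewrite mxE. Qed.

Lemma oppmxE m n (A : 'M[C]_(m, n)) i j : (- A) i j = - A i j.
Proof. by rewrite mxE. Qed.

Lemma scalemxE m n a (A : 'M[C]_(m, n)) i j : (a *: A) i j = a * A i j.
Proof. by rewrite mxE. Qed.

(** In a [numClosedFieldType], [0 <= z] includes that z is real; this is how the definition forces H
    to be Hermitian. *)
Definition psdmx n (H : 'M[C]_n) := forall x : 'cV[C]_n, 0 <= (x^H *m H *m x) 0 0.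

Definition contrmx m n (A : 'M[C]_(m, n)) := psdmx (1%:M - A^H *m A).

Lemma form_adjmx n (H : 'M[C]_n) (x : 'cV[C]_n) :
  (x^H *m H^H *m x) 0 0 = ((x^H *m H *m x) 0 0)^*.
Proof. by rewrite -(adjmxE (x^H *m H *m x)) !adjmxM adjmxK mulmxA. Qed.

Lemma gram_diagE m (x : 'cV[C]_m) : (x^H *m x) 0 0 = \sum_i `|x i 0| ^+ 2.
Proof. by rewrite mxE; apply: eq_bigr => i _; rewrite adjmxE normCKC. Qed.

Lemma gram_ge0 m (x : 'cV[C]_m) : 0 <= (x^H *m x) 0 0.
Proof. by rewrite gram_diagE sumr_ge0// => i _; rewrite exprn_ge0. Qed.

Lemma psdmxD n (A B : 'M[C]_n) : psdmx A -> psdmx B -> psdmx (A + B).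
Proof. by move=> a b x; rewrite mulmxDr mulmxDl mxE addr_ge0. Qed.

Lemma psdmx_conj m n (A : 'M[C]_n) (B : 'M[C]_(n, m)) :
  psdmx A -> psdmx (B^H *m A *m B).
Proof. by move=> a x; have := a (B *m x); rewrite adjmxM !mulmxA. Qed.

Lemma psdmx_gram m n (B : 'M[C]_(n, m)) : psdmx (B^H *m B).
Proof. by move=> x; have := gram_ge0 (B *m x); rewrite adjmxM !mulmxA. Qed.

Lemma psdmxZ n a (A : 'M[C]_n) : 0 <= a -> psdmx A -> psdmx (a *: A).
Proof. by move=> a0 A0 x; rewrite -scalemxAr -scalemxAl mxE mulr_ge0. Qed.

Lemma psdmx0 n : psdmx (0 : 'M[C]_n).
Proof. by move=> x; rewrite mulmx0 mul0mx mxE. Qed.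

Lemma psdmx_diag n (d : 'rV[C]_n) : (forall i, 0 <= d 0 i) -> psdmx (diag_mx d).
Proof.
move=> d0 x; rewrite mxE; apply: sumr_ge0 => i _.
rewrite mul_mx_diag mxE adjmxE mulrAC -normCKC mulr_ge0// exprn_ge0//.
Qed.

Lemma psdmx_entry n (A : 'M[C]_n) i : psdmx A -> 0 <= A i i.
Proof.
move=> /(_ (delta_mx i 0)).
rewrite -colE 2!mxE (bigD1 i)//= big1 ?addr0; last first.
  by move=> j ji; rewrite adjmxE !mxE (negbTE ji) rmorph0 mul0r.
by rewrite adjmxE !mxE !eqxx/= rmorph1 mul1r.
Qed.

(** With P = A A^H, the identity 1 - P = (1 - P)^2 + A (1 - A^H A) A^H writes the defect of A^H as a
    sum of two positive matrices. *)
Lemma contrmx_adj m n (A : 'M[C]_(m, n)) : contrmx A -> contrmx A^H.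
Proof.
rewrite /contrmx => cA; rewrite adjmxK.
have -> : 1%:M - A *m A^H =
   (1%:M - A *m A^H)^H *m (1%:M - A *m A^H) + A^H^H *m (1%:M - A^H *m A) *m A^H.
  rewrite adjmxB adjmx1 adjmxM adjmxK; set P := A *m A^H.
  have -> : A *m (1%:M - A^H *m A) *m A^H = P - P *m P.
    by rewrite mulmxBr mulmx1 mulmxBl /P !mulmxA.
  by rewrite mulmxBr mulmx1 mulmxBl mul1mx subrK.
by apply: psdmxD; [exact: psdmx_gram|exact: psdmx_conj].
Qed.

Lemma contrmxM m n p (A : 'M[C]_(m, n)) (B : 'M[C]_(n, p)) :
  contrmx A -> contrmx B -> contrmx (A *m B).
Proof.
rewrite /contrmx => cA cB.
have -> : 1%:M - (A *m B)^H *m (A *m B) =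
    (1%:M - B^H *m B) + B^H *m (1%:M - A^H *m A) *m B.
  by rewrite adjmxM mulmxBr mulmx1 mulmxBl !mulmxA addrA subrK.
by apply: psdmxD => //; exact: psdmx_conj.
Qed.

Lemma contrmx_isometry m n (A : 'M[C]_(m, n)) : A^H *m A = 1%:M -> contrmx A.
Proof. by rewrite /contrmx => ->; rewrite subrr; exact: psdmx0. Qed.

Lemma contrmx1 n : contrmx (1%:M : 'M[C]_n).
Proof. by apply: contrmx_isometry; rewrite adjmx1 mulmx1. Qed.

Lemma contrmx_diag n (d : 'rV[C]_n) : (forall i, `|d 0 i| <= 1) -> contrmx (diag_mx d).
Proof.
move=> d1; rewrite /contrmx.
have -> : 1%:M - (diag_mx d)^H *m diag_mx d = diag_mx (\row_i (1 - `|d 0 i| ^+ 2)).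
  apply/matrixP => i j; rewrite mul_mx_diag !mxE.
  have [->|_] := eqVneq i j; last by rewrite !mulr0n rmorph0 mul0r subr0.
  by rewrite !mulr1n normCKC.
by apply: psdmx_diag => i; rewrite mxE subr_ge0 exprn_ile1.
Qed.

(* Polarization: a form that is real-valued on the diagonal is Hermitian. *)
Lemma psdmx_hermitian n (H : 'M[C]_n) : psdmx H -> H^H = H.
Proof.
move=> psdH.
have real (x : 'cV_n) : (x^H *m (H^H - H) *m x) 0 0 = 0.
  rewrite mulmxBr mulmxBl addmxE oppmxE form_adjmx.
  by have /ger0_real/CrealP -> := psdH x; rewrite subrr.
apply/eqP; rewrite -subr_eq0; apply/eqP; move: (H^H - H) real => K real.
pose e i : 'cV[C]_n := delta_mx i 0.
have eKe i j : ((e i)^H *m K *m e j) 0 0 = K i j.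
  rewrite -colE 2!mxE (bigD1 i)//= big1 ?addr0; last first.
    by move=> k ki; rewrite adjmxE !mxE (negbTE ki) rmorph0 mul0r.
  by rewrite adjmxE !mxE !eqxx/= rmorph1 mul1r.
have fD (x y : 'cV_n) a : ((x + a *: y)^H *m K *m (x + a *: y)) 0 0 =
    a * (x^H *m K *m y) 0 0 + a^* * (y^H *m K *m x) 0 0.
  transitivity ((x^H *m K *m x + a *: (x^H *m K *m y) + a^* *: (y^H *m K *m x)
     + (a^* * a) *: (y^H *m K *m y)) 0 0).
    congr (fun_of_matrix _ 0 0).
    rewrite adjmxD adjmxZ !mulmxDl !mulmxDr -!scalemxAl -!scalemxAr scalerA.
    by rewrite !addrA addrAC (addrAC (_ + _) _ (a^* *: _)).
  by rewrite !addmxE !scalemxE !real mulr0 add0r addr0.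
apply/matrixP => i j; rewrite [RHS]mxE.
have h1 : K i j + K j i = 0.
  by have := real (e i + 1 *: e j); rewrite fD !eKe rmorph1 !mul1r.
have h2 : K i j - K j i = 0.
  have := real (e i + 'i *: e j); rewrite fD !eKe conjCi mulNr -mulrBr => /eqP.
  by rewrite mulf_eq0 (negbTE (neq0Ci C))/= => /eqP.
have : K i j *+ 2 = 0 by rewrite mulr2n -[X in X + _](subrK (K j i)) h2 add0r addrC.
by move/eqP; rewrite mulrn_eq0/= => /eqP.
Qed.

End Loewner.

Local Notation nc := Normc.normc.
Local Notation "A ^H" := (adjmx A).
Local Notation "x %:C" := (real_complex _ x) : ring_scope.

(** * Singular values and Schatten norms of finite matrices *)

Section Modulus.
Context {R : realType}.
Local Notation C := R[i].
Implicit Types z w : C.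

Lemma normcC z : `|z| = (nc z)%:C. Proof. by []. Qed.

Lemma nc_ge0 z : 0 <= nc z.
Proof. by case: z => a b; exact: sqrtr_ge0. Qed.

Lemma ncM z w : nc (z * w) = nc z * nc w.
Proof. exact: Normc.normcM. Qed.

Lemma ncD z w : nc (z + w) <= nc z + nc w.
Proof. exact: le_normcD. Qed.

Lemma ncJ z : nc (z^*)%R = nc z.
Proof. by apply: complexI; rewrite -!normcC norm_conjC. Qed.

Lemma ncR (x : R) : nc (x%:C) = `|x|.
Proof. by rewrite /= expr0n/= addr0 sqrtr_sqr. Qed.

Lemma nc0 : nc (0 : C) = 0.
Proof. by rewrite -[0 : C]/((0 : R)%:C) ncR normr0. Qed.

Lemma ncN z : nc (- z) = nc z.
Proof. by apply: complexI; rewrite -!normcC normrN. Qed.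

Lemma nc_sum (I : Type) (r : seq I) (P : pred I) (F : I -> C) :
  nc (\sum_(i <- r | P i) F i) <= \sum_(i <- r | P i) nc (F i).
Proof.
elim/big_ind2: _ => //; first by rewrite nc0.
by move=> a b c d h1 h2; apply: le_trans (ncD _ _) _; exact: lerD.
Qed.

Lemma nc_conjM z : (nc z ^+ 2)%:C = z^* * z.
Proof. by rewrite rmorphXn/= -normcC normCKC. Qed.

Lemma real_complex_conj (x : R) : ((x%:C : C)^*)%R = x%:C.
Proof. exact: conjc_real. Qed.

Lemma complexRe_id z : (z^*)%R = z -> (complex.Re z)%:C = z.
Proof. by move=> zr; rewrite RRe_real//; apply/CrealP. Qed.

End Modulus.

(** * Singular value decomposition, pinching and trace duality *)

Section SingularValues.
Context {R : realType}.
Local Notation C := R[i].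

Definition rdiag n (d : 'I_n -> R) : 'M[C]_n := diag_mx (\row_i (d i)%:C).

Lemma rdiagE n (d : 'I_n -> R) i : rdiag d i i = (d i)%:C.
Proof. by rewrite !mxE eqxx mulr1n. Qed.

Lemma rdiagM n (d e : 'I_n -> R) : rdiag d *m rdiag e = rdiag (fun i => d i * e i).
Proof.
rewrite /rdiag mulmx_diag; congr diag_mx.
by apply/rowP => i; rewrite !mxE rmorphM.
Qed.

Lemma adj_rdiag n (d : 'I_n -> R) : (rdiag d)^H = rdiag d.
Proof. by apply: adjmx_diag => i; rewrite mxE real_complex_conj. Qed.

Lemma rdiag_psd n (d : 'I_n -> R) : (forall i, 0 <= d i) -> psdmx (rdiag d).
Proof. by move=> d0; apply: psdmx_diag => i; rewrite mxE ler0c. Qed.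

Lemma rdiag_contr n (d : 'I_n -> R) : (forall i, `|d i| <= 1) -> contrmx (rdiag d).
Proof. by move=> d1; apply: contrmx_diag => i; rewrite mxE normcC ncR lecR. Qed.

Lemma rdiag1 n : rdiag (fun=> 1) = 1%:M :> 'M[C]_n.
Proof.
by rewrite /rdiag -diag_const_mx; congr diag_mx; apply/rowP => i; rewrite !mxE.
Qed.

Lemma rdiagB n (d e : 'I_n -> R) : rdiag d - rdiag e = rdiag (fun i => d i - e i).
Proof.
by rewrite /rdiag -raddfB; congr diag_mx; apply/rowP => i; rewrite !mxE rmorphB.
Qed.

Lemma mxtrace_rdiagM n (d : 'I_n -> R) (A : 'M[C]_n) :
  \tr (rdiag d *m A) = \sum_i (d i)%:C * A i i.
Proof. by apply: eq_bigr => i _; rewrite mul_diag_mx !mxE. Qed.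

Lemma spectral_hermitian n (H : 'M[C]_n) : H^H = H ->
  exists (W : 'M[C]_n) (d : 'I_n -> R),
    [/\ W^H *m W = 1%:M, W *m W^H = 1%:M & H = W^H *m rdiag d *m W].
Proof.
move=> hH.
have HN : H \is normalmx by apply/normalmxP; rewrite -[map_mx _ _]/(H^H) hH.
pose W := spectralmx H.
have uW : W \is unitarymx by exact: spectral_unitarymx.
have WW : W *m W^H = 1%:M by exact/unitarymxP.
have WW' : W^H *m W = 1%:M by rewrite mulmx1C.
have HE := orthomx_spectralP HN.
rewrite -/W invmx_unitary// -[map_mx _ _]/(W^H) in HE.
have dE : W *m H *m W^H = diag_mx (spectral_diag H).
  by rewrite {1}HE !mulmxA WW mul1mx -mulmxA WW mulmx1.
exists W, (fun i => complex.Re (spectral_diag H 0 i)); split; [exact: WW'|exact: WW|].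
suff -> : rdiag (fun i => complex.Re (spectral_diag H 0 i)) = diag_mx (spectral_diag H).
  exact: HE.
congr diag_mx; apply/rowP => i; rewrite mxE complexRe_id//.
have : (diag_mx (spectral_diag H))^H = diag_mx (spectral_diag H).
  by rewrite -dE !adjmxM adjmxK hH mulmxA.
by move=> /matrixP/(_ i i); rewrite adjmxE !mxE eqxx mulr1n.
Qed.

Lemma spectral_psd n (H : 'M[C]_n) : psdmx H ->
  exists (W : 'M[C]_n) (d : 'I_n -> R),
    [/\ W^H *m W = 1%:M, W *m W^H = 1%:M, H = W^H *m rdiag d *m W &
    forall i, 0 <= d i].
Proof.
move=> H0; have [W [d [w1 w2 HE]]] := spectral_hermitian (psdmx_hermitian H0).
exists W, d; split => // i.
have := psdmx_entry i (psdmx_conj (W^H) H0).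
by rewrite adjmxK HE !mulmxA w2 mul1mx -mulmxA w2 mulmx1 rdiagE ler0c.
Qed.

(** The diagonal of B^H B consists of the squared norms of the columns. The hypothesis has the form
    left by conjugating a Loewner inequality with a matrix that kills its larger side, as in
    [spow_mono]. *)
Lemma gram_mx_eq0 m n (B : 'M[C]_(m, n)) : psdmx (- (B^H *m B)) -> B = 0.
Proof.
move=> B0; apply/matrixP => i j; rewrite [RHS]mxE.
have := psdmx_entry j B0; rewrite oppmxE oppr_ge0 mxE.
under eq_bigr do rewrite adjmxE -normCKC.
move=> h; have : \sum_k `|B k j| ^+ 2 = 0.
  by apply/eqP; rewrite eq_le h sumr_ge0// => k _; rewrite exprn_ge0.
move/eqP; rewrite psumr_eq0; last by move=> k _; rewrite exprn_ge0.
move=> /allP/(_ i (mem_index_enum _)).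
by rewrite expf_eq0/= normr_eq0 => /eqP.
Qed.

(** Diagonalize A^H A = W^H diag(d) W and put s = sqrt d, U = A W^H diag(1 / s). As 0^-1 = 0, the
    columns of U at vanishing singular values are 0; U^H U is the diagonal matrix of the indicators
    e, and U is a contraction. *)
Lemma svd_subproof m n (A : 'M[C]_(m, n)) : exists s : 'I_n -> R,
  (forall i, 0 <= s i) /\ exists (U : 'M[C]_(m, n)) (W : 'M[C]_n),
  [/\ contrmx U, W^H *m W = 1%:M, W *m W^H = 1%:M, A = U *m rdiag s *m W &
      U^H *m A = rdiag s *m W].
Proof.
have [W [d [w1 w2 HE d0]]] := spectral_psd (psdmx_gram A).
pose s i := Num.sqrt (d i).
have ss i : s i * s i = d i by rewrite -expr2 sqr_sqrtr.
pose t i := (s i)^-1.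
pose e i := (s i)^-1 * s i.
have sE i : e i * s i = s i.
  by rewrite /e; have [->|sn] := eqVneq (s i) 0; rewrite ?mulr0// mulVf// mul1r.
pose B := A *m W^H.
have BB : B^H *m B = rdiag d.
  rewrite /B adjmxM adjmxK mulmxA -(mulmxA W) HE !mulmxA w2 mul1mx.
  by rewrite -mulmxA w2 mulmx1.
(* The Gram matrix of B (e - 1) is diag ((e - 1)^2 d), which vanishes since d = s^2 is zero wherever
   e is. *)
have BE : B *m rdiag e = B.
  apply/eqP; rewrite -subr_eq0; apply/eqP; apply: gram_mx_eq0.
  have -> : B *m rdiag e - B = B *m rdiag (fun i => e i - 1).
    by rewrite -rdiagB rdiag1 mulmxBr mulmx1.
  rewrite adjmxM adj_rdiag mulmxA -(mulmxA _ B^H) BB !rdiagM.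
  have -> : rdiag (fun i => (e i - 1) * d i * (e i - 1)) = 0.
    apply/matrixP => i j; rewrite !mxE -ss.
    have -> : (e i - 1) * (s i * s i) = (e i * s i - s i) * s i by ring.
    by rewrite sE subrr !mul0r mul0rn.
  by rewrite oppr0; exact: psdmx0.
exists s; split; first by move=> i; exact: sqrtr_ge0.
pose U := B *m rdiag t.
have UU : U^H *m U = rdiag e.
  rewrite /U adjmxM adj_rdiag mulmxA -(mulmxA _ B^H) BB !rdiagM.
  congr rdiag; apply/funext => i; rewrite -ss /t /e.
  by have [->|sn] := eqVneq (s i) 0; [rewrite !(mulr0, mul0r)|field].
have AE : A = U *m rdiag s *m W.
  by rewrite /U -(mulmxA B) rdiagM BE /B -mulmxA w1 mulmx1.
clearbody U.
exists U, W; split; [|exact: w1|exact: w2|exact: AE|].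
  rewrite /contrmx UU -rdiag1 rdiagB; apply: rdiag_psd => i.
  by rewrite /e; have [->|sn] := eqVneq (s i) 0; rewrite ?mulr0 ?subr0// mulVf// subrr.
rewrite {1}AE !mulmxA UU rdiagM; congr (rdiag _ *m _).
by apply/funext => i.
Qed.

(** Obtained by choice, in no particular order; accessed only through [svals_ge0] and [svd]. *)
Definition svals m n (A : 'M[C]_(m, n)) : 'I_n -> R := sval (cid (svd_subproof A)).

Lemma svals_ge0 m n (A : 'M[C]_(m, n)) i : 0 <= svals A i.
Proof. by rewrite /svals; case: cid => s []. Qed.

Lemma svd m n (A : 'M[C]_(m, n)) : exists (U : 'M[C]_(m, n)) (W : 'M[C]_n),
  [/\ contrmx U, W^H *m W = 1%:M, W *m W^H = 1%:M, A = U *m rdiag (svals A) *m W &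
      U^H *m A = rdiag (svals A) *m W].
Proof. by rewrite /svals; case: cid => s []. Qed.

Definition spow m n (p : R) (A : 'M[C]_(m, n)) : R := \sum_i svals A i `^ p.

Definition snorm m n (p : R) (A : 'M[C]_(m, n)) : R := spow p A `^ p^-1.

Lemma spow_ge0 m n p (A : 'M[C]_(m, n)) : 0 <= spow p A.
Proof. by apply: sumr_ge0 => i _; exact: powR_ge0. Qed.

Lemma snorm_ge0 m n p (A : 'M[C]_(m, n)) : 0 <= snorm p A.
Proof. exact: powR_ge0. Qed.

Lemma gram_colE m n (B : 'M[C]_(m, n)) i : (B^H *m B) i i = (\sum_k nc (B k i) ^+ 2)%:C.
Proof. by rewrite mxE rmorph_sum/=; apply: eq_bigr => k _; rewrite adjmxE nc_conjM. Qed.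

Lemma contrmx_col_le m n (B : 'M[C]_(m, n)) i : contrmx B -> \sum_k nc (B k i) ^+ 2 <= 1.
Proof.
move=> /(psdmx_entry i); rewrite addmxE oppmxE mxE eqxx gram_colE.
by rewrite mulr1n -[1 : C]/((1 : R)%:C) -rmorphB ler0c subr_ge0.
Qed.

Lemma contrmx_row_le m n (B : 'M[C]_(m, n)) k : contrmx B -> \sum_i nc (B k i) ^+ 2 <= 1.
Proof.
move=> /contrmx_adj/(contrmx_col_le k).
by under eq_bigr do rewrite adjmxE ncJ.
Qed.

(* The weights |(UP)_ki| |(QV)_ik| form a doubly substochastic array, so the
   inequality follows from the convexity of t^p. *)
Lemma pinching m n r k (P : 'M[C]_(m, r)) (s : 'I_r -> R) (Q : 'M[C]_(r, n))
    (U : 'M[C]_(k, m)) (V : 'M[C]_(n, k)) p : 1 <= p ->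
  contrmx P -> contrmx Q -> contrmx U -> contrmx V -> (forall i, 0 <= s i) ->
  \sum_j nc ((U *m (P *m rdiag s *m Q) *m V) j j) `^ p <= \sum_i s i `^ p.
Proof.
move=> p1 cP cQ cU cV s0; have p0 : 0 <= p by lra.
have cG := contrmxM cU cP; have cH := contrmxM cQ cV.
set G := U *m P in cG; set H := Q *m V in cH.
have -> : U *m (P *m rdiag s *m Q) *m V = G *m rdiag s *m H by rewrite /G /H !mulmxA.
clearbody G H.
pose d j i := nc (G j i) * nc (H i j).
have d0 j i : 0 <= d j i by rewrite mulr_ge0 ?nc_ge0.
have amgm (I : finType) (x y : I -> R) : \sum_i x i ^+ 2 <= 1 ->
    \sum_i y i ^+ 2 <= 1 -> \sum_i x i * y i <= 1.
  move=> x1 y1; apply: (@le_trans _ _ (\sum_i (x i ^+ 2 + y i ^+ 2) / 2)).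
    apply: ler_sum => i _; have := sqr_ge0 (x i - y i); rewrite sqrrB mulr2n => ?.
    by rewrite ler_pdivlMr// mulr_natr mulr2n; lra.
  by rewrite -mulr_suml big_split/=; lra.
have dr j : \sum_i d j i <= 1 := amgm _ _ _ (contrmx_row_le j cG) (contrmx_col_le j cH).
have dc i : \sum_j d j i <= 1 := amgm _ _ _ (contrmx_col_le i cG) (contrmx_row_le i cH).
apply: (@le_trans _ _ (\sum_j \sum_i d j i * s i `^ p)).
  apply: ler_sum => j _; apply: le_trans (powR_jensen p1 (d0 j) s0 (dr j)).
  rewrite ge0_ler_powR ?nnegrE ?nc_ge0//.
    by apply: sumr_ge0 => i _; rewrite mulr_ge0.
  rewrite mul_mx_diag mxE; apply: le_trans (nc_sum _ _ _) _.
  apply: ler_sum => i _; rewrite !mxE !ncM ncR (ger0_norm (s0 i)) /d.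
  by rewrite mulrAC.
rewrite exchange_big/=; apply: ler_sum => i _.
by rewrite -mulr_suml ler_piMl ?powR_ge0.
Qed.

(** [pinching] with the singular vectors of the product itself, which put its singular values on the
    diagonal. Any factorization through contractions thus bounds the norm. *)
Lemma spow_decomp_le m n r (P : 'M[C]_(m, r)) (s : 'I_r -> R) (Q : 'M[C]_(r, n)) p :
  1 <= p -> contrmx P -> contrmx Q -> (forall i, 0 <= s i) ->
  spow p (P *m rdiag s *m Q) <= \sum_i s i `^ p.
Proof.
move=> p1 cP cQ s0; have [U [W [cU w1 w2 AE UA]]] := svd (P *m rdiag s *m Q).
have := @pinching _ _ _ _ P s Q (U^H) (W^H) p p1 cP cQ (contrmx_adj cU)
  (contrmx_adj (contrmx_isometry w1)) s0.
rewrite UA -mulmxA w2 mulmx1; apply: le_trans.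
by apply: ler_sum => i _; rewrite rdiagE ncR ger0_norm ?svals_ge0.
Qed.

Lemma spow_pinching m n k (A : 'M[C]_(m, n)) (U : 'M[C]_(k, m)) (V : 'M[C]_(n, k)) p :
  1 <= p -> contrmx U -> contrmx V ->
  \sum_j nc ((U *m A *m V) j j) `^ p <= spow p A.
Proof.
move=> p1 cU cV; have [U' [W [cU' w1 w2 AE UA]]] := svd A.
rewrite {1}AE.
exact: (pinching p1 cU' (contrmx_isometry w1) cU cV (svals_ge0 A)).
Qed.

(** Together with [spow_pinching] this makes [spow p A] a maximum over pairs of contractions,
    attained by one pair for all p; the triangle inequality then reduces to Minkowski's for finite
    sums. *)
Lemma spow_attained m n (A : 'M[C]_(m, n)) : exists (U : 'M[C]_(n, m)) (V : 'M[C]_n),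
  [/\ contrmx U, contrmx V & forall p, spow p A = \sum_j nc ((U *m A *m V) j j) `^ p].
Proof.
have [U [W [cU w1 w2 AE UA]]] := svd A.
exists (U^H), (W^H); split; first exact: contrmx_adj.
  exact/contrmx_adj/contrmx_isometry.
move=> p; rewrite UA -mulmxA w2 mulmx1.
by apply: eq_bigr => i _; rewrite rdiagE ncR ger0_norm ?svals_ge0.
Qed.

Lemma spow_contr m n m' n' (A : 'M[C]_(m, n)) (D : 'M[C]_(m', m)) (E : 'M[C]_(n, n')) p :
  1 <= p -> contrmx D -> contrmx E -> spow p (D *m A *m E) <= spow p A.
Proof.
move=> p1 cD cE; have [U [V [cU cV ->]]] := spow_attained (D *m A *m E).
have -> : U *m (D *m A *m E) *m V = (U *m D) *m A *m (E *m V) by rewrite !mulmxA.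
exact: (spow_pinching A p1 (contrmxM cU cD) (contrmxM cE cV)).
Qed.

Lemma spow_adj m n (A : 'M[C]_(m, n)) p : 1 <= p -> spow p (A^H) = spow p A.
Proof.
move=> p1.
have le m' n' (B : 'M[C]_(m', n')) : spow p (B^H) <= spow p B.
  have [U [V [cU cV ->]]] := spow_attained (B^H).
  have := spow_pinching B p1 (contrmx_adj cV) (contrmx_adj cU); apply: le_trans.
  apply: ler_sum => j _.
  have -> : U *m B^H *m V = (V^H *m B *m U^H)^H by rewrite !adjmxM !adjmxK mulmxA.
  by rewrite adjmxE ncJ.
by apply/eqP; rewrite eq_le le -{1}[A]adjmxK le.
Qed.

Lemma snormE m n p (A : 'M[C]_(m, n)) : 0 < p -> snorm p A `^ p = spow p A.
Proof. by move=> p0; rewrite /snorm powRKV ?spow_ge0. Qed.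

Lemma snorm_le m n m' n' p (A : 'M[C]_(m, n)) (B : 'M[C]_(m', n')) : 0 < p ->
  spow p A <= spow p B -> snorm p A <= snorm p B.
Proof. by move=> p0 h; apply: powR_mono (spow_ge0 _ _) h; rewrite invr_ge0 ltW. Qed.

Lemma spow_le_snorm m n p (A : 'M[C]_(m, n)) K : 0 < p -> 0 <= K ->
  snorm p A <= K -> spow p A <= K `^ p.
Proof.
by move=> p0 K0 h; rewrite -snormE//; exact: powR_mono (ltW p0) (snorm_ge0 _ _) h.
Qed.

Lemma snorm_le_spow m n p (A : 'M[C]_(m, n)) K : 0 < p -> 0 <= K ->
  spow p A <= K `^ p -> snorm p A <= K.
Proof.
move=> p0 K0 h; rewrite -(powRVK p0 K0).
by apply: powR_mono (spow_ge0 _ _) h; rewrite invr_ge0 ltW.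
Qed.

Lemma snorm_triangle m n p (A B : 'M[C]_(m, n)) : 1 <= p ->
  snorm p (A + B) <= snorm p A + snorm p B.
Proof.
move=> p1; have p0 : 0 < p by lra.
have [U [V [cU cV AE]]] := spow_attained (A + B).
rewrite /snorm AE.
apply: (@le_trans _ _ ((\sum_j (nc ((U *m A *m V) j j) + nc ((U *m B *m V) j j)) `^ p)
    `^ p^-1)).
  rewrite ge0_ler_powR ?nnegrE ?invr_ge0 ?(ltW p0)//.
  - by apply: sumr_ge0 => i _; exact: powR_ge0.
  - by apply: sumr_ge0 => i _; exact: powR_ge0.
  apply: ler_sum => j _.
  rewrite ge0_ler_powR ?nnegrE ?nc_ge0 ?addr_ge0 ?nc_ge0 ?(ltW p0)//.
  by rewrite mulmxDr mulmxDl mxE ncD.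
apply: le_trans (minkowski_sum p1 _ _) _; [by move=> i; exact: nc_ge0..|].
by apply: lerD; rewrite ge0_ler_powR ?nnegrE ?invr_ge0 ?(ltW p0)// ?spow_ge0//
  ?spow_pinching//; apply: sumr_ge0 => i _; exact: powR_ge0.
Qed.

Lemma snormZ m n p c (A : 'M[C]_(m, n)) : 1 <= p -> snorm p (c *: A) <= nc c * snorm p A.
Proof.
move=> p1; have p0 : 0 < p by lra.
apply: snorm_le_spow => //; first by rewrite mulr_ge0 ?nc_ge0 ?snorm_ge0.
rewrite powRM ?nc_ge0 ?snorm_ge0// snormE//.
have [U [V [cU cV ->]]] := spow_attained (c *: A).
apply: le_trans (ler_wpM2l (powR_ge0 _ _) (spow_pinching A p1 cU cV)).
rewrite mulr_sumr; apply: ler_sum => j _.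
by rewrite -scalemxAr -scalemxAl mxE ncM powRM ?nc_ge0.
Qed.

Lemma snormN m n p (A : 'M[C]_(m, n)) : 1 <= p -> snorm p (- A) <= snorm p A.
Proof.
move=> p1; have := snormZ (-1) A p1.
by rewrite scaleN1r ncN -[1 : C]/((1 : R)%:C) ncR normr1 mul1r.
Qed.

(** In the singular basis of A the trace is sum_i s_i (W B^H U)_ii; after Hoelder's inequality, the
    diagonal of W B^H U is bounded by pinching B^H. *)
Lemma trace_hoelder m n p q (A B : 'M[C]_(m, n)) : 1 <= p -> 1 <= q ->
  p^-1 + q^-1 = 1 -> nc (\tr (A *m B^H)) <= snorm p A * snorm q B.
Proof.
move=> p1 q1 pq; have p0 : 0 < p by lra. have q0 : 0 < q by lra.
have [U [W [cU w1 w2 AE UA]]] := svd A.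
rewrite {1}AE mxtrace_mulC !mulmxA mxtrace_mulC !mulmxA mxtrace_mulC.
rewrite -!mulmxA mxtrace_rdiagM; apply: le_trans (nc_sum _ _ _) _.
under eq_bigr do rewrite ncM ncR (ger0_norm (svals_ge0 _ _)).
apply: le_trans (hoelder_sum (svals_ge0 A) (fun i => nc_ge0 _) p0 q0 pq) _.
apply: (ler_wpM2l (powR_ge0 _ _)); apply: powR_mono.
- by rewrite invr_ge0 ltW.
- by apply: sumr_ge0 => i _; exact: powR_ge0.
rewrite -(spow_adj B q1).
under eq_bigr do rewrite mulmxA.
exact: (spow_pinching _ q1 (contrmx_isometry w1) cU).
Qed.

(** Test on B = U s^(p - 1) W: the trace is then the sum of the s_i^p and, since (p - 1) q = p,
    [spow q B] is at most the same sum. *)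
Lemma trace_dual m n p q (A : 'M[C]_(m, n)) K : 1 < p -> 1 < q ->
  p^-1 + q^-1 = 1 -> 0 <= K ->
  (forall B : 'M[C]_(m, n), nc (\tr (A *m B^H)) <= K * snorm q B) -> snorm p A <= K.
Proof.
move=> p1 q1 pq K0 h; have p0 : 0 < p by lra. have q0 : 0 < q by lra.
have [U [W [cU w1 w2 AE UA]]] := svd A.
pose B := U *m rdiag (fun i => svals A i `^ (p - 1)) *m W.
have trE : nc (\tr (A *m B^H)) = spow p A.
  rewrite /B !adjmxM adj_rdiag !mulmxA mxtrace_mulC !mulmxA UA -(mulmxA _ W) w2 mulmx1.
  rewrite rdiagM -[rdiag _]mulmx1 mxtrace_rdiagM.
  under eq_bigr do rewrite mxE eqxx mulr1 mulr_powRB1 ?svals_ge0//.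
  by rewrite -(rmorph_sum (real_complex R)) ncR ger0_norm ?spow_ge0.
have pqq : (p - 1) * q = p.
  have : q * (p * (p^-1 + q^-1)) = q * p by rewrite pq mulr1.
  by rewrite mulrDr mulfV ?gt_eqF// mulrDr mulrCA mulfV ?gt_eqF//; lra.
have BE : spow q B <= spow p A.
  apply: le_trans (spow_decomp_le (ltW q1) cU (contrmx_isometry w1) _) _.
    by move=> i; exact: powR_ge0.
  by apply: ler_sum => i _; rewrite -powRrM pqq.
have := h B; rewrite trE => h1.
have h2 : spow p A <= K * spow p A `^ q^-1.
  apply: le_trans h1 _; apply: (ler_wpM2l K0); apply: powR_mono (spow_ge0 _ _) BE.
  by rewrite invr_ge0 ltW.
have [A0|A0] := eqVneq (spow p A) 0.
  by rewrite /snorm A0 powR0// invr_eq0 gt_eqF.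
have Ap : 0 < spow p A by rewrite lt_def A0 spow_ge0.
rewrite -(ler_pM2r (powR_gt0 q^-1 Ap)); apply: le_trans h2.
by rewrite /snorm -powRD ?A0 ?implybT// pq powRr1 ?spow_ge0.
Qed.

(** Douglas factorization: with T the pseudo-inverse of B one has A = (A T) B, and A T is a
    contraction because B T is one and T^H (B^H B - A^H A) T >= 0. *)
Lemma spow_mono m k n (A : 'M[C]_(m, n)) (B : 'M[C]_(k, n)) p : 1 <= p ->
  psdmx (B^H *m B - A^H *m A) -> spow p A <= spow p B.
Proof.
move=> p1 AB; have [U [W [cU w1 w2 BE UB]]] := svd B.
pose s := svals B.
pose e i := (s i)^-1 * s i.
have sE i : s i * e i = s i.
  by rewrite /e; have [->|sn] := eqVneq (s i) 0; rewrite ?mul0r// mulVf// mulr1.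
pose T := W^H *m rdiag (fun i => (s i)^-1) *m U^H.
(* 1 - W^H e W projects onto the kernel of B, where A vanishes too since A^H A <= B^H B. *)
have AE : A *m (1%:M - W^H *m rdiag e *m W) = 0.
  set N := 1%:M - _.
  have BN : B *m N = 0.
    rewrite /N mulmxBr mulmx1 {2}BE !mulmxA -(mulmxA _ W) w2 mulmx1.
    rewrite -(mulmxA U) rdiagM.
    have -> : rdiag (fun i => svals B i * e i) = rdiag (svals B).
      by congr rdiag; apply/funext => i; rewrite sE.
    by rewrite -BE subrr.
  clearbody N; apply: gram_mx_eq0; have := psdmx_conj N AB.
  rewrite mulmxBr mulmxBl !mulmxA -(mulmxA _ B) BN mulmx0 sub0r.
  by rewrite adjmxM.
have TB : A *m T *m B = A.
  rewrite /T -!mulmxA UB !mulmxA -(mulmxA _ (rdiag _) (rdiag _)) rdiagM.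
  apply/eqP; rewrite eq_sym -subr_eq0; apply/eqP; rewrite -[RHS]AE mulmxBr mulmx1.
  by rewrite !mulmxA.
have cBT : contrmx (B *m T).
  rewrite /T {1}BE -!mulmxA (mulmxA W) w2 mul1mx (mulmxA (rdiag _)) rdiagM.
  apply: (contrmxM cU); apply: contrmxM; last exact: (contrmx_adj cU).
  apply: rdiag_contr => i; rewrite -/s.
  by have [->|sn] := eqVneq (s i) 0; rewrite ?mul0r ?normr0// mulfV// normr1.
clearbody T.
have cAT : contrmx (A *m T).
  rewrite /contrmx.
  have -> : 1%:M - (A *m T)^H *m (A *m T) =
      (1%:M - (B *m T)^H *m (B *m T)) + T^H *m (B^H *m B - A^H *m A) *m T.
    by rewrite !adjmxM mulmxBr mulmxBl !mulmxA addrA subrK.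
  exact: (psdmxD cBT (psdmx_conj _ AB)).
by have := spow_contr B p1 cAT (@contrmx1 _ n); rewrite TB mulmx1.
Qed.

Lemma spow2 m n (A : 'M[C]_(m, n)) : spow 2 A = \sum_i \sum_j nc (A i j) ^+ 2.
Proof.
apply: complexI; have [U [W [cU w1 w2 AE UA]]] := svd A.
transitivity (\tr (A^H *m A)).
  rewrite {2}AE !adjmxM adj_rdiag -!mulmxA UA mxtrace_mulC -!mulmxA w2 mulmx1.
  rewrite rdiagM -[rdiag _]mulmx1 mxtrace_rdiagM /spow rmorph_sum/=.
  apply: eq_bigr => i _; rewrite mxE eqxx mulr1.
  by rewrite -expr2 powR_mulrn ?svals_ge0.
rewrite exchange_big/= rmorph_sum/=; apply: eq_bigr => i _.
rewrite mxE rmorph_sum/=; apply: eq_bigr => j _.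
by rewrite adjmxE nc_conjM.
Qed.

End SingularValues.

(** * A determinant inequality *)

Section Determinants.
Context {R : realType}.
Local Notation C := R[i].

(** Sylvester's identity: two block matrices multiply, in either order, to a block triangular
    matrix, and both products have the same determinant. *)
Lemma det_1addM (F : fieldType) m n (A : 'M[F]_(m, n)) (B : 'M[F]_(n, m)) :
  \det (1%:M + A *m B) = \det (1%:M + B *m A).
Proof.
have e3 : (block_mx 1%:M A (- B) 1%:M *m block_mx 1%:M 0 B 1%:M : 'M[F]_(m + n)) =
    block_mx (1%:M + A *m B) A 0 1%:M.
  by rewrite mulmx_block !mulmx1 !mul1mx !mulmx0 !add0r addNr.
have e4 : (block_mx 1%:M 0 B 1%:M *m block_mx 1%:M A (- B) 1%:M : 'M[F]_(m + n)) =
    block_mx 1%:M A 0 (1%:M + B *m A).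
  by rewrite mulmx_block !mulmx1 !mul1mx !mul0mx !addr0 subrr addrC.
have d3 := congr1 determinant e3; have d4 := congr1 determinant e4.
move: d3 d4; rewrite !det_mulmx !det_lblock !det_ublock !det1 !mul1r !mulr1.
by move=> <- <-.
Qed.

Lemma det_adjmx n (A : 'M[C]_n) : \det (A^H) = ((\det A)^*)%R.
Proof. by rewrite /adjmx det_map_mx det_tr. Qed.

Lemma det_unitary_conj n (W A : 'M[C]_n) : W^H *m W = 1%:M ->
  \det (W^H *m A *m W) = \det A.
Proof. by move=> w; rewrite !det_mulmx mulrAC -det_mulmx w det1 mul1r. Qed.

Lemma det_rdiag n (d : 'I_n -> R) : \det (rdiag d) = (\prod_i d i)%:C.
Proof. by rewrite det_diag rmorph_prod; apply: eq_bigr => i _; rewrite mxE. Qed.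

Lemma prod_ge1 (I : finType) (F : I -> R) : (forall i, 1 <= F i) -> 1 <= \prod_i F i.
Proof.
move=> h; elim/big_ind: _ => // x y x1 y1; rewrite (le_trans x1)//.
by rewrite ler_peMr// (le_trans ler01 x1).
Qed.

(* M := 1 + G satisfies M^* M >= 1, hence |det M|^2 >= 1. *)
Lemma det_accretive_ge1 n (G : 'M[C]_n) : psdmx (G + G^H) -> 1 <= nc (\det (1%:M + G)).
Proof.
move=> G0; set M := 1%:M + G.
have MM : psdmx (M^H *m M - 1%:M).
  have -> : M^H *m M - 1%:M = (G + G^H) + G^H *m G.
    rewrite /M adjmxD adjmx1 mulmxDr mulmxDl !mulmx1 mulmxDl !mul1mx.
    by apply/matrixP => i j; rewrite !(addmxE, oppmxE); ring.
  exact: (psdmxD G0 (psdmx_gram _)).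
have [W [d [w1 w2 ME _]]] := spectral_psd (psdmx_gram M).
have d1 i : 1 <= d i.
  have := psdmx_entry i (psdmx_conj (W^H) MM).
  rewrite adjmxK mulmxBr mulmxBl mulmx1 w2 ME !mulmxA w2 mul1mx -mulmxA w2 mulmx1.
  by rewrite addmxE oppmxE rdiagE mxE eqxx subr_ge0 -[1%:R]/((1 : R)%:C) lecR.
have : (nc (\det M) ^+ 2)%:C = (\prod_i d i)%:C :> C.
  by rewrite nc_conjM -det_adjmx -det_mulmx ME det_unitary_conj// det_rdiag.
move/complexI => dE; rewrite -(@ler_pXn2r _ 2)// ?nnegrE ?nc_ge0//.
by rewrite expr1n dE prod_ge1.
Qed.

Lemma nc_prod (I : finType) (F : I -> C) : nc (\prod_i F i) = \prod_i nc (F i).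
Proof.
elim/big_ind2: _ => //; last by move=> a b c d <- <-; rewrite ncM.
by rewrite -[1 : C]/((1 : R)%:C) ncR normr1.
Qed.

Lemma accretive_unit n (G : 'M[C]_n) : psdmx (G + G^H) -> 1%:M + G \in unitmx.
Proof.
move=> /det_accretive_ge1 h; rewrite unitmxE unitfE; apply/eqP => h0.
by move: h; rewrite h0 nc0 ler10.
Qed.

Lemma skew_accretive n (X : 'M[C]_n) (t : R) : X^H = X ->
  (- ('i * t%:C) *: X) + (- ('i * t%:C) *: X)^H = 0.
Proof.
move=> hX; rewrite adjmxZ hX rmorphN rmorphM/= conjCi real_complex_conj -scalerDl.
by rewrite mulNr opprK addNr scale0r.
Qed.

(* With b' = min (b, 2) and Z = b' - i X, write b - i X = Z + E^2, then
   b'^-1 = 1/2 + J^2; both times the determinant of what remains is that of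
   1 + G with G accretive. *)
Lemma det_diag_subi_ge n (b : 'I_n -> R) (X : 'M[C]_n) :
  (forall i, 1 <= b i) -> X^H = X ->
  (\prod_i Num.min (b i) 2) * nc (\det (1%:M - ('i * (2^-1)%:C) *: X)) <=
  nc (\det (rdiag b - 'i *: X)).
Proof.
move=> b1 hX; pose b' i := Num.min (b i) 2.
have b'1 i : 1 <= b' i by rewrite /b' le_min b1; lra.
have b'2 i : b' i <= 2 by rewrite /b' ge_min lexx orbT.
have b'b i : b' i <= b i by rewrite /b' ge_min lexx.
have b'0 i : b' i != 0 by have := b'1 i; lra.
pose E := rdiag (fun i => Num.sqrt (b i - b' i)) : 'M[C]_n.
have EE : E *m E = rdiag b - rdiag b'.
  rewrite /E rdiagM rdiagB; congr rdiag; apply/funext => i.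
  by rewrite -expr2 sqr_sqrtr// subr_ge0.
have hE : E^H = E by exact: adj_rdiag.
pose Z := rdiag b' - 'i *: X.
have ZZ : Z + Z^H = rdiag b' + rdiag b'.
  rewrite /Z adjmxB adjmxZ adj_rdiag hX conjCi scaleNr opprK addrACA.
  by rewrite addNr addr0.
have b'psd : psdmx (rdiag b' : 'M[C]_n).
  by apply: rdiag_psd => i; apply: le_trans (b'1 i); exact: ler01.
have Zu : Z \in unitmx.
  have -> : Z = 1%:M + (Z - 1%:M) by rewrite addrC subrK.
  apply: accretive_unit; rewrite adjmxB adjmx1 addrACA ZZ addrACA -rdiag1 rdiagB.
  have h : psdmx (rdiag (fun i => b' i - 1) : 'M[C]_n).
    by apply: rdiag_psd => i; rewrite subr_ge0.
  exact: (psdmxD h h).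
have step1 : nc (\det Z) <= nc (\det (rdiag b - 'i *: X)).
  have -> : rdiag b - 'i *: X = Z *m (1%:M + (invmx Z *m E) *m E).
    rewrite mulmxDr mulmx1 !mulmxA mulmxV// mul1mx EE /Z.
    by apply/matrixP => i j; rewrite !(addmxE, oppmxE); ring.
  rewrite det_mulmx ncM ler_peMr ?nc_ge0// det_1addM mulmxA.
  apply: det_accretive_ge1; set G := E *m invmx Z *m E.
  (* E Z^-1 E = T^H Z^H T turns the real part of an inverse into a congruence of Z + Z^H = 2 b',
     which is positive. *)
  pose T := invmx Z *m E.
  have e1 : G = T^H *m Z^H *m T.
    have -> : T^H *m Z^H = E by rewrite -adjmxM /T mulmxA mulmxV// mul1mx hE.
    by rewrite /G /T mulmxA.
  have e2 : G^H = T^H *m Z *m T by rewrite e1 !adjmxM !adjmxK mulmxA.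
  clearbody T.
  rewrite e2 e1 -mulmxDl -mulmxDr addrC ZZ.
  by apply: psdmx_conj; exact: (psdmxD b'psd b'psd).
apply: le_trans step1.
pose t : R := 2^-1; rewrite -[2^-1]/t.
pose N := 1%:M - ('i * t%:C) *: X.
have Nu : N \in unitmx.
  rewrite /N -scaleNr; apply: accretive_unit.
  by rewrite (skew_accretive t hX); exact: psdmx0.
(* The cap at 2 in b' makes b'^-1 - 1/2 nonnegative, so that J is a true square root. *)
pose J := rdiag (fun i => Num.sqrt ((b' i)^-1 - t)) : 'M[C]_n.
have hJ : J^H = J by exact: adj_rdiag.
have JJ : J *m J + rdiag (fun=> t) = rdiag (fun i => (b' i)^-1).
  have -> : rdiag (fun=> t) = rdiag (fun i => (b' i)^-1) - rdiag (fun i => (b' i)^-1 - t)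
      :> 'M[C]_n.
    by rewrite rdiagB; congr rdiag; apply/funext => i; ring.
  rewrite /J rdiagM addrC -addrA -[RHS]addr0; congr (_ + _).
  apply/eqP; rewrite addrC subr_eq0; apply/eqP; congr rdiag; apply/funext => i.
  rewrite -expr2 sqr_sqrtr// subr_ge0 /t lef_pV2 ?posrE//.
  by apply: lt_le_trans (b'1 i).
have tE : rdiag (fun=> t) *m X = t%:C *: X.
  have -> : rdiag (fun=> t) = t%:C *: 1%:M :> 'M[C]_n.
    by rewrite -rdiag1; apply/matrixP => i j; rewrite !mxE mulrnAr mulr1.
  by rewrite -scalemxAl mul1mx.
have ZE : Z = rdiag b' *m ((1%:M + J *m (- 'i *: (J *m X *m invmx N))) *m N).
  rewrite mulmxDl mul1mx -scalemxAr -scalemxAl -!mulmxA mulVmx// mulmx1.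
  rewrite [J *m (J *m X)]mulmxA.
  have -> : J *m J = rdiag (fun i => (b' i)^-1) - rdiag (fun=> t).
    by rewrite -JJ addrK.
  rewrite mulmxBl tE.
  have -> : N + - 'i *: (rdiag (fun i => (b' i)^-1) *m X - t%:C *: X) =
      1%:M - 'i *: (rdiag (fun i => (b' i)^-1) *m X).
    move: (rdiag _ *m X) => P; rewrite /N.
    by apply/matrixP => i j; rewrite !(addmxE, oppmxE, scalemxE); ring.
  rewrite mulmxBr mulmx1 -scalemxAr mulmxA rdiagM.
  have -> : rdiag (fun i => b' i * (b' i)^-1) = 1%:M :> 'M[C]_n.
    by rewrite -rdiag1; congr rdiag; apply/funext => i; rewrite mulfV.
  by rewrite mul1mx.
rewrite -/N ZE !det_mulmx det_rdiag !ncM ncR ger0_norm; last first.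
  by apply: prodr_ge0 => i _; apply: le_trans (b'1 i); exact: ler01.
rewrite -/b' ler_wpM2l//.
  by apply: prodr_ge0 => i _; apply: le_trans (b'1 i); exact: ler01.
rewrite ler_peMl ?nc_ge0// det_1addM.
apply: det_accretive_ge1.
pose T := invmx N *m J.
have JE : N *m T = J by rewrite /T mulmxA mulmxV// mul1mx.
have JE' : T^H *m N^H = J by rewrite -adjmxM JE hJ.
have e1 : - 'i *: (J *m X *m invmx N) *m J = T^H *m (- 'i *: (N^H *m X)) *m T.
  rewrite -scalemxAr -!scalemxAl; congr (_ *: _).
  by rewrite (mulmxA (T^H)) JE' /T !mulmxA.
have NE : N = 1%:M - ('i * t%:C) *: X by [].
clearbody T N J Z E.
have e2 : (T^H *m (- 'i *: (N^H *m X)) *m T)^H = T^H *m ('i *: (X *m N)) *m T.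
  have ci : ((- 'i : C)^*)%R = 'i by rewrite rmorphN/= conjCi opprK.
  rewrite (adjmxM _ T).
  rewrite (adjmxM (T^H)).
  rewrite adjmxK.
  rewrite adjmxZ ci.
  rewrite (adjmxM (N^H)).
  rewrite hX adjmxK.
  exact: mulmxA.
rewrite e1 e2 -mulmxDl -mulmxDr; apply: psdmx_conj.
(* The terms linear in X cancel, and t + t = 1 leaves exactly X^2. *)
have -> : - 'i *: (N^H *m X) + 'i *: (X *m N) = X^H *m X.
  rewrite NE adjmxB adjmx1 adjmxZ hX rmorphM/= conjCi real_complex_conj.
  rewrite mulmxBl mulmxBr mul1mx mulmx1 -scalemxAl -scalemxAr !scalerBr !scalerA.
  transitivity ((- ('i ^+ 2) * (t + t)%:C) *: (X *m X)).
    rewrite rmorphD/=; move: (X *m X) (t%:C : C) ('i : C) => P u w.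
    by apply/matrixP => i j; rewrite !(addmxE, oppmxE, scalemxE); ring.
  have -> : t + t = 1 by rewrite /t; lra.
  by rewrite sqrCi opprK mul1r scale1r.
exact: psdmx_gram.
Qed.

End Determinants.

(** * From weak type to strong type *)

Section DyadicSums.
Context {R : realType}.
Implicit Types (x y z p w q : R).

(** With w = z / 2^j, the summands account in this order for the terms with w < 1/2, with w >= 1 and
    with 1/2 <= w < 1 of the sum in [dyadic_sum_le]. *)
Definition dyadic_cst p : R := (2 `^ (2 - p) - 1)^-1 + (1 - 2 `^ (1 - p))^-1 + 1.

Lemma one_powR q : 1 `^ q = 1 :> R.
Proof. by rewrite powR1. Qed.

Lemma powR2_gt1 p : 0 < p -> 1 < 2 `^ p.
Proof.
move=> p0; have := @gt0_ltr_powR R p p0 1 2.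
by rewrite powR1; apply; rewrite ?nnegrE; lra.
Qed.

Lemma powR2_lt1 p : p < 0 -> 2 `^ p < 1.
Proof.
move=> p0; rewrite -[p]opprK powRN invf_lt1 ?powR_gt0//.
by apply: powR2_gt1; rewrite oppr_gt0.
Qed.

(** The terms are w^(1 - p) for w >= 1 and w^(2 - p) for w < 1, hence geometric on either side of 1.
    The bound is uniform in z and M. *)
Lemma dyadic_sum_le p z (M : nat) : 1 < p < 2 -> 0 < z ->
  \sum_(j < M) (z / 2 ^+ j) `^ (- p) * Num.min (z / 2 ^+ j) ((z / 2 ^+ j) ^+ 2) <=
  dyadic_cst p.
Proof.
move=> /andP[p1 p2] z0.
have c1 : 0 < 2 `^ (2 - p) - 1 by rewrite subr_gt0 powR2_gt1// subr_gt0.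
have c2 : 0 < 1 - 2 `^ (1 - p) by rewrite subr_gt0 powR2_lt1// subr_lt0.
pose h1 (w : R) := (2 `^ (2 - p) - 1)^-1 * Num.min w 1 `^ (2 - p).
pose h2 (w : R) := (1 - 2 `^ (1 - p))^-1 * (1 - Num.max w 1 `^ (1 - p)).
pose h3 (w : R) : R := (1 <= w)%R%:R.
have min01 (w : R) : 0 < w -> 0 < Num.min w 1 by move=> w0; rewrite lt_min w0 ltr01.
have max1 (w : R) : 1 <= Num.max w 1 by rewrite le_max lexx orbT.
have powN (w q : R) : 1 <= w -> q <= 0 -> w `^ q <= 1.
  move=> w1 q0; rewrite -[q]opprK powRN invf_le1 ?powR_gt0 ?(lt_le_trans ltr01)//.
  by rewrite -[1](powRr0 w) ler_powR// oppr_ge0.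
have h1_le (w : R) : 0 < w -> 0 <= h1 w <= (2 `^ (2 - p) - 1)^-1.
  move=> w0; rewrite mulr_ge0 ?powR_ge0 ?invr_ge0 ?(ltW c1)//= ler_piMr ?invr_ge0 ?(ltW c1)//.
  rewrite -[leRHS](one_powR (2 - p)) powR_mono ?subr_ge0 ?(ltW p2) ?(ltW (min01 _ w0))//.
  by rewrite ge_min lexx orbT.
have h2_le (w : R) : 0 <= h2 w <= (1 - 2 `^ (1 - p))^-1.
  rewrite mulr_ge0 ?invr_ge0 ?(ltW c2)//= ?subr_ge0 ?powN ?subr_le0 ?(ltW p1)//.
  rewrite ler_piMr ?invr_ge0 ?(ltW c2)// gerBl powR_ge0//.
have h3_le (w : R) : 0 <= h3 w <= 1 by rewrite /h3; case: (1 <= w)%R; rewrite ?lexx ?ler01.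
have h1_mono (w : R) : 0 < w -> h1 w <= h1 (2 * w).
  move=> w0; rewrite ler_wpM2l ?invr_ge0 ?(ltW c1)// powR_mono ?subr_ge0 ?(ltW p2)//.
    exact/ltW/min01.
  by rewrite le_min !ge_min lexx orbT/= andbT; apply/orP; left; lra.
have h2_mono (w : R) : 0 < w -> h2 w <= h2 (2 * w).
  move=> w0; rewrite ler_wpM2l ?invr_ge0 ?(ltW c2)// lerB//.
  rewrite -(opprB p 1) !powRN lef_pV2 ?posrE ?powR_gt0 ?(lt_le_trans ltr01 (max1 _))//.
  rewrite powR_mono ?subr_ge0 ?(ltW p1) ?(le_trans ler01 (max1 _))//.
  by rewrite ge_max !le_max lexx !orbT andbT; apply/orP; left; lra.
have h3_mono (w : R) : 0 < w -> h3 w <= h3 (2 * w).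
  move=> w0; rewrite /h3; have [w1|w1] := leP 1 w.
    by have -> : (1 <= 2 * w)%R by lra.
  by case: (1 <= 2 * w)%R; rewrite ?ler01.
(* The terms are increments h (2 w) - h w of the bounded function
   h = h1 + h2 + h3, hence the sum telescopes. *)
have key (w : R) : 0 < w -> w `^ (- p) * Num.min w (w ^+ 2) <=
    (h1 (2 * w) + h2 (2 * w) + h3 (2 * w)) - (h1 w + h2 w + h3 w).
  move=> w0; have m1 := h1_mono _ w0; have m2 := h2_mono _ w0; have m3 := h3_mono _ w0.
  have w_neq0 : w != 0 by lra.
  have [w1|w1] := leP 1 w.
    have -> : Num.min w (w ^+ 2) = w by apply/min_idPl; rewrite expr2 ler_peMl// ltW.
    rewrite -[X in _ * X]powRr1 ?(ltW w0)// -powRD ?w_neq0 ?implybT//.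
    suff : w `^ (- p + 1) <= h2 (2 * w) - h2 w by lra.
    rewrite /h2 (max_idPl _) ?(max_idPl _)//; last by lra.
    rewrite -mulrBr addrC powRM ?(ltW w0)//.
    have -> : 1 - 2 `^ (1 - p) * w `^ (1 - p) - (1 - w `^ (1 - p)) =
       (1 - 2 `^ (1 - p)) * w `^ (1 - p) by ring.
    by rewrite mulrA mulVf ?mul1r// gt_eqF.
  have -> : Num.min w (w ^+ 2) = w ^+ 2.
    by apply/min_idPr; rewrite expr2 ler_piMl ?ltW.
  rewrite -(powR_mulrn 2 (ltW w0)) -powRD ?w_neq0 ?implybT// addrC.
  have [w2|w2] := leP 1 (2 * w).
    have e3 : h3 (2 * w) - h3 w = 1 by rewrite /h3 w2 leNgt w1/= subr0.
    have : w `^ (2 - p) <= 1.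
      rewrite -[leRHS](one_powR (2 - p)) powR_mono ?subr_ge0 ?(ltW p2)// ltW//.
    by lra.
  suff : w `^ (2 - p) <= h1 (2 * w) - h1 w by lra.
  rewrite /h1 !(min_idPl _) ?(ltW w1) ?(ltW w2)//.
  rewrite -mulrBr powRM ?(ltW w0)//.
  have -> : 2 `^ (2 - p) * w `^ (2 - p) - w `^ (2 - p) =
     (2 `^ (2 - p) - 1) * w `^ (2 - p) by ring.
  by rewrite mulrA mulVf ?mul1r// gt_eqF.
pose F (j : nat) := - (h1 (2 * (z / 2 ^+ j)) + h2 (2 * (z / 2 ^+ j)) + h3 (2 * (z / 2 ^+ j))).
apply: (@le_trans _ _ (\sum_(0 <= j < M) (F j.+1 - F j))).
  rewrite big_mkord; apply: ler_sum => j _.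
  have wj : 0 < z / 2 ^+ j by rewrite divr_gt0// exprn_gt0.
  apply: le_trans (key _ wj) _; rewrite /F exprS invfM.
  have -> : 2 * (z * (2^-1 / 2 ^+ j)) = z / 2 ^+ j.
    by field; rewrite expf_neq0.
  by lra.
rewrite telescope_sumr// /F /dyadic_cst.
set v := 2 * (z / 2 ^+ 0); set u := 2 * (z / 2 ^+ M).
have u0 : 0 < u by rewrite mulr_gt0// divr_gt0// exprn_gt0.
have v0 : 0 < v by rewrite mulr_gt0// divr_gt0// exprn_gt0.
have := h1_le _ u0; have := h1_le _ v0; have := h2_le u; have := h2_le v.
have := h3_le u; have := h3_le v.
by move=> /andP[? ?] /andP[? ?] /andP[? ?] /andP[? ?] /andP[? ?] /andP[? ?]; lra.
Qed.

(** The term of the largest j with t 2^j <= x suffices, as x < t 2^(j + 1); the sum over all j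
    avoids naming it. *)
Lemma powR_le_dyadic x t p (M : nat) : 0 < p -> 0 < t -> t <= x -> x < t * 2 ^+ M ->
  x `^ p <= \sum_(j < M) (t * 2 ^+ j <= x)%R%:R * (t * 2 ^+ j.+1) `^ p.
Proof.
move=> p0 t0 tx; elim: M => [|M IH xM]; first by rewrite mulr1 ltNge tx.
rewrite big_ord_recr/=.
have [xM'|xM'] := ltP x (t * 2 ^+ M).
  by apply: le_trans (IH xM') _; rewrite lerDl mul0r.
rewrite mul1r; apply: (@le_trans _ _ ((t * 2 ^+ M.+1) `^ p)).
  by rewrite powR_mono ?(ltW p0)// ?(le_trans (ltW t0))// ltW.
by rewrite lerDr sumr_ge0// => j _; rewrite mulr_ge0 ?ler0n ?powR_ge0.
Qed.

Lemma strong_of_weak (I J : finType) (x : I -> R) (y : J -> R) (A p : R) :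
  1 < p < 2 -> 0 <= A -> (forall i, 0 <= x i) -> (forall j, 0 <= y j) ->
  (forall s, 0 < s -> \sum_i (2 <= s * x i)%R%:R <=
                      A * \sum_j Num.min (s * y j) ((s * y j) ^+ 2)) ->
  \sum_i x i `^ p <= A * 2 `^ p * 2 `^ p * dyadic_cst p * \sum_j y j `^ p.
Proof.
move=> p12 A0 x0 y0 weak; have /andP[p1 p2] := p12.
have p0 : 0 < p by lra.
(* A positive lower bound for the nonzero x i; the vanishing ones contribute 0^-1 = 0. *)
pose t := (1 + \sum_i (x i)^-1)^-1.
have S0 : 0 <= \sum_i (x i)^-1 by apply: sumr_ge0 => i _; rewrite invr_ge0.
have t0 : 0 < t by rewrite invr_gt0; lra.
have tx i : 0 < x i -> t <= x i.
  move=> xi; rewrite -[leRHS]invrK lef_pV2 ?posrE ?invr_gt0//; last by lra.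
  rewrite (bigD1 i)//=; have : 0 <= \sum_(j | j != i) (x j)^-1.
    by apply: sumr_ge0 => j _; rewrite invr_ge0.
  lra.
have [M xM] : exists M, forall i, x i < t * 2 ^+ M.
  pose X := \sum_i x i.
  have X0 : 0 <= X by apply: sumr_ge0.
  exists (Num.trunc (X / t)).+1 => i; rewrite -ltr_pdivrMl//.
  apply: (@lt_trans _ _ (Num.trunc (X / t)).+1%:R); last first.
    by rewrite -natrX ltr_nat ltn_expl.
  apply: (@le_lt_trans _ _ (X / t)); last by rewrite truncnS_gt.
  rewrite mulrC; apply: ler_wpM2r; first by rewrite invr_ge0 ltW.
  by rewrite /X (bigD1 i)//= lerDl sumr_ge0.
(* Chosen so that 2 <= s_j x_i is the same as t 2^j <= x_i. *)
pose s j : R := 2 / (t * 2 ^+ j).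
have tj0 j : 0 < t * 2 ^+ j by rewrite mulr_gt0 ?exprn_gt0.
apply: (@le_trans _ _ (\sum_i \sum_(j < M) (t * 2 ^+ j <= x i)%R%:R * (t * 2 ^+ j.+1) `^ p)).
  apply: ler_sum => i _; have [xi|xi] := eqVneq (x i) 0.
    rewrite xi powR0 ?gt_eqF//; apply: sumr_ge0 => j _.
    by rewrite mulr_ge0 ?ler0n ?powR_ge0.
  have xip : 0 < x i by rewrite lt_def xi x0.
  exact: powR_le_dyadic (tx _ xip) (xM i).
rewrite exchange_big/=.
apply: (@le_trans _ _ (\sum_(j < M) (t * 2 ^+ j.+1) `^ p *
    (A * \sum_k Num.min (s j * y k) ((s j * y k) ^+ 2)))).
  apply: ler_sum => j _; rewrite -mulr_suml mulrC ler_wpM2l ?powR_ge0//.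
  apply: le_trans (weak (s j) _); last by rewrite divr_gt0.
  apply: ler_sum => i _; rewrite /s mulrAC ler_pdivlMr//.
  by rewrite ler_pM2l.
have -> : \sum_(j < M) (t * 2 ^+ j.+1) `^ p *
    (A * \sum_k Num.min (s j * y k) ((s j * y k) ^+ 2)) =
  A * \sum_k \sum_(j < M) (t * 2 ^+ j.+1) `^ p *
    Num.min (s j * y k) ((s j * y k) ^+ 2).
  rewrite exchange_big/= mulr_sumr; apply: eq_bigr => j _.
  by rewrite mulrCA mulr_sumr.
rewrite -!mulrA ler_wpM2l// !mulrA mulr_sumr; apply: ler_sum => k _.
have [yk|yk] := eqVneq (y k) 0.
  rewrite yk powR0 ?gt_eqF// mulr0 big1// => j _.
  by rewrite mulr0 expr0n/= minxx mulr0.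
have ykp : 0 < y k by rewrite lt_def yk y0.
pose z := 2 * y k / t.
have z0 : 0 < z by rewrite divr_gt0// mulr_gt0.
have sE j : s j * y k = z / 2 ^+ j.
  by rewrite /s /z; field; rewrite ?expf_neq0 ?gt_eqF.
apply: (@le_trans _ _ (\sum_(j < M) 2 `^ p * 2 `^ p * y k `^ p *
  ((z / 2 ^+ j) `^ (- p) * Num.min (z / 2 ^+ j) ((z / 2 ^+ j) ^+ 2)))).
  apply: ler_sum => j _; rewrite sE [leRHS]mulrA ler_wpM2r//.
    by rewrite le_min sqr_ge0 divr_ge0 ?(ltW z0) ?exprn_ge0.
  have w0 : 0 < z / 2 ^+ j by rewrite divr_gt0 ?exprn_gt0.
  (* Origin of the two factors 2^p: one from rounding x up to the next dyadic level, the other from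
     the threshold 2 in the weak estimate. *)
  have E : (t * 2 ^+ j.+1) `^ p * (z / 2 ^+ j) `^ p = 2 `^ p * 2 `^ p * y k `^ p.
    rewrite -powRM ?(ltW (tj0 _)) ?(ltW w0)//.
    have -> : t * 2 ^+ j.+1 * (z / 2 ^+ j) = 2 * 2 * y k.
      by rewrite /z exprS; field; rewrite ?expf_neq0 ?gt_eqF.
    by rewrite powRM ?powRM ?(ltW ykp)// mulr_ge0.
  by rewrite powRN -E mulfK// gt_eqF// powR_gt0.
rewrite -mulr_sumr -[leRHS]mulrA [_ * y k `^ p in leRHS]mulrC mulrA.
by rewrite ler_wpM2l ?mulr_ge0 ?powR_ge0// dyadic_sum_le.
Qed.

End DyadicSums.

(** * Triangular truncation *)

Section Triangular.
Context {R : realType}.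
Local Notation C := R[i].

Definition upmx n (A : 'M[C]_n) : 'M[C]_n :=
  \matrix_(i, j) if (i < j)%N then A i j else 0.

Definition lomx n (A : 'M[C]_n) : 'M[C]_n :=
  \matrix_(i, j) if (j < i)%N then A i j else 0.

Definition dgmx n (A : 'M[C]_n) : 'M[C]_n := diag_mx (\row_i A i i).

Lemma tri_decomp n (A : 'M[C]_n) : A = upmx A + lomx A + dgmx A.
Proof.
apply/matrixP => i j; rewrite !mxE.
have [ij|ij|/val_inj->] := ltngtP i j; last by rewrite eqxx mulr1n !add0r.
- by rewrite (_ : (i == j) = false) ?mulr0n ?addr0//; apply/eqP => e; rewrite e ltnn in ij.
- by rewrite (_ : (i == j) = false) ?mulr0n ?addr0 ?add0r//; apply/eqP => e; rewrite e ltnn in ij.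
Qed.

Definition hilbertmx n (Y : 'M[C]_n) : 'M[C]_n := 'i *: (lomx Y - upmx Y).

Lemma hilbertmx_hermitian n (Y : 'M[C]_n) : Y^H = Y -> (hilbertmx Y)^H = hilbertmx Y.
Proof.
move=> hY; rewrite /hilbertmx adjmxZ conjCi scaleNr -scalerN; congr (_ *: _).
rewrite adjmxB opprB; congr (_ - _); apply/matrixP => i j; rewrite adjmxE !mxE;
  case: ifP => _; by rewrite ?rmorph0// -adjmxE hY.
Qed.

(* 1 + s Y - i s X is lower triangular for X = hilbertmx Y. *)
Lemma det_hilbertmx n (Y : 'M[C]_n) (s : R) :
  \det (1%:M + s%:C *: Y - 'i *: (s%:C *: hilbertmx Y)) = \prod_i (1 + s%:C * Y i i).
Proof.
have TE : 1%:M + s%:C *: Y - 'i *: (s%:C *: hilbertmx Y) =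
    1%:M + s%:C *: Y + s%:C *: (lomx Y - upmx Y).
  rewrite /hilbertmx; congr (_ + _); rewrite !scalerA -scaleNr; congr (_ *: _).
  by rewrite mulrAC -expr2 sqrCi mulN1r opprK.
rewrite TE det_trig.
  apply: eq_bigr => i _; rewrite !(addmxE, oppmxE, scalemxE) !mxE eqxx !ltnn.
  by rewrite subr0 mulr0 addr0.
apply/is_trig_mxP => i j ij; rewrite !(addmxE, oppmxE, scalemxE) !mxE ij ltnNge (ltnW ij)/=.
rewrite (_ : (i == j) = false); last by apply/eqP => e; rewrite e ltnn in ij.
by rewrite add0r sub0r mulrN subrr.
Qed.

Lemma psd_diag_real n (Y : 'M[C]_n) i : psdmx Y -> Y i i = (complex.Re (Y i i))%:C.
Proof. by move=> /(psdmx_entry i) Y0; rewrite RRe_real// ger0_real. Qed.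

Lemma psd_diag_ge0 n (Y : 'M[C]_n) i : psdmx Y -> 0 <= complex.Re (Y i i).
Proof. by move=> Y0; rewrite -ler0c -psd_diag_real//; exact: psdmx_entry. Qed.

Lemma sum_eigenvalues n (Y W : 'M[C]_n) (y : 'I_n -> R) :
  W *m W^H = 1%:M -> Y = W^H *m rdiag y *m W ->
  \sum_i complex.Re (Y i i) = \sum_i y i.
Proof.
move=> w2 YE; rewrite -(raddf_sum (@complex.Re R : Rcomplex R -> R)).
have -> : \sum_i Y i i = \tr Y by [].
rewrite YE mxtrace_mulC mulmxA w2 mul1mx -[rdiag y]mulmx1 mxtrace_rdiagM.
rewrite raddf_sum; apply: eq_bigr => i _.
by rewrite mxE eqxx mulr1.
Qed.

Lemma nc_1subi (t : R) : nc (1 - 'i * t%:C : C) = Num.sqrt (1 + t ^+ 2).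
Proof.
set z : C := 1 - _.
suff e : nc z ^+ 2 = 1 + t ^+ 2 by rewrite -e sqrtr_sqr ger0_norm ?nc_ge0.
apply: complexI; rewrite nc_conjM /z rmorphB rmorphM/= rmorph1 conjCi real_complex_conj.
rewrite mulNr opprK mulrC -subr_sqr expr1n exprMn sqrCi mulN1r opprK.
by rewrite rmorphD/= rmorphXn/=.
Qed.

(** [det_diag_subi_ge] in an eigenbasis of Y, where 1 + s Y becomes diag(1 + s y) and s H(Y) becomes
    the Hermitian matrix X'. The right-hand side is the modulus of the triangular determinant. *)
Lemma hilbertmx_prod_le n (Y W W' : 'M[C]_n) (x y : 'I_n -> R) (s : R) : 0 < s ->
  psdmx Y -> W *m W^H = 1%:M -> W^H *m W = 1%:M -> Y = W^H *m rdiag y *m W ->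
  (forall i, 0 <= y i) ->
  W' *m W'^H = 1%:M -> W'^H *m W' = 1%:M -> hilbertmx Y = W'^H *m rdiag x *m W' ->
  (\prod_i Num.min (1 + s * y i) 2) * (\prod_i Num.sqrt (1 + (s * x i / 2) ^+ 2)) <=
  \prod_i (1 + s * complex.Re (Y i i)).
Proof.
move=> s0 Y0 w2 w1 YE y0 w2' w1' XE.
have hX : (hilbertmx Y)^H = hilbertmx Y by exact/hilbertmx_hermitian/psdmx_hermitian.
pose X' := W *m (s%:C *: hilbertmx Y) *m W^H.
have hX' : X'^H = X'.
  by rewrite /X' (adjmxM _ (W^H)) (adjmxM W) adjmxK adjmxZ hX real_complex_conj mulmxA.
have b1 i : 1 <= 1 + s * y i by rewrite lerDl mulr_ge0// ltW.
have w2H : (W^H)^H *m W^H = 1%:M by rewrite adjmxK.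
have E1 : nc (\det (rdiag (fun i => 1 + s * y i) - 'i *: X')) =
    \prod_i (1 + s * complex.Re (Y i i)).
  have -> : rdiag (fun i => 1 + s * y i) - 'i *: X' =
      (W^H)^H *m (1%:M + s%:C *: Y - 'i *: (s%:C *: hilbertmx Y)) *m W^H.
    rewrite adjmxK mulmxBr mulmxDr mulmxBl mulmxDl mulmx1 w2; congr (_ - _).
      rewrite YE -scalemxAr -scalemxAl !mulmxA w2 mul1mx -mulmxA w2 mulmx1.
      by apply/matrixP => i j; rewrite !mxE; case: eqP => _;
        rewrite ?mulr1n ?mulr0n ?mulr0 ?addr0// rmorphD rmorphM.
    by rewrite -scalemxAr -scalemxAl /X'.
  rewrite (det_unitary_conj _ w2H) det_hilbertmx nc_prod.
  apply: eq_bigr => i _; rewrite {1}psd_diag_real// -rmorphM.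
  rewrite -[1 : C]/((1 : R)%:C) -rmorphD ncR ger0_norm//.
  by rewrite addr_ge0// mulr_ge0 ?psd_diag_ge0// ltW.
have E2 : nc (\det (1%:M - ('i * (2^-1)%:C) *: X')) =
    \prod_i Num.sqrt (1 + (s * x i / 2) ^+ 2).
  have -> : 1%:M - ('i * (2^-1)%:C) *: X' =
      (W^H)^H *m (W'^H *m (1%:M - ('i * (2^-1)%:C) *: (s%:C *: rdiag x)) *m W') *m W^H.
    rewrite adjmxK mulmxBr mulmx1 mulmxBl w1' mulmxBr mulmxBl mulmx1 w2; congr (_ - _).
    by rewrite /X' XE -!scalemxAr -!scalemxAl -!scalemxAr -!scalemxAl.
  rewrite (det_unitary_conj _ w2H) (det_unitary_conj _ w1').
  have -> : 1%:M - ('i * (2^-1)%:C) *: (s%:C *: rdiag x) =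
      diag_mx (\row_i (1 - 'i * (s * x i / 2)%:C)).
    apply/matrixP => i j; rewrite !(addmxE, oppmxE, scalemxE) !mxE.
    case: eqP => _; last by rewrite !mulr0n !mulr0 subr0.
    rewrite !mulr1n !rmorphM/=; congr (_ - _).
    by rewrite -!mulrA; congr (_ * _); rewrite mulrC mulrA.
  rewrite det_diag nc_prod.
  by apply: eq_bigr => i _; rewrite mxE nc_1subi.
rewrite -E1 -E2; exact: (det_diag_subi_ge b1 hX').
Qed.

(** For u < 1, exp(u^2 - u) >= 1 - u + u^2 and (1 + u) (1 - u + u^2) = 1 + u^3 >= 1. For u >= 1 the
    left-hand side is 1. *)
Lemma expR_le_min (u : R) : 0 <= u ->
  expR (u - Num.min u (u ^+ 2)) <= Num.min (1 + u) 2.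
Proof.
move=> u0; have [u1|u1] := leP 1 u.
  rewrite (min_idPl _); last by rewrite expr2 ler_peMl.
  by rewrite subrr expR0 le_min; apply/andP; split; lra.
rewrite (min_idPr _); last by rewrite expr2 ler_piMl// ltW.
rewrite (min_idPl _); last by lra.
have := expR_ge1Dx (- (u - u ^+ 2)); rewrite expRN.
have e0 : 0 < expR (u - u ^+ 2) by exact: expR_gt0.
have q0 : 0 < 1 - u + u ^+ 2 by nra.
rewrite -(ler_pM2r e0) mulVf ?gt_eqF// => h.
rewrite -(ler_pM2l q0); apply: (@le_trans _ _ 1).
  by apply: le_trans h; rewrite ler_pM2r// opprB addrA addrAC.
have : 0 <= u ^+ 3 by rewrite exprn_ge0.
have -> : (1 - u + u ^+ 2) * (1 + u) = 1 + u ^+ 3 by ring.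
lra.
Qed.

(** After squaring, exp(1/2) <= 2, which follows from exp(-1/2) >= 1 - 1/2. The quarter becomes the
    factor 4 of [hilbertmx_weak]. *)
Lemma expR4_le (b : bool) (t : R) : (b -> 1 <= t ^+ 2) ->
  expR (b%:R / 4) <= Num.sqrt (1 + t ^+ 2).
Proof.
move=> h; rewrite -ler_sqr ?nnegrE ?expR_ge0 ?sqrtr_ge0// sqr_sqrtr; last first.
  by have := sqr_ge0 t; lra.
rewrite -expRM_natl; case: b h => [/(_ isT) h|_]; last first.
  by rewrite mul0r mulr0 expR0; have := sqr_ge0 t; lra.
have -> : 2%:R * (true%:R / 4) = 2^-1 :> R by rewrite /=; lra.
apply: (@le_trans _ _ 2); last by lra.
have := expR_ge1Dx (- (2^-1 : R)); rewrite expRN => h1.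
rewrite -[leRHS]invrK -[leLHS]invrK lef_pV2 ?posrE ?invr_gt0 ?expR_gt0//.
by apply: le_trans h1; lra.
Qed.

(** The product over the diagonal is at most exp(s tr Y), that over the eigenvalues at least exp(s
    tr Y - sum_k min (s y_k, (s y_k)^2)). The traces cancel, and the remainder must pay 1/4 for each
    large x_k. *)
Lemma hilbertmx_weak n (Y W W' : 'M[C]_n) (x y : 'I_n -> R) (s : R) : 0 < s ->
  psdmx Y -> W *m W^H = 1%:M -> W^H *m W = 1%:M -> Y = W^H *m rdiag y *m W ->
  (forall i, 0 <= y i) ->
  W' *m W'^H = 1%:M -> W'^H *m W' = 1%:M -> hilbertmx Y = W'^H *m rdiag x *m W' ->
  \sum_i (2 <= s * `|x i|)%R%:R <= 4 * \sum_i Num.min (s * y i) ((s * y i) ^+ 2).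
Proof.
move=> s0 Y0 w2 w1 YE y0 w2' w1' XE.
have := hilbertmx_prod_le s0 Y0 w2 w1 YE y0 w2' w1' XE.
have L : expR (\sum_i (s * y i - Num.min (s * y i) ((s * y i) ^+ 2))) *
    expR (\sum_i ((2 <= s * `|x i|)%R%:R / 4)) <=
    (\prod_i Num.min (1 + s * y i) 2) * (\prod_i Num.sqrt (1 + (s * x i / 2) ^+ 2)).
  rewrite !expR_sum; apply: ler_pM.
  - by apply: prodr_ge0 => i _; exact: expR_ge0.
  - by apply: prodr_ge0 => i _; exact: expR_ge0.
  - apply: ler_prod => i _; rewrite expR_ge0/=.
    by apply: expR_le_min; rewrite mulr_ge0// ltW.
  - apply: ler_prod => i _; rewrite expR_ge0/=; apply: expR4_le => h.
    rewrite -[(_ / 2) ^+ 2]real_normK ?num_real//.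
    rewrite normrM normrM (gtr0_norm s0) (_ : `|2^-1| = 2^-1 :> R); last first.
      by rewrite gtr0_norm// invr_gt0.
    by rewrite exprn_ege1// ler_pdivlMr// mul1r.
have U : \prod_i (1 + s * complex.Re (Y i i)) <= expR (\sum_i s * y i).
  rewrite -mulr_sumr -(sum_eigenvalues w2 YE) mulr_sumr expR_sum.
  apply: ler_prod => i _; rewrite expR_ge1Dx andbT.
  by rewrite addr_ge0// mulr_ge0 ?psd_diag_ge0// ltW.
move=> h; have := le_trans L (le_trans h U).
rewrite -expRD ler_expR sumrB -mulr_suml; lra.
Qed.

Lemma spow_hermitian_le n (X W : 'M[C]_n) (x : 'I_n -> R) p : 1 <= p ->
  W *m W^H = 1%:M -> W^H *m W = 1%:M -> X = W^H *m rdiag x *m W ->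
  spow p X <= \sum_i `|x i| `^ p.
Proof.
move=> p1 w2 w1 ->.
have -> : rdiag x = rdiag (fun i => Num.sg (x i)) *m rdiag (fun i => `|x i|) :> 'M[C]_n.
  by rewrite rdiagM; congr rdiag; apply/funext => i; rewrite -numEsg.
rewrite mulmxA.
apply: (spow_decomp_le p1 _ (contrmx_isometry w1)) => [|i]; last exact: normr_ge0.
apply: (contrmxM (contrmx_adj (contrmx_isometry w1))).
by apply: rdiag_contr => i; rewrite normr_sg lern1 leq_b1.
Qed.

Lemma spow_eigen_ge n (Y W : 'M[C]_n) (y : 'I_n -> R) p : 1 <= p ->
  W *m W^H = 1%:M -> W^H *m W = 1%:M -> Y = W^H *m rdiag y *m W ->
  \sum_i `|y i| `^ p <= spow p Y.
Proof.
move=> p1 w2 w1 YE.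
have := spow_pinching Y p1 (contrmx_isometry w1) (contrmx_adj (contrmx_isometry w1)).
apply: le_trans; rewrite le_eqVlt; apply/predU1P; left; apply: eq_bigr => i _.
by rewrite YE !mulmxA w2 mul1mx -mulmxA w2 mulmx1 rdiagE ncR.
Qed.

Definition riesz_cst p : R := 4 * 2 `^ p * 2 `^ p * dyadic_cst p.

Lemma riesz_cst_ge0 p : 1 < p < 2 -> 0 <= riesz_cst p.
Proof.
move=> /andP[q1 q2]; rewrite /riesz_cst mulr_ge0 ?mulr_ge0 ?powR_ge0// /dyadic_cst.
have : 0 <= (2 `^ (2 - p) - 1)^-1 :> R.
  by rewrite invr_ge0 subr_ge0 ltW// powR2_gt1// subr_gt0.
have : 0 <= (1 - 2 `^ (1 - p))^-1 :> R.
  by rewrite invr_ge0 subr_ge0 ltW// powR2_lt1// subr_lt0.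
lra.
Qed.

Lemma spow_hilbertmx_le n (Y : 'M[C]_n) p : 1 < p < 2 -> psdmx Y ->
  spow p (hilbertmx Y) <= riesz_cst p * spow p Y.
Proof.
move=> p12 Y0; have p1 : 1 <= p by case/andP: p12 => /ltW.
have [W [y [w1 w2 YE y0]]] := spectral_psd Y0.
have hX : (hilbertmx Y)^H = hilbertmx Y by exact/hilbertmx_hermitian/psdmx_hermitian.
have [W' [x [w1' w2' XE]]] := spectral_hermitian hX.
apply: le_trans (spow_hermitian_le p1 w2' w1' XE) _.
have weak (s : R) : 0 < s -> \sum_i (2 <= s * `|x i|)%R%:R <=
    4 * \sum_i Num.min (s * y i) ((s * y i) ^+ 2).
  by move=> s0; exact: (hilbertmx_weak s0 Y0 w2 w1 YE y0 w2' w1' XE).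
have x0 i : 0 <= `|x i| by exact: normr_ge0.
apply: le_trans (strong_of_weak p12 _ x0 y0 weak) _; first by [].
rewrite -/(riesz_cst p); apply: (ler_wpM2l (riesz_cst_ge0 p12)).
apply: le_trans (spow_eigen_ge p1 w2 w1 YE).
by apply: ler_sum => i _; rewrite ger0_norm.
Qed.

End Triangular.

(** * Multipliers of finite matrices *)

(* lra compares atoms up to conversion, which is expensive for norms of
   matrices; hence the abstraction of these atoms. *)
Ltac norm_lra :=
  repeat match goal with H : is_true _ |- _ => revert H end;
  repeat match goal with |- context [@snorm ?R ?m ?n ?p ?A] =>
    let x := fresh "x" in generalize (@snorm R m n p A); intro x end;
  intros; lra.

Section FiniteMultiplier.
Context {R : realType}.
Local Notation C := R[i].

Definition hadmx (mu : nat -> nat -> C) n (A : 'M[C]_n) : 'M[C]_n :=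
  \matrix_(i, j) (mu i j * A i j).

Lemma hadmxD mu n (A B : 'M[C]_n) : hadmx mu (A + B) = hadmx mu A + hadmx mu B.
Proof. by apply/matrixP => i j; rewrite !mxE mulrDr. Qed.

Lemma hadmxZ mu n c (A : 'M[C]_n) : hadmx mu (c *: A) = c *: hadmx mu A.
Proof. by apply/matrixP => i j; rewrite !mxE mulrCA. Qed.

Definition tri_cst (p : R) : R := riesz_cst p `^ p^-1.

Lemma snorm_hilbertmx_le n (Y : 'M[C]_n) p : 1 < p < 2 -> psdmx Y ->
  snorm p (hilbertmx Y) <= tri_cst p * snorm p Y.
Proof.
move=> p12 Y0; have /andP[p1 p2] := p12; have p0 : 0 < p by lra.
apply: snorm_le_spow => //; first by rewrite mulr_ge0 ?snorm_ge0 ?powR_ge0.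
rewrite powRM ?snorm_ge0 ?powR_ge0// snormE// /tri_cst powRKV//.
  exact: spow_hilbertmx_le.
exact: riesz_cst_ge0.
Qed.

Lemma snorm_diag_le n (c : 'I_n -> C) (A : 'M[C]_n) p : 1 <= p ->
  (forall i, nc (c i) <= 1) ->
  snorm p (diag_mx (\row_i (c i * A i i))) <= snorm p A.
Proof.
move=> p1 c1; have p0 : 0 < p by lra.
apply: snorm_le => //.
(* The phases of the diagonal entries; at a zero entry the quotient is 0, which a contraction allows
   as well. *)
pose u i := (c i * A i i) / (nc (c i * A i i))%:C.
have -> : diag_mx (\row_i (c i * A i i)) =
    diag_mx (\row_i u i) *m rdiag (fun i => nc (c i * A i i)) *m 1%:M.
  rewrite mulmx1 /rdiag mulmx_diag; congr diag_mx; apply/rowP => i; rewrite !mxE /u.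
  have [->|z] := eqVneq (c i * A i i) 0; first by rewrite !mul0r.
  by rewrite mulfVK// -normcC normr_eq0.
have cu : contrmx (diag_mx (\row_i u i)).
  apply: contrmx_diag => i; rewrite mxE /u normcC ncM.
  have [->|z] := eqVneq (c i * A i i) 0; first by rewrite nc0 mul0r lecR.
  have zp : 0 < nc (c i * A i i).
    by rewrite -ltcR -normcC normr_gt0.
  by rewrite -fmorphV ncR ger0_norm ?invr_ge0 ?(ltW zp)// mulfV ?gt_eqF// lecR.
have nn i : 0 <= nc (c i * A i i) by exact: nc_ge0.
apply: le_trans (spow_decomp_le p1 cu (@contrmx1 _ n) nn) _.
apply: le_trans (spow_pinching A p1 (@contrmx1 _ n) (@contrmx1 _ n)).
apply: ler_sum => i _; rewrite mul1mx mulmx1; apply: powR_mono => //; first exact: ltW.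
by rewrite ncM ler_piMl ?nc_ge0.
Qed.

Lemma upmxE n (A : 'M[C]_n) :
  upmx A = (2^-1)%:C *: (A + - dgmx A + 'i *: hilbertmx A).
Proof.
rewrite {2}(tri_decomp A) addrK /hilbertmx scalerA -expr2 sqrCi scaleN1r opprB.
have -> : upmx A + lomx A + (upmx A - lomx A) = (2 : R)%:C *: upmx A.
  by apply/matrixP => i j; rewrite !(addmxE, oppmxE, scalemxE) rmorphD rmorph1; ring.
by rewrite scalerA -rmorphM mulVf// scale1r.
Qed.

Lemma lomxE n (A : 'M[C]_n) :
  lomx A = (2^-1)%:C *: (A + - dgmx A + - ('i *: hilbertmx A)).
Proof.
rewrite {2}(tri_decomp A) addrK /hilbertmx scalerA -expr2 sqrCi scaleN1r opprK.
have -> : upmx A + lomx A + (lomx A - upmx A) = (2 : R)%:C *: lomx A.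
  by apply/matrixP => i j; rewrite !(addmxE, oppmxE, scalemxE) rmorphD rmorph1; ring.
by rewrite scalerA -rmorphM mulVf// scale1r.
Qed.

Lemma nc_i : nc ('i : C) = 1.
Proof. by apply: complexI; rewrite -normcC normCi. Qed.

Lemma snorm_tri_le n (Y : 'M[C]_n) p : 1 < p < 2 -> psdmx Y ->
  snorm p (upmx Y) <= (2 + tri_cst p) * snorm p Y /\
  snorm p (lomx Y) <= (2 + tri_cst p) * snorm p Y.
Proof.
move=> p12 Y0; have p1 : 1 <= p by case/andP: p12 => /ltW.
have sk := snorm_hilbertmx_le p12 Y0.
have isk : snorm p ('i *: hilbertmx Y) <= tri_cst p * snorm p Y.
  by apply: le_trans (snormZ _ _ p1) _; rewrite nc_i mul1r.
have dg : snorm p (- dgmx Y) <= snorm p Y.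
  apply: le_trans (snormN _ p1) _.
  have -> : dgmx Y = diag_mx (\row_i (1 * Y i i)).
    by congr diag_mx; apply/rowP => i; rewrite !mxE mul1r.
  apply: snorm_diag_le => // i.
  by rewrite -[1 : C]/((1 : R)%:C) ncR normr1.
have half (B : 'M[C]_n) : snorm p ((2^-1)%:C *: B) <= snorm p B.
  apply: le_trans (snormZ _ _ p1) _; apply: (ler_piMl (snorm_ge0 _ _)).
  by rewrite ncR ger0_norm; norm_lra.
have YD : snorm p (Y + - dgmx Y) <= snorm p Y + snorm p Y.
  by apply: le_trans (snorm_triangle _ _ p1) _; rewrite lerD2l.
split.
  rewrite upmxE; apply: le_trans (half _) _.
  apply: le_trans (snorm_triangle _ _ p1) _; norm_lra.
rewrite lomxE; apply: le_trans (half _) _.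
apply: le_trans (snorm_triangle _ _ p1) _.
apply: le_trans (lerD YD (le_trans (snormN _ p1) isk)) _; norm_lra.
Qed.

Lemma hadmx_max n (nn mm : nat -> bool) (A : 'M[C]_n) :
  hadmx (max_mx nn mm) A =
  1%:M *m upmx A *m rdiag (fun i => (mm i)%:R) + rdiag (fun i => (mm i)%:R) *m lomx A *m 1%:M
  + diag_mx (\row_i ((nn i)%:R * A i i)).
Proof.
rewrite mul1mx mulmx1 mul_mx_diag mul_diag_mx; apply/matrixP => i j; rewrite !mxE /max_mx.
have natE (b : bool) : (b%:R : R)%:C = b%:R by case: b.
rewrite !natE; have [ij|ij|/val_inj->] := ltngtP i j.
- have -> : (i == j) = false by apply/eqP => e; rewrite e ltnn in ij.
  rewrite ?mul0r ?mulr0 mulr0n !addr0.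
  by rewrite mulrC.
- have -> : (i == j) = false by apply/eqP => e; rewrite e ltnn in ij.
  by rewrite mul0r mulr0n addr0 add0r.
- by rewrite ?eqxx mul0r mulr0 !add0r mulr1n.
Qed.

Lemma natb_contr n (f : 'I_n -> bool) : contrmx (rdiag (fun i => (f i)%:R) : 'M[C]_n).
Proof. by apply: rdiag_contr => i; case: (f i); rewrite ?normr1 ?normr0. Qed.

Lemma snorm_contr m n m' n' (A : 'M[C]_(m, n)) (D : 'M[C]_(m', m)) (E : 'M[C]_(n, n')) p :
  1 <= p -> contrmx D -> contrmx E -> snorm p (D *m A *m E) <= snorm p A.
Proof. by move=> p1 cD cE; apply: snorm_le; [norm_lra|exact: spow_contr]. Qed.

Lemma snorm_hadmx_psd n (nn mm : nat -> bool) (Y : 'M[C]_n) p : 1 < p < 2 -> psdmx Y ->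
  snorm p (hadmx (max_mx nn mm) Y) <= (5 + 2 * tri_cst p) * snorm p Y.
Proof.
move=> p12 Y0; have p1 : 1 <= p by case/andP: p12 => /ltW.
have [uY lY] := snorm_tri_le p12 Y0.
rewrite hadmx_max; apply: le_trans (snorm_triangle _ _ p1) _.
have h3 : snorm p (diag_mx (\row_i ((nn i)%:R * Y i i))) <= snorm p Y.
  apply: snorm_diag_le => // i; case: (nn i); last by rewrite nc0 ler01.
  by rewrite -[1%:R : C]/((1 : R)%:C) ncR normr1.
have cD : contrmx (rdiag (fun i : 'I_n => (mm i)%:R) : 'M[C]_n).
  exact: (natb_contr (fun i : 'I_n => mm i)).
apply: le_trans (lerD (snorm_triangle _ _ p1) h3) _.
apply: le_trans (lerD (lerD (snorm_contr _ p1 (@contrmx1 _ n) cD)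
  (snorm_contr _ p1 cD (@contrmx1 _ n))) (lexx _)) _.
by norm_lra.
Qed.

(** The two parts are H times functions of H with values in {0, 1} and {-1, 0}. These are
    contractions, so neither norm exceeds that of H. *)
Lemma hermitian_split n (H : 'M[C]_n) p : 1 <= p -> H^H = H ->
  exists Y Z, [/\ H = Y + (- 1) *: Z, psdmx Y, psdmx Z,
    snorm p Y <= snorm p H & snorm p Z <= snorm p H].
Proof.
move=> p1 hH; have [W [x [w1 w2 HE]]] := spectral_hermitian hH.
have cW : contrmx W by exact: contrmx_isometry.
have cut (e : 'I_n -> R) : (forall i, `|e i| <= 1) -> (forall i, 0 <= e i * x i) ->
    psdmx (W^H *m rdiag (fun i => e i * x i) *m W) /\
    snorm p (W^H *m rdiag (fun i => e i * x i) *m W) <= snorm p H.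
  move=> e1 ex; split; first by apply: psdmx_conj; exact: rdiag_psd.
  have -> : W^H *m rdiag (fun i => e i * x i) *m W = (W^H *m rdiag e *m W) *m H *m 1%:M.
    by rewrite -rdiagM mulmx1 {1}HE -!mulmxA (mulmxA W (W^H)) w2 mul1mx.
  apply: snorm_contr p1 _ (@contrmx1 _ n).
  exact: (contrmxM (contrmxM (contrmx_adj cW) (rdiag_contr e1)) cW).
pose e (i : 'I_n) : R := (0 <= x i)%R%:R; pose f (i : 'I_n) : R := - (x i < 0)%R%:R.
have e1 i : `|e i| <= 1 by rewrite /e; case: (0 <= x i)%R; rewrite ?normr1 ?normr0.
have f1 i : `|f i| <= 1 by rewrite /f normrN; case: (x i < 0)%R; rewrite ?normr1 ?normr0.
have ex i : 0 <= e i * x i by rewrite /e; case: (leP 0 (x i)) => h; rewrite ?mul1r ?mul0r.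
have fx i : 0 <= f i * x i.
  by rewrite /f; case: (ltP (x i) 0) => h; rewrite ?mulN1r ?oppr0 ?mul0r// oppr_ge0 ltW.
have [Y0 Yn] := cut e e1 ex; have [Z0 Zn] := cut f f1 fx.
exists (W^H *m rdiag (fun i => e i * x i) *m W), (W^H *m rdiag (fun i => f i * x i) *m W).
split; [|exact: Y0|exact: Z0|exact: Yn|exact: Zn].
rewrite scaleN1r -mulmxBl -mulmxBr rdiagB {1}HE.
congr (_ *m rdiag _ *m _); apply/funext => i; rewrite /e /f.
by case: (ltP (x i) 0) => h; rewrite ?(mulN1r, oppr0, mul0r, subr0, mul1r, sub0r, opprK).
Qed.

(** The previous bound concerns positive matrices. The factor 4 comes from splitting A into two
    Hermitian matrices of norm at most that of A, and each of them into two positive ones. *)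
Lemma snorm_hadmx_lt2 n (nn mm : nat -> bool) (A : 'M[C]_n) p : 1 < p < 2 ->
  snorm p (hadmx (max_mx nn mm) A) <= (4 * (5 + 2 * tri_cst p)) * snorm p A.
Proof.
move=> p12; have p1 : 1 <= p by case/andP: p12 => /ltW.
have T0 : 0 <= tri_cst p by exact: powR_ge0.
set mu := max_mx nn mm; set K := 5 + 2 * tri_cst p.
have K0 : 0 <= K by rewrite /K; norm_lra.
have ncm1 : nc (-1 : C) = 1 by rewrite ncN -[1 : C]/((1 : R)%:C) ncR normr1.
have herm (H : 'M[C]_n) : H^H = H -> snorm p (hadmx mu H) <= 2 * K * snorm p H.
  move=> /(hermitian_split p1)[Y [Z [-> Y0 Z0]]].
  set N := snorm p (Y + _) => YN ZN.
  rewrite hadmxD hadmxZ; apply: le_trans (snorm_triangle _ _ p1) _.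
  have := snormZ (-1) (hadmx mu Z) p1; rewrite ncm1 mul1r.
  have := snorm_hadmx_psd nn mm p12 Y0; have := snorm_hadmx_psd nn mm p12 Z0.
  rewrite -/mu -/K; have := ler_wpM2l K0 YN; have := ler_wpM2l K0 ZN; norm_lra.
pose H1 := (2^-1)%:C *: (A + A^H); pose H2 := ((2^-1)%:C * 'i) *: (A^H - A).
have AE : A = H1 + 'i *: H2.
  rewrite /H1 /H2 scalerA mulrCA -expr2 sqrCi mulrN1.
  apply/matrixP => i j; rewrite !(addmxE, oppmxE, scalemxE) mulNr.
  have e2 : (2^-1 : R)%:C + (2^-1)%:C = 1 :> C.
    by rewrite -rmorphD; congr real_complex_def; norm_lra.
  by rewrite -[LHS]mul1r -e2; ring.
have h1 : H1^H = H1 by rewrite /H1 adjmxZ real_complex_conj adjmxD adjmxK addrC.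
have h2 : H2^H = H2.
  rewrite /H2 adjmxZ rmorphM/= conjCi real_complex_conj adjmxB adjmxK.
  by rewrite mulrN scaleNr -scalerN opprB.
have sA : snorm p (A^H) <= snorm p A.
  by rewrite /snorm spow_adj.
have n1 : snorm p H1 <= snorm p A.
  apply: le_trans (snormZ _ _ p1) _; rewrite ncR ger0_norm ?invr_ge0//.
  have := snorm_triangle A (A^H) p1; norm_lra.
have n2 : snorm p H2 <= snorm p A.
  apply: le_trans (snormZ _ _ p1) _; rewrite ncM nc_i mulr1 ncR ger0_norm ?invr_ge0//.
  have hh : snorm p (A^H - A) <= 2 * snorm p A.
    apply: le_trans (snorm_triangle _ _ p1) _.
    apply: le_trans (lerD sA (snormN _ p1)) _; norm_lra.
  apply: le_trans (ler_wpM2l _ hh) _; norm_lra.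
clearbody H1 H2 K.
rewrite {1}AE hadmxD hadmxZ; apply: le_trans (snorm_triangle _ _ p1) _.
have K20 : 0 <= 2 * K by rewrite mulr_ge0.
have b3 : snorm p ('i *: hadmx mu H2) <= snorm p (hadmx mu H2).
  apply: le_trans (snormZ _ _ p1) _; rewrite nc_i mul1r; exact: lexx.
have E : 4 * K * snorm p A = 2 * K * snorm p A + 2 * K * snorm p A.
  by move: (snorm p A) => a; ring.
rewrite E.
refine (lerD _ _).
  refine (le_trans (herm _ h1) _).
  exact: (ler_wpM2l K20 n1).
refine (le_trans b3 _).
refine (le_trans (herm _ h2) _).
exact: (ler_wpM2l K20 n2).
Qed.

Lemma snorm_hadmx_2 n (nn mm : nat -> bool) (A : 'M[C]_n) :
  snorm 2 (hadmx (max_mx nn mm) A) <= snorm 2 A.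
Proof.
apply: snorm_le => //; rewrite !spow2; apply: ler_sum => i _; apply: ler_sum => j _.
rewrite mxE ncM; have -> : nc (max_mx nn mm i j : C) =
    (if val i == val j then nn i else mm (maxn i j))%:R.
  rewrite /max_mx; case: (if _ then _ else _); last by rewrite nc0.
  by rewrite -[1%:R : C]/((1 : R)%:C) ncR normr1.
case: (if _ then _ else _); first by rewrite mul1r.
by rewrite mul0r expr0n sqr_ge0.
Qed.

Lemma trace_hadmx (mu : nat -> nat -> C) n (A B : 'M[C]_n) :
  (forall i j, ((mu i j)^*)%R = mu i j) ->
  \tr (hadmx mu A *m B^H) = \tr (A *m (hadmx mu B)^H).
Proof.
move=> mur; apply: eq_bigr => i _; rewrite !mxE; apply: eq_bigr => j _.
by rewrite !adjmxE !mxE rmorphM/= mur -mulrA mulrCA.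
Qed.

(** A real Schur multiplier is its own adjoint for the pairing tr (A B^H), so a bound at q passes to
    the conjugate exponent p with the same K. *)
Lemma snorm_hadmx_dual (mu : nat -> nat -> C) n p q K : 1 < p -> 1 < q ->
  p^-1 + q^-1 = 1 -> 0 <= K -> (forall i j, ((mu i j)^*)%R = mu i j) ->
  (forall B : 'M[C]_n, snorm q (hadmx mu B) <= K * snorm q B) ->
  forall A : 'M[C]_n, snorm p (hadmx mu A) <= K * snorm p A.
Proof.
move=> p1 q1 pq K0 mur h A.
apply: (trace_dual p1 q1 pq); first by rewrite mulr_ge0 ?snorm_ge0.
move=> B; rewrite trace_hadmx//.
apply: le_trans (trace_hoelder _ _ (ltW p1) (ltW q1) pq) _.
rewrite -[leRHS]mulrA [leRHS]mulrCA; exact: (ler_wpM2l (snorm_ge0 _ _) (h B)).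
Qed.

End FiniteMultiplier.

(** * Sequences of complex numbers *)

Section ComplexSequences.
Context {R : realType}.
Local Notation C := R[i].
Implicit Types (u v : nat -> C) (l : C).

Definition ctends u l : Prop := (u : nat -> C^o) @ \oo --> (l : C^o).

(** The radii of balls in [C^o] are themselves complex numbers; here they become real ones. *)
Lemma ctendsP u l : ctends u l <->
  forall e : R, 0 < e -> exists N, forall n, (N <= n)%N -> nc (u n - l) < e.
Proof.
split=> [h e e0|h].
  have /cvgrPdist_lt h' := h.
  have e0' : 0 < e%:C :> C by rewrite ltcR.
  have [N _ HN] := h' _ e0'.
  exists N => n Nn; have := HN n Nn; rewrite /= distrC normcC ltcR; exact.
apply/cvgrPdist_lt => e e0.
have eE : e = (complex.Re e)%:C by rewrite RRe_real// gtr0_real.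
have e0' : 0 < complex.Re e by rewrite -ltcR -eE.
have [N HN] := h _ e0'.
exists N => // n Nn; rewrite /= distrC normcC eE ltcR; exact: HN.
Qed.

Lemma ctends_unique u l l' : ctends u l -> ctends u l' -> l = l'.
Proof. exact: (@cvg_unique _ (@norm_hausdorff _ C^o)). Qed.

Lemma ctends_cst l : ctends (fun=> l) l.
Proof. exact: cvg_cst. Qed.

Lemma ctendsD u v l l' : ctends u l -> ctends v l' ->
  ctends (fun n => u n + v n) (l + l').
Proof. exact: cvgD. Qed.

Lemma ctendsN u l : ctends u l -> ctends (fun n => - u n) (- l).
Proof. exact: cvgN. Qed.

Lemma ctendsM u v l l' : ctends u l -> ctends v l' ->
  ctends (fun n => u n * v n) (l * l').
Proof. exact: (@cvgM C). Qed.

Lemma ctends_sum (I : Type) (r : seq I) (P : pred I) (f : I -> nat -> C) (l : I -> C) :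
  (forall i, ctends (f i) (l i)) ->
  ctends (fun n => \sum_(i <- r | P i) f i n) (\sum_(i <- r | P i) l i).
Proof.
move=> h; elim: r => [|i r IH].
  rewrite big_nil; have -> : (fun n => \sum_(i <- [::] | P i) f i n) = fun=> 0.
    by apply/funext => n; rewrite big_nil.
  exact: ctends_cst.
rewrite big_cons; have -> : (fun n => \sum_(j <- i :: r | P j) f j n) =
   (fun n => (if P i then f i n else 0) + \sum_(j <- r | P j) f j n).
  by apply/funext => n; rewrite big_cons; case: (P i); rewrite ?add0r.
case: (P i); first exact: (ctendsD (h i) IH).
have -> : (fun n => 0 + \sum_(j <- r | P j) f j n) = (fun n => \sum_(j <- r | P j) f j n).
  by apply/funext => n; rewrite add0r.
exact: IH.
Qed.

Lemma ctends_conj u l : ctends u l -> ctends (fun n => (u n)^*)%R (l^*)%R.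
Proof.
move=> /ctendsP h; apply/ctendsP => e e0; have [N HN] := h _ e0.
by exists N => n Nn; rewrite -rmorphB ncJ; exact: HN.
Qed.

Lemma ctends_near u v l N : ctends u l -> (forall n, (N <= n)%N -> u n = v n) -> ctends v l.
Proof.
move=> /ctendsP h e; apply/ctendsP => d d0; have [M HM] := h _ d0.
exists (maxn M N) => n; rewrite geq_max => /andP[Mn Nn].
by rewrite -e// HM.
Qed.

Lemma nc_dist (z w : C) : `|nc z - nc w| <= nc (z - w).
Proof.
rewrite ler_norml; have h1 := ncD (z - w) w; have h2 := ncD (w - z) z.
by rewrite !subrK in h1 h2; rewrite -(ncN (w - z)) opprB in h2; apply/andP; split; lra.
Qed.

Lemma ctends_nc_le u l B : ctends u l -> (forall n, nc (u n) <= B) -> nc l <= B.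
Proof.
move=> /ctendsP h b; apply/ler_addgt0Pr => e e0.
have [N /(_ N (leqnn _)) HN] := h _ e0.
have := nc_dist (u N) l; rewrite ler_norml => /andP[h1 h2].
by have := b N; lra.
Qed.

Lemma Re_le_nc (z : C) : `|complex.Re z| <= nc z.
Proof. by rewrite -lecR -normcC normc_ge_Re. Qed.

Lemma Im_le_nc (z : C) : `|complex.Im z| <= nc z.
Proof.
case: z => a b /=; rewrite -[leLHS]sqrtr_sqr ler_wsqrtr//.
by rewrite lerDr sqr_ge0.
Qed.

Lemma ReB (z w : C) : complex.Re (z - w) = complex.Re z - complex.Re w.
Proof. by case: z w => [a b] [c d]. Qed.

Lemma ImB (z w : C) : complex.Im (z - w) = complex.Im z - complex.Im w.
Proof. by case: z w => [a b] [c d]. Qed.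

Lemma ctends_ge0 u l : ctends u l -> (forall n, 0 <= u n) -> 0 <= l.
Proof.
move=> /ctendsP h b; rewrite lecE/=; apply/andP; split.
  rewrite -normr_le0; apply/ler_addgt0Pr => e e0; rewrite add0r.
  have [N /(_ N (leqnn _)) HN] := h _ e0.
  apply: le_trans (ltW HN); apply: le_trans (Im_le_nc _).
  by rewrite ImB (ger0_Im (b N)) sub0r normrN.
apply/ler_addgt0Pr => e e0.
have [N /(_ N (leqnn _)) HN] := h _ e0.
have := le_trans (Re_le_nc _) (ltW HN); rewrite ReB ler_norml => /andP[_].
have : 0 <= complex.Re (u N) by have := b N; rewrite lecE => /andP[].
by lra.
Qed.

(** The centre l may vary with e, as when u is compared with other convergent sequences.
    Completeness is taken from the reals, for Re and Im separately. *)
Lemma ccauchy u : (forall e : R, 0 < e -> exists N l, forall n, (N <= n)%N -> nc (u n - l) <= e) ->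
  exists l, ctends u l.
Proof.
move=> h.
have rc (f : C -> R) : (forall z w, `|f z - f w| <= nc (z - w)) ->
    exists l : R, forall e : R, 0 < e -> exists N, forall n, (N <= n)%N -> `|f (u n) - l| < e.
  move=> fl; have : cvgn (f \o u : nat -> R^o).
    apply/cauchy_cvgP/cauchy_exP => e e0.
    have e2 : 0 < e / 4 by rewrite divr_gt0.
    have [N [l Hl]] := h _ e2.
    exists (f (u N)); exists N => // n /= Nn; rewrite /ball/=.
    have := le_trans (fl _ _) (Hl _ (leqnn N)); have := le_trans (fl _ _) (Hl _ Nn).
    rewrite !ler_norml ltr_norml => /andP[? ?] /andP[? ?]; apply/andP; split; lra.
  move=> /cvg_ex[l /cvgrPdist_lt Hl]; exists l => e e0.
  by have [N _ HN] := Hl _ e0; exists N => n Nn; rewrite distrC; exact: HN.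
have reL (z w : C) : `|complex.Re z - complex.Re w| <= nc (z - w).
  by rewrite -ReB Re_le_nc.
have imL (z w : C) : `|complex.Im z - complex.Im w| <= nc (z - w).
  by rewrite -ImB Im_le_nc.
have [a Ha] := rc _ reL.
have [b Hb] := rc _ imL.
exists (Complex a b); apply/ctendsP => e e0.
have e2 : 0 < e / 2 by rewrite divr_gt0.
have [N HN] := Ha _ e2; have [M HM] := Hb _ e2.
exists (maxn N M) => n; rewrite geq_max => /andP[Nn Mn].
have := HN _ Nn; have := HM _ Mn; case: (u n) => x y /=.
set p := x - a; set q := y - b => qe pe.
apply: (@le_lt_trans _ _ (`|p| + `|q|)); last by lra.
rewrite -[leRHS]ger0_norm ?addr_ge0// -sqrtr_sqr ler_wsqrtr//.
rewrite -(real_normK (num_real p)) -(real_normK (num_real q)).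
have := normr_ge0 p; have := normr_ge0 q; nra.
Qed.

Lemma csum_ctends (u : nat -> C) l : ctends (fun N => \sum_(k < N) u k) l ->
  cvgn (cseries u) /\ csum u = l.
Proof.
move=> h; have e : (cseries u : nat -> C) = (fun N => \sum_(k < N) u k).
  by apply/funext => N; rewrite /cseries /series/= big_mkord.
have h' : (cseries u) @ \oo --> (l : C^o) by move: h; rewrite /ctends -e.
split; first by apply/cvg_ex; exists l.
by apply: cvg_lim h'; exact: norm_hausdorff.
Qed.

Definition ssq (N : nat) (x : nat -> C) : R := \sum_(k < N) nc (x k) ^+ 2.

Lemma ssq_ge0 N x : 0 <= ssq N x.
Proof. by apply: sumr_ge0 => k _; exact: sqr_ge0. Qed.

Lemma ssq_le N M x : (N <= M)%N -> ssq N x <= ssq M x.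
Proof.
move=> NM; rewrite /ssq -(subnKC NM) big_split_ord/= lerDl.
by apply: sumr_ge0 => k _; exact: sqr_ge0.
Qed.

Lemma ssq_finite n N (x : nat -> C) : (forall k, (n <= k)%N -> x k = 0) ->
  ssq N x <= ssq n x.
Proof.
move=> x0; have [Nn|nN] := leqP N n; first exact: ssq_le.
rewrite /ssq -(subnKC (ltnW nN)) big_split_ord/= [X in _ + X]big1 ?addr0// => k _.
by rewrite x0 ?leq_addr// nc0 expr0n.
Qed.

Lemma ssq_tail (x : nat -> C) A (d : R) : (forall N, ssq N x <= A) -> 0 < d ->
  exists m, forall N, (m <= N)%N -> ssq N x - ssq m x <= d.
Proof.
move=> xA d0; pose S := [set ssq N x | N in [set: nat]].
have hS : has_sup S.
  split; first by exists (ssq 0 x), 0%N.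
  by exists A => _ [N _ <-].
have [_ [m _ <-] hm] := sup_adherent d0 hS.
exists m => N mN; have : ssq N x <= sup S by apply: ub_le_sup; [case: hS|exists N].
by lra.
Qed.

Lemma weighted_cauchy_schwarz (I : finType) (P : pred I) (a b : I -> R) t : 0 < t ->
  \sum_(i | P i) a i * b i <= (\sum_(i | P i) a i ^+ 2) / t + t * \sum_(i | P i) b i ^+ 2.
Proof.
move=> t0; rewrite mulr_suml mulr_sumr -big_split/=; apply: ler_sum => i _.
rewrite -subr_ge0.
have -> : a i ^+ 2 / t + t * b i ^+ 2 - a i * b i =
    ((a i - t * b i) ^+ 2 + a i ^+ 2 + (t * b i) ^+ 2) / (2 * t).
  by field; rewrite gt_eqF.
by rewrite divr_ge0 ?addr_ge0 ?sqr_ge0// mulr_ge0// ltW.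
Qed.

(** m depends on u, B and e only: the tails of the pairing are small uniformly over all y of squared
    norm at most B. This is what allows limits under the sum in [weak_cvg]. *)
Lemma weak_tail (u : nat -> C) A B e : 0 < e -> 0 <= B ->
  (forall N, ssq N u <= A) ->
  exists m, forall N, (m <= N)%N -> forall y : nat -> C, ssq N y <= B ->
    nc (\sum_(k < N) u k * y k - \sum_(k < m) u k * y k) <= e.
Proof.
(* t balances the two halves of Cauchy-Schwarz: t B <= e / 2, and the tail of u is then taken at
   most (e / 2) t. *)
move=> e0 B0 uA; pose t := e / 2 / (B + 1).
have t0 : 0 < t by rewrite !divr_gt0//; lra.
have d0 : 0 < e / 2 * t by rewrite mulr_gt0// divr_gt0.
have [m Hm] := ssq_tail uA d0; exists m => N mN z zB.
have -> : \sum_(k < N) u k * z k - \sum_(k < m) u k * z k =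
    \sum_(k < N | (m <= k)%N) u k * z k.
  rewrite (big_ord_widen_cond N (fun=> true) (fun k => u k * z k) mN)/=.
  rewrite (bigID (fun k : 'I_N => (k < m)%N))/= addrC addrK.
  by apply: eq_bigl => k; rewrite -leqNgt.
have uE : \sum_(k < N | (m <= k)%N) nc (u k) ^+ 2 = ssq N u - ssq m u.
  rewrite /ssq (big_ord_widen_cond N (fun=> true) (fun k => nc (u k) ^+ 2) mN)/=.
  rewrite [in RHS](bigID (fun k : 'I_N => (k < m)%N))/= addrC addrK.
  by apply: eq_bigl => k; rewrite -leqNgt.
apply: le_trans (nc_sum _ _ _) _; under eq_bigr do rewrite ncM.
apply: le_trans (weighted_cauchy_schwarz _ _ _ t0) _.
have h1 : (\sum_(k < N | (m <= k)%N) nc (u k) ^+ 2) / t <= e / 2.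
  by rewrite uE ler_pdivrMr//; exact: Hm.
have h2 : \sum_(k < N | (m <= k)%N) nc (z k) ^+ 2 <= B.
  apply: le_trans zB; rewrite /ssq [leRHS](bigID (fun k : 'I_N => (m <= k)%N))/= lerDl.
  by apply: sumr_ge0 => k _; exact: sqr_ge0.
have h3 : t * \sum_(k < N | (m <= k)%N) nc (z k) ^+ 2 <= t * B by rewrite ler_wpM2l// ltW.
have h4 : t * B <= e / 2.
  have -> : e / 2 = t * (B + 1) by rewrite /t; field; lra.
  by rewrite ler_wpM2l ?(ltW t0)//; lra.
lra.
Qed.

(** A fixed l^2 sequence u is paired with bounded vectors that converge coordinatewise, that is,
    weakly. The vector y N lives on the first N coordinates, like a column of the N-th corner, which
    makes the pairing a finite sum. *)
Lemma weak_cvg (u : nat -> C) (y : nat -> nat -> C) (z : nat -> C) A B :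
  (forall N, ssq N u <= A) -> (forall N, ssq N (y N) <= B) ->
  (forall N k, (N <= k)%N -> y N k = 0) ->
  (forall k, ctends (y ^~ k) (z k)) ->
  [/\ ctends (fun N => \sum_(k < N) u k * y N k) (csum (fun k => u k * z k)),
      ctends (fun N => \sum_(k < N) u k * z k) (csum (fun k => u k * z k)),
      cvgn (cseries (fun k => u k * z k)) & forall N, ssq N z <= B].
Proof.
move=> uA yB y0 yz.
have B0 : 0 <= B by apply: le_trans (yB 0%N); exact: ssq_ge0.
have yB' N M : ssq M (y N) <= B.
  by apply: le_trans (yB N); apply: ssq_finite => k; exact: y0.
have zB N : ssq N z <= B.
  have : ctends (fun M => \sum_(k < N) (y M k)^* * y M k)%R (\sum_(k < N) (z k)^* * z k)%R.
    by apply: ctends_sum => k; apply: ctendsM; [exact: ctends_conj|].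
  move=> lim.
  have sE (x : nat -> C) : nc (\sum_(k < N) (x k)^* * x k)%R = ssq N x.
    under eq_bigr do rewrite -nc_conjM.
    by rewrite -(rmorph_sum (real_complex R)) ncR ger0_norm// ssq_ge0.
  by have := @ctends_nc_le _ _ B lim; rewrite sE; apply => M; rewrite sE.
have [l Hl] : exists l, ctends (fun N => \sum_(k < N) u k * z k) l.
  apply: ccauchy => e e0; have [m Hm] := weak_tail e0 B0 uA.
  by exists m, (\sum_(k < m) u k * z k) => n mn; exact: Hm n mn z (zB n).
have [cv sE] := @csum_ctends (fun k => u k * z k) l Hl.
split; rewrite ?sE; [|exact: Hl|exact: cv|exact: zB].
apply/ctendsP => e e0; have e4 : 0 < e / 4 by rewrite divr_gt0.
have e3 : 0 < e / 2 by rewrite divr_gt0.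
have [m Hm] := weak_tail e4 B0 uA.
have : ctends (fun n => \sum_(k < m) u k * y n k) (\sum_(k < m) u k * z k).
  by apply: ctends_sum => k; apply: ctendsM; [exact: ctends_cst|exact: yz].
move=> /ctendsP/(_ _ e4)[N HN].
have /ctendsP/(_ _ e4)[M HM] := Hl.
exists (maxn m (maxn N M)) => n; rewrite !geq_max => /and3P[mn Nn Mn].
have h1 := Hm n mn (y n) (yB' n n); have h2 := HN n Nn.
have h3 := Hm n mn z (zB n); have h4 := HM n Mn.
set s1 := \sum_(k < n) u k * y n k in h1 *; set s2 := \sum_(k < m) u k * y n k in h1 h2.
set s3 := \sum_(k < m) u k * z k in h2 h3; set s4 := \sum_(k < n) u k * z k in h3 h4.
have := ncD (s1 - s2) (s2 - s3); rewrite addrA subrK => h5.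
have := ncD (s1 - s3) (s3 - s4); rewrite addrA subrK => h6.
have := ncD (s1 - s4) (s4 - l); rewrite addrA subrK => h7.
have : nc (s3 - s4) <= e / 4 by rewrite -ncN opprB.
lra.
Qed.

End ComplexSequences.

(** * Bounded operators as limits of their corners *)

Section BoundedOperators.
Context {R : realType}.
Local Notation C := R[i].
Implicit Types (a b c : imatrix R).

Definition blk m n a : 'M[C]_(m, n) := \matrix_(i, j) a i j.

Definition nsq n (x : 'cV[C]_n) : R := \sum_i nc (x i 0) ^+ 2.

Lemma nsq_ge0 n (x : 'cV[C]_n) : 0 <= nsq x.
Proof. by apply: sumr_ge0 => i _; exact: sqr_ge0. Qed.

Lemma gram_nsq n (x : 'cV[C]_n) : (x^H *m x) 0 0 = (nsq x)%:C.
Proof. exact: gram_colE. Qed.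

Definition bndmx m n (M : R) (A : 'M[C]_(m, n)) :=
  psdmx ((M ^+ 2)%:C *: 1%:M - A^H *m A).

Lemma bndmx_contr m n (A : 'M[C]_(m, n)) : bndmx 1 A <-> contrmx A.
Proof. by rewrite /bndmx expr1n rmorph1 scale1r. Qed.

Lemma bndmx_col_le m n M (A : 'M[C]_(m, n)) j : bndmx M A ->
  \sum_k nc (A k j) ^+ 2 <= M ^+ 2.
Proof.
move=> /(psdmx_entry j); rewrite addmxE oppmxE scalemxE mxE eqxx mulr1 gram_colE.
by rewrite -rmorphB ler0c subr_ge0.
Qed.

Lemma bndmx_form m n M (A : 'M[C]_(m, n)) x :
  (x^H *m ((M ^+ 2)%:C *: 1%:M - A^H *m A) *m x) 0 0 =
  (M ^+ 2 * nsq x - nsq (A *m x))%:C.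
Proof.
rewrite rmorphB (rmorphM _ (M ^+ 2))/= -!gram_nsq (adjmxM A x).
rewrite mulmxBr mulmxBl -scalemxAr -scalemxAl mulmx1 addmxE oppmxE scalemxE.
by rewrite !mulmxA.
Qed.

Lemma bndmxP m n M (A : 'M[C]_(m, n)) :
  bndmx M A <-> forall x, nsq (A *m x) <= M ^+ 2 * nsq x.
Proof.
split=> h x; have := h x; rewrite bndmx_form ler0c subr_ge0 //.
Qed.

Lemma bndmx_mul m n k Ma Mb (A : 'M[C]_(m, n)) (B : 'M[C]_(n, k)) :
  bndmx Ma A -> bndmx Mb B -> bndmx (Ma * Mb) (A *m B).
Proof.
move=> /bndmxP hA /bndmxP hB; apply/bndmxP => x; rewrite -mulmxA exprMn -mulrA.
by apply: le_trans (hA _) _; rewrite ler_wpM2l ?sqr_ge0.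
Qed.

Lemma bndmx_adj m n M (A : 'M[C]_(m, n)) : 0 <= M -> bndmx M A -> bndmx M (A^H).
Proof.
rewrite le_eqVlt => /predU1P[<-|M0].
  rewrite /bndmx expr0n/= !scale0r !sub0r => /gram_mx_eq0 ->.
  by rewrite adjmx0 adjmx0 mul0mx oppr0; exact: psdmx0.
have e k l (B : 'M[C]_(k, l)) : (M ^+ 2)%:C *: 1%:M - B^H *m B =
   (M ^+ 2)%:C *: (1%:M - (M^-1%:C *: B)^H *m (M^-1%:C *: B)).
  rewrite adjmxZ real_complex_conj -scalemxAl -scalemxAr scalerA scalerBr scalerA.
  rewrite -!rmorphM -expr2 -exprMn mulfV ?gt_eqF// expr1n rmorph1.
  by rewrite scale1r.
have M2 : 0 <= (M ^+ 2)%:C :> C by rewrite ler0c sqr_ge0.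
have M2' : 0 <= (M ^- 2)%:C :> C by rewrite ler0c invr_ge0 sqr_ge0.
have M2V : M ^- 2 * M ^+ 2 = 1 by rewrite mulVf// expf_neq0// gt_eqF.
rewrite /bndmx => h; rewrite e; apply: (psdmxZ M2).
have c0 : contrmx (M^-1%:C *: A).
  rewrite /contrmx; have := psdmxZ M2' h; rewrite e scalerA -rmorphM.
  by rewrite M2V rmorph1 scale1r; exact.
by have := contrmx_adj c0; rewrite adjmxZ real_complex_conj.
Qed.

Lemma bndmx_rowsub m n k M (f : 'I_k -> 'I_m) (A : 'M[C]_(m, n)) : injective f ->
  bndmx M A -> bndmx M (rowsub f A).
Proof.
move=> fI /bndmxP h; apply/bndmxP => x; apply: le_trans (h x); rewrite /nsq.
have -> : \sum_i nc ((rowsub f A *m x) i 0) ^+ 2 = \sum_(i in f @: 'I_k) nc ((A *m x) i 0) ^+ 2.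
  rewrite big_imset/=; last by move=> i j _ _; exact: fI.
  by apply: eq_bigr => i _; rewrite !mxE; congr (nc _ ^+ 2); apply: eq_bigr => j _; rewrite !mxE.
rewrite [leRHS](bigID (mem (f @: 'I_k)))/= lerDl.
by apply: sumr_ge0 => i _; exact: sqr_ge0.
Qed.

Lemma bndmx_colsub m n k M (g : 'I_k -> 'I_n) (A : 'M[C]_(m, n)) : 0 <= M -> injective g ->
  bndmx M A -> bndmx M (colsub g A).
Proof.
move=> M0 gI /(bndmx_adj M0)/(bndmx_rowsub gI)/(bndmx_adj M0).
suff -> : (rowsub g (A^H))^H = colsub g A by [].
by apply/matrixP => i j; rewrite adjmxE !mxE conjCK.
Qed.

Definition mctends m n (F : nat -> 'M[C]_(m, n)) (A : 'M[C]_(m, n)) :=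
  forall i j, ctends (fun K => F K i j) (A i j).

Lemma mctends_cst m n (A : 'M[C]_(m, n)) : mctends (fun=> A) A.
Proof. by move=> i j; exact: ctends_cst. Qed.

Lemma mctendsM m n k (F : nat -> 'M[C]_(m, n)) (G : nat -> 'M[C]_(n, k)) A B :
  mctends F A -> mctends G B -> mctends (fun K => F K *m G K) (A *m B).
Proof.
move=> h1 h2 i j; rewrite mxE.
have -> : (fun K => (F K *m G K) i j) = (fun K => \sum_l F K i l * G K l j).
  by apply/funext => K; rewrite mxE.
by apply: ctends_sum => l; apply: ctendsM; [exact: h1|exact: h2].
Qed.

Lemma mctends_adj m n (F : nat -> 'M[C]_(m, n)) A :
  mctends F A -> mctends (fun K => (F K)^H) (A^H).
Proof.
move=> h i j; rewrite adjmxE.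
have -> : (fun K => (F K)^H i j) = (fun K => (F K j i)^*)%R.
  by apply/funext => K; rewrite adjmxE.
exact: (ctends_conj (h j i)).
Qed.

Lemma mctendsD m n (F G : nat -> 'M[C]_(m, n)) A B :
  mctends F A -> mctends G B -> mctends (fun K => F K + G K) (A + B).
Proof.
move=> h1 h2 i j; rewrite mxE.
have -> : (fun K => (F K + G K) i j) = (fun K => F K i j + G K i j).
  by apply/funext => K; rewrite mxE.
exact: (ctendsD (h1 i j) (h2 i j)).
Qed.

Lemma mctendsN m n (F : nat -> 'M[C]_(m, n)) A :
  mctends F A -> mctends (fun K => - F K) (- A).
Proof.
move=> h1 i j; rewrite mxE.
have -> : (fun K => (- F K) i j) = (fun K => - F K i j).
  by apply/funext => K; rewrite mxE.
exact: (ctendsN (h1 i j)).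
Qed.

Lemma psdmx_lim n (F : nat -> 'M[C]_n) A : mctends F A -> (forall K, psdmx (F K)) -> psdmx A.
Proof.
move=> h p x.
have := mctendsM (mctendsM (@mctends_cst _ _ (x^H)) h) (@mctends_cst _ _ x).
by move=> /(_ 0 0)/ctends_ge0; apply => K; exact: p.
Qed.

Lemma bndmx_lim m n M (F : nat -> 'M[C]_(m, n)) A : mctends F A ->
  (forall K, bndmx M (F K)) -> bndmx M A.
Proof.
move=> h b; apply: psdmx_lim (mctendsD (@mctends_cst _ _ _) (mctendsN
  (mctendsM (mctends_adj h) h))) _.
exact: b.
Qed.

(** By [opnorm_leP], the condition that the operator norm is at most M, in terms of finite matrices
    only. *)
Definition obnd M a := 0 <= M /\ forall n, bndmx M (blk n n a).

Lemma obnd_blk M a m n : obnd M a -> bndmx M (blk m n a).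
Proof.
move=> [M0 h].
have wI p q (pq : (p <= q)%N) : injective (widen_ord pq).
  by move=> i j /(congr1 val) /= e; exact: val_inj.
have := bndmx_colsub M0 (wI _ _ (leq_maxr m n))
  (bndmx_rowsub (wI _ _ (leq_maxl m n)) (h (maxn m n))).
suff -> : colsub (widen_ord (leq_maxr m n)) (rowsub (widen_ord (leq_maxl m n))
    (blk (maxn m n) (maxn m n) a)) = blk m n a by [].
by apply/matrixP => i j; rewrite !mxE.
Qed.

Lemma nsq_col n (x : nat -> C) : nsq (\col_(i < n) x i) = ssq n x.
Proof. by apply: eq_bigr => i _; rewrite mxE. Qed.

Lemma obnd_mulv M a m n (v : nat -> C) : obnd M a ->
  ssq m (fun k => \sum_(l < n) a k l * v l) <= M ^+ 2 * ssq n v.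
Proof.
move=> /(@obnd_blk _ _ m n)/bndmxP/(_ (\col_(i < n) v i)); rewrite nsq_col.
apply: le_trans; rewrite le_eqVlt; apply/predU1P; left.
apply: eq_bigr => i _; rewrite mxE; congr (nc _ ^+ 2).
by apply: eq_bigr => l _; rewrite !mxE.
Qed.

Lemma blk_iadj m n a : blk m n (iadj a) = (blk n m a)^H.
Proof. by apply/matrixP => i j; rewrite adjmxE !mxE. Qed.

Lemma obnd_iadj M a : obnd M a -> obnd M (iadj a).
Proof.
move=> [M0 h]; split; [exact: M0|move=> n].
rewrite blk_iadj; exact: (bndmx_adj M0 (h n)).
Qed.

Lemma obnd_col M a j N : obnd M a -> ssq N (fun k => a k j) <= M ^+ 2.
Proof.
move=> /(@obnd_blk _ _ N j.+1)/(bndmx_col_le (Ordinal (ltnSn j))).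
by under eq_bigr do rewrite mxE.
Qed.

Lemma ssq_conj N (x : nat -> C) : ssq N (fun k => (x k)^*)%R = ssq N x.
Proof. by apply: eq_bigr => k _; rewrite ncJ. Qed.

Lemma obnd_row M a i N : obnd M a -> ssq N (a i) <= M ^+ 2.
Proof. by move=> /obnd_iadj/(@obnd_col _ _ i N); rewrite /iadj ssq_conj. Qed.

Lemma l2_csum (u z : nat -> C) A B : (forall N, ssq N u <= A) -> (forall N, ssq N z <= B) ->
  ctends (fun N => \sum_(k < N) u k * z k) (csum (fun k => u k * z k)) /\
  cvgn (cseries (fun k => u k * z k)).
Proof.
move=> uA zB.
have [||k|_ h1 h2 _] := @weak_cvg _ u (fun N k => if (k < N)%N then z k else 0) z A B uA.
- by move=> N; apply: le_trans (zB N); rewrite le_eqVlt; apply/predU1P; left;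
    apply: eq_bigr => k _; rewrite ltn_ord.
- by move=> N k Nk; rewrite ltnNge Nk.
- by apply: (@ctends_near _ (fun=> z k) _ _ k.+1) => [|n kn]; [exact: ctends_cst|rewrite kn].
by split.
Qed.

Lemma imul_ctends Ma Mb a b i j : obnd Ma a -> obnd Mb b ->
  ctends (fun N => \sum_(k < N) a i k * b k j) (imul a b i j).
Proof.
move=> ha hb.
by have [] := l2_csum (fun N => obnd_row i N ha) (fun N => obnd_col j N hb).
Qed.

Lemma blk_imul Ma Mb a b m n : obnd Ma a -> obnd Mb b ->
  mctends (fun K => blk m K a *m blk K n b) (blk m n (imul a b)).
Proof.
move=> ha hb i j; rewrite mxE.
have -> : (fun K => (blk m K a *m blk K n b) i j) = (fun K => \sum_(k < K) a i k * b k j).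
  by apply/funext => K; rewrite mxE; apply: eq_bigr => k _; rewrite !mxE.
exact: imul_ctends ha hb.
Qed.

Lemma obnd_imul Ma Mb a b : obnd Ma a -> obnd Mb b -> obnd (Ma * Mb) (imul a b).
Proof.
move=> ha hb; split; first by case: ha hb => [? _] [? _]; rewrite mulr_ge0.
move=> n; apply: bndmx_lim (blk_imul ha hb) _ => K.
by apply: bndmx_mul; exact: obnd_blk.
Qed.

(** Products of infinite matrices are not associative in general. For bounded operators both sides
    are limits of the same sums over k, l < N, each by [weak_cvg]. *)
Lemma imulA Ma Mb Mc a b c : obnd Ma a -> obnd Mb b -> obnd Mc c ->
  imul (imul a b) c = imul a (imul b c).
Proof.
move=> ha hb hc; apply/funext => i; apply/funext => j.
pose s N := \sum_(k < N) \sum_(l < N) a i k * b k l * c l j.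
have h1 : ctends s (imul a (imul b c) i j).
  have [||k|h _ _ _] := @weak_cvg _ (a i)
    (fun N k => if (k < N)%N then \sum_(l < N) b k l * c l j else 0)
    (fun k => imul b c k j) (Ma ^+ 2) (Mb ^+ 2 * Mc ^+ 2) (fun N => obnd_row i N ha).
  - move=> N; have h := obnd_mulv N N (fun l => c l j) hb.
    apply: (@le_trans _ _ (Mb ^+ 2 * ssq N (fun l => c l j))); last first.
      by rewrite ler_wpM2l ?sqr_ge0//; exact: obnd_col.
    apply: le_trans h; rewrite le_eqVlt; apply/predU1P; left.
    by apply: eq_bigr => k _; rewrite ltn_ord.
  - by move=> N k Nk; rewrite ltnNge Nk.
  - apply: (@ctends_near _ _ _ _ k.+1 (@imul_ctends _ _ _ _ k j hb hc)) => n kn.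
    by rewrite kn.
  apply: (@ctends_near _ _ _ _ 0 h) => n _; apply: eq_bigr => k _.
  by rewrite ltn_ord mulr_sumr; apply: eq_bigr => l _; rewrite mulrA.
have h2 : ctends s (imul (imul a b) c i j).
  have hb' := obnd_iadj hb; have ha' := obnd_iadj ha.
  have [||l|h _ _ _] := @weak_cvg _ (fun l => c l j)
    (fun N l => if (l < N)%N then \sum_(k < N) a i k * b k l else 0)
    (fun l => imul a b i l) (Mc ^+ 2) (Mb ^+ 2 * Ma ^+ 2) (fun N => obnd_col j N hc).
  - move=> N; have h := obnd_mulv N N (fun k => (a i k)^*)%R hb'.
    apply: (@le_trans _ _ (Mb ^+ 2 * ssq N (fun k => (a i k)^*)%R)); last first.
      by rewrite ler_wpM2l ?sqr_ge0// ssq_conj; exact: obnd_row.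
    apply: le_trans h; rewrite le_eqVlt; apply/predU1P; left.
    apply: eq_bigr => l _; rewrite ltn_ord -ncJ rmorph_sum; congr (nc _ ^+ 2).
    by apply: eq_bigr => k _; rewrite rmorphM mulrC.
  - by move=> N k Nk; rewrite ltnNge Nk.
  - apply: (@ctends_near _ _ _ _ l.+1 (@imul_ctends _ _ _ _ i l ha hb)) => n kn.
    by rewrite kn.
  have e : (fun k => c k j * imul a b i k) = (fun k => imul a b i k * c k j).
    by apply/funext => k; rewrite mulrC.
  rewrite /imul -/(imul a b) -e.
  apply: (@ctends_near _ _ _ _ 0 h) => n _; rewrite /s exchange_big/=.
  apply: eq_bigr => k _; rewrite ltn_ord mulr_sumr; apply: eq_bigr => l _.
  by rewrite mulrC.
exact: ctends_unique h2 h1.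
Qed.

Lemma l2norm_leP (x : nat -> C) B : 0 <= B ->
  ((l2norm x <= B%:E)%E <-> forall N, ssq N x <= B ^+ 2).
Proof.
move=> B0.
have p0 k : (0 <= ((nc (x k)) ^+ 2)%:E)%E by rewrite lee_fin sqr_ge0.
have S0 : (0 <= \sum_(0 <= k <oo) ((nc (x k)) ^+ 2)%:E)%E by exact: nneseries_ge0.
have sE N : (ssq N x)%:E = (\sum_(0 <= k < N) ((nc (x k)) ^+ 2)%:E)%E.
  by rewrite sumEFin big_mkord.
have half0 : (0 <= 2^-1 :> R)%R by rewrite invr_ge0.
have i0y (y : \bar R) : (0 <= y)%E -> y \in `[0%E, +oo%E] by move=> y0; rewrite in_itv/= y0 leey.
split=> [h N|h].
  rewrite -lee_fin sE; apply: le_trans (nneseries_lim_ge N _) _; first by move=> *; exact: p0.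
  have two0 : (0 <= 2 :> R)%R by [].
  have := gt0_ler_poweR two0 (i0y _ (poweR_ge0 _ _)) (i0y B%:E _) h.
  rewrite lee_fin => /(_ B0); rewrite -poweRrM mulVf// poweRe1//.
  by rewrite poweR_EFin powR_mulrn.
have hS : (\sum_(0 <= k <oo) ((nc (x k)) ^+ 2)%:E <= (B ^+ 2)%:E)%E.
  apply: lime_le; first exact: is_cvg_nneseries.
  by apply: nearW => N; rewrite -sE lee_fin.
have := gt0_ler_poweR half0 (i0y _ S0) (i0y (B ^+ 2)%:E _) hS.
rewrite lee_fin sqr_ge0 => /(_ isT) /le_trans; apply.
by rewrite poweR_EFin -powR_mulrn// -powRrM mulfV// powRr1.
Qed.

Lemma opnorm_ge0 a : (0 <= opnorm a)%E.
Proof. by apply: le_ereal_inf_tmp => _ [x [x0 _] <-]; rewrite lee_fin. Qed.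

(** From left to right, test on vectors supported in the first n coordinates. Conversely the rows
    are in l^2, so the series converge, and the bound on corners passes to the limit. *)
Lemma opnorm_leP a M : 0 <= M -> ((opnorm a <= M%:E)%E <-> forall n, bndmx M (blk n n a)).
Proof.
move=> M0; split=> [h n|h].
  apply/bndmxP => x; apply/ler_addgt0Pr => e e0.
  (* For d' <= 1, (M + d')^2 <= M^2 + (2 M + 1) d'; hence a bound M' < M + d' with d' <= d costs at
     most e. *)
  pose d := e / ((2 * M + 1) * (nsq x + 1)).
  have nx := nsq_ge0 x.
  have d0 : 0 < d by rewrite divr_gt0// mulr_gt0//; lra.
  pose d' := Num.min d 1.
  have d'0 : 0 < d' by rewrite lt_min d0 ltr01.
  have : (opnorm a < (M + d')%:E)%E by apply: le_lt_trans h _; rewrite lte_fin ltrDl.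
  move=> /ereal_inf_lt[_ [M' [M'0 hM'] <-]]; rewrite lte_fin => M'M.
  pose v k := if insub k is Some i then x i 0 else 0 : C.
  have vE (i : 'I_n) : v i = x i 0 by rewrite /v valK.
  have v0 k : (n <= k)%N -> v k = 0 by move=> nk; rewrite /v insubF// ltnNge nk.
  have vs N : ssq N v <= nsq x.
    have -> : nsq x = ssq n v by apply: eq_bigr => i _; rewrite vE.
    exact: ssq_finite.
  have sn0 : 0 <= Num.sqrt (nsq x) by exact: sqrtr_ge0.
  have lv : (l2norm v <= (Num.sqrt (nsq x))%:E)%E.
    by apply/(l2norm_leP _ sn0) => N; rewrite sqr_sqrtr.
  have [|_ lav] := hM' v; first by apply: le_lt_trans lv _; exact: ltry.
  have : (l2norm (imulv a v) <= (M' * Num.sqrt (nsq x))%:E)%E.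
    by apply: le_trans lav _; rewrite EFinM; apply: lee_wpmul2l; rewrite ?lee_fin.
  move=> /(l2norm_leP _ (mulr_ge0 M'0 sn0))/(_ n).
  rewrite exprMn sqr_sqrtr//.
  have -> : ssq n (imulv a v) = nsq (blk n n a *m x).
    apply: eq_bigr => i _; congr (nc _ ^+ 2); rewrite mxE /imulv.
    have lim : ctends (fun N => \sum_(k < N) a i k * v k) (\sum_(k < n) a i k * v k).
      apply: (@ctends_near _ (fun=> \sum_(k < n) a i k * v k) _ _ n) => [|N nN].
        exact: ctends_cst.
      rewrite -(subnKC nN) big_split_ord/= [X in _ = _ + X]big1 ?addr0// => k _.
      by rewrite v0 ?leq_addr// mulr0.
    have [_ ->] := @csum_ctends _ (fun k => a i k * v k) _ lim.
    by apply: eq_bigr => k _; rewrite mxE vE.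
  move=> /le_trans; apply.
  have h1 : M' ^+ 2 <= M ^+ 2 + (2 * M + 1) * d'.
    have d'1 : d' <= 1 by rewrite /d' ge_min lexx orbT.
    have : M' ^+ 2 <= (M + d') ^+ 2 by rewrite lerXn2r ?nnegrE ?(ltW M'M)//; lra.
    nra.
  have h2 : (2 * M + 1) * d' * (nsq x) <= e.
    have h3 : (2 * M + 1) * d' * nsq x <= (2 * M + 1) * d * (nsq x + 1).
      apply: ler_pM => //; [by rewrite mulr_ge0 ?(ltW d'0)//; lra| |lra].
      by rewrite ler_wpM2l ?/d' ?ge_min ?lexx//; lra.
    apply: le_trans h3 _; rewrite /d le_eqVlt; apply/predU1P; left; field.
    by rewrite !gt_eqF//; lra.
  have := ler_wpM2r nx h1; rewrite mulrDl; lra.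
apply: ereal_inf_lbound; exists M => //; split => // x xfin.
have ob : obnd M a by split.
have x0 : (0 <= l2norm x)%E by exact: poweR_ge0.
have xE : l2norm x = (fine (l2norm x))%:E by rewrite fineK// ge0_fin_numE.
have r0 : 0 <= fine (l2norm x) by exact: fine_ge0.
have xs N : ssq N x <= fine (l2norm x) ^+ 2.
  by move: N; apply/(l2norm_leP _ r0); rewrite -xE.
have cs i := l2_csum (fun N => obnd_row i N ob) xs.
split; first by move=> i; case: (cs i).
rewrite xE -EFinM; apply/l2norm_leP; first by rewrite mulr_ge0.
move=> N; rewrite exprMn.
have lim : ctends (fun K => \sum_(i < N) (\sum_(k < K) a i k * x k)^* *
     (\sum_(k < K) a i k * x k))%R (\sum_(i < N) (imulv a x i)^* * imulv a x i)%R.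
  by apply: ctends_sum => i; have [h' _] := cs i; exact: (ctendsM (ctends_conj h') h').
have sE (y : nat -> C) : nc (\sum_(k < N) (y k)^* * y k)%R = ssq N y.
  under eq_bigr do rewrite -nc_conjM.
  by rewrite -(rmorph_sum (real_complex R)) ncR ger0_norm// ssq_ge0.
have := @ctends_nc_le _ _ _ (M ^+ 2 * fine (l2norm x) ^+ 2) lim; rewrite sE; apply => K.
rewrite (sE (fun i => \sum_(k < K) a i k * x k)).
by apply: le_trans (obnd_mulv N K x ob) _; rewrite ler_wpM2l ?sqr_ge0.
Qed.

End BoundedOperators.

(** * Bernstein polynomials *)

Section Bernstein.
Context {R : realType}.
Implicit Types (f g : nat -> R) (x e M K s t c d p : R).

(* bern n f is the Bernstein polynomial of degree n with nodes f 0, ..., f n,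
   defined by de Casteljau's recursion. *)
Fixpoint bern (n : nat) f : {poly R} :=
  if n is n'.+1 then 'X * bern n' (fun k => f k.+1) + (1 - 'X) * bern n' f else (f 0%N)%:P.

Lemma bernS n f x :
  (bern n.+1 f).[x] = x * (bern n (fun k => f k.+1)).[x] + (1 - x) * (bern n f).[x].
Proof. by rewrite /= !hornerE. Qed.

Lemma bern0 f x : (bern 0 f).[x] = f 0%N.
Proof. by rewrite /= hornerC. Qed.

Lemma bern_le n f g x : 0 <= x <= 1 -> (forall k, (k <= n)%N -> f k <= g k) ->
  (bern n f).[x] <= (bern n g).[x].
Proof.
move=> /andP[x0 x1]; elim: n f g => [|n IH] f g fg; first by rewrite !bern0 fg.
rewrite !bernS; apply: lerD; apply: ler_wpM2l; rewrite ?subr_ge0//; apply: IH => k kn.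
  exact: fg.
by apply: fg; rewrite (leq_trans kn).
Qed.

Lemma bern_affine n f x c d :
  (bern n (fun k => c + d * f k)).[x] = c + d * (bern n f).[x].
Proof.
elim: n f => [|n IH] f; first by rewrite !bern0.
by rewrite !bernS (IH (fun k => f k.+1)) IH; ring.
Qed.

(** The second moment about c of the binomial distribution; the recursion replaces c by c - 1. At c
    = n x only the variance n x (1 - x) remains. *)
Lemma bern_variance n x c :
  (bern n (fun k => (k%:R - c) ^+ 2)).[x] = n%:R * (x * (1 - x)) + (n%:R * x - c) ^+ 2.
Proof.
elim: n c => [|n IH] c; first by rewrite bern0; ring.
rewrite bernS IH.
have -> : (fun k : nat => (k.+1%:R - c) ^+ 2) = (fun k => (k%:R - (c - 1)) ^+ 2).
  by apply/funext => k; rewrite -natr1; ring.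
by rewrite IH -natr1; ring.
Qed.

Definition poly_approx (h : R -> R) (M : R) := forall e, 0 < e ->
  exists q : {poly R}, forall t, 0 <= t <= M -> `|q.[t] - h t| <= e.

(** This quadratic modulus of continuity is what Bernstein polynomials handle directly: they
    preserve inequalities between functions, and their value on a squared distance is a binomial
    variance. *)
Lemma weierstrass (h : R -> R) M :
  (forall e, 0 < e -> exists2 K, 0 <= K & forall s t, 0 <= s <= M -> 0 <= t <= M ->
     `|h s - h t| <= e + K * (s - t) ^+ 2) ->
  poly_approx h M.
Proof.
move=> hh e e0; have [M0|M0] := leP M 0.
  exists (h 0)%:P => t /andP[t0 tM]; rewrite hornerC.
  have -> : t = 0 by apply/eqP; rewrite eq_le t0 (le_trans tM).
  by rewrite subrr normr0 ltW.
have e2 : 0 < e / 2 by rewrite divr_gt0.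
have [K K0 hK] := hh _ e2.
(* A degree for which the variance term K M^2 / n is at most e / 2. *)
pose n := (Num.trunc (K * M ^+ 2 / (e / 2))).+1.
have n0 : 0 < n%:R :> R by rewrite ltr0n.
have nK : K * M ^+ 2 / n%:R <= e / 2.
  rewrite ler_pdivrMr// [leRHS]mulrC -ler_pdivrMr//; apply/ltW; exact: truncnS_gt.
pose f k := h (M * (k%:R / n%:R)).
exists (bern n f \Po (M^-1 *: 'X)) => t /andP[t0 tM].
rewrite horner_comp hornerZ hornerX mulrC; set x := t / M.
have x0 : 0 <= x by rewrite divr_ge0// ltW.
have x1 : x <= 1 by rewrite ler_pdivrMr// mul1r.
have x01 : 0 <= x <= 1 by rewrite x0 x1.
have tE : t = M * x by rewrite /x; field; lra.
pose v k := e / 2 + K * M ^+ 2 / n%:R ^+ 2 * (k%:R - n%:R * x) ^+ 2.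
have node k : (k <= n)%N -> `|f k - h t| <= v k.
  move=> kn; apply: le_trans (hK _ _ _ _) _.
  - rewrite mulr_ge0 ?divr_ge0 ?ler0n ?(ltW M0)//= ler_piMr ?(ltW M0)//.
    by rewrite ler_pdivrMr// mul1r ler_nat.
  - by rewrite t0 tM.
  rewrite /v lerD2l tE le_eqVlt; apply/predU1P; left.
  by field; rewrite gt_eqF.
have var : (bern n v).[x] <= e.
  rewrite (bern_affine n (fun k => (k%:R - n%:R * x) ^+ 2)) bern_variance subrr expr0n/= addr0.
  have -> : K * M ^+ 2 / n%:R ^+ 2 * (n%:R * (x * (1 - x))) = K * M ^+ 2 / n%:R * (x * (1 - x)).
    by field; rewrite gt_eqF.
  have : x * (1 - x) <= 1 by nra.
  have : 0 <= K * M ^+ 2 / n%:R.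
    apply: mulr_ge0; last by rewrite invr_ge0 ltW.
    by apply: mulr_ge0 => //; exact: sqr_ge0.
  move: nK; set w := K * M ^+ 2 / n%:R; move=> w1 w0 xx.
  have : w * (x * (1 - x)) <= w * 1 by rewrite ler_wpM2l.
  lra.
rewrite ler_norml; apply/andP; split.
- have : (bern n (fun k => h t + -1 * v k)).[x]
    <= (bern n f).[x].
    by apply: bern_le => // k /node; rewrite ler_norml => /andP[]; lra.
  by rewrite (bern_affine n v); lra.
- have : (bern n f).[x] <= (bern n (fun k => h t + 1 * v k)).[x].
    by apply: bern_le => // k /node; rewrite ler_norml => /andP[]; lra.
  by rewrite (bern_affine n v); lra.
Qed.

Lemma poly_approx_sqrt M : poly_approx Num.sqrt M.
Proof.
(* If the roots a, b of s, t are at distance w > e, then (s - t)^2 = w^2 (a + b)^2 >= w^4 >= e^3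
   w. *)
apply: weierstrass => e e0; exists (e ^- 3); first by rewrite invr_ge0 exprn_ge0// ltW.
move=> s t /andP[s0 _] /andP[t0 _].
have a0 := sqrtr_ge0 s; have b0 := sqrtr_ge0 t.
rewrite -{2}(sqr_sqrtr s0) -{2}(sqr_sqrtr t0).
set a := Num.sqrt s in a0 *; set b := Num.sqrt t in b0 *.
have e3 : 0 < e ^+ 3 by rewrite exprn_gt0.
have [|we] := leP `|a - b| e.
  by move=> we; apply: le_trans we _; rewrite lerDl mulr_ge0 ?sqr_ge0// invr_ge0 ltW.
apply: (@le_trans _ _ (e ^- 3 * (a ^+ 2 - b ^+ 2) ^+ 2)); last by rewrite lerDr ltW.
rewrite mulrC ler_pdivlMr//.
set w := `|a - b| in we *.
have w0 : 0 <= w by exact: normr_ge0.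
have wab : w <= a + b.
  by rewrite /w ler_norml; apply/andP; split; lra.
have -> : (a ^+ 2 - b ^+ 2) ^+ 2 = w ^+ 2 * (a + b) ^+ 2.
  by rewrite subr_sqr exprMn /w real_normK ?num_real.
apply: (@le_trans _ _ (w ^+ 2 * w ^+ 2)); last first.
  by rewrite ler_wpM2l ?sqr_ge0// lerXn2r ?nnegrE//; lra.
have -> : w ^+ 2 * w ^+ 2 = w * w ^+ 3 by ring.
by rewrite ler_wpM2l// lerXn2r ?nnegrE ?(ltW we) ?(ltW e0).
Qed.

Lemma poly_approx_powR p M : 1 <= p -> poly_approx (fun t => t `^ p) M.
Proof.
move=> p1; apply: weierstrass => e e0; pose L := p * M `^ (p - 1).
have L0 : 0 <= L by rewrite mulr_ge0 ?powR_ge0//; lra.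
(* L is a Lipschitz constant on [0, M], and L d <= e + L^2 d^2 / e by the arithmetic-geometric mean
   inequality. *)
exists (L ^+ 2 / e); first by rewrite divr_ge0 ?sqr_ge0 ?ltW.
have half (s t : R) : 0 <= s <= M -> 0 <= t <= M -> t `^ p - s `^ p <= L * `|s - t|.
  move=> /andP[s0 sM] /andP[t0 tM].
  have := powR_tangent p1 s0 t0.
  have tM' : t `^ (p - 1) <= M `^ (p - 1) by rewrite powR_mono// subr_ge0.
  have h1 : p * t `^ (p - 1) * (t - s) <= p * t `^ (p - 1) * `|s - t|.
    by rewrite ler_wpM2l ?mulr_ge0 ?powR_ge0//; [lra|rewrite distrC ler_norm].
  have h2 : p * t `^ (p - 1) * `|s - t| <= L * `|s - t|.
    by rewrite ler_wpM2r// /L ler_wpM2l//; lra.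
  have -> : p * t `^ (p - 1) * (s - t) = - (p * t `^ (p - 1) * (t - s)) by ring.
  lra.
move=> s t hs ht.
have : `|s `^ p - t `^ p| <= L * `|s - t|.
  rewrite ler_norml; have := half _ _ hs ht; have := half _ _ ht hs.
  by rewrite distrC => ? ?; apply/andP; split; lra.
move=> /le_trans; apply; rewrite -[(s - t) ^+ 2]real_normK ?num_real//.
set d := `|s - t|.
have -> : e + L ^+ 2 / e * d ^+ 2 = (e - L * d) ^+ 2 / e + 2 * (L * d).
  by field; rewrite gt_eqF.
have : 0 <= (e - L * d) ^+ 2 / e by rewrite divr_ge0 ?sqr_ge0 ?ltW.
have : 0 <= L * d by rewrite mulr_ge0 ?normr_ge0.
lra.
Qed.

End Bernstein.

(** * Functional calculus *)

Section FunctionalCalculus.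
Context {R : realType}.
Local Notation C := R[i].
Implicit Types (f g : R -> R) (T : imatrix R).

Lemma hfun_subproof n (A : 'M[C]_n) : exists Wd : 'M[C]_n * ('I_n -> R), A^H = A ->
  [/\ Wd.1^H *m Wd.1 = 1%:M, Wd.1 *m Wd.1^H = 1%:M & A = Wd.1^H *m rdiag Wd.2 *m Wd.1].
Proof.
have [hA|nA] := pselect (A^H = A).
  by have [W [d h]] := spectral_hermitian hA; exists (W, d) => _.
by exists (0, fun=> 0) => /nA.
Qed.

(** The diagonalization depends on A alone, so that the same eigenvectors serve all f at once. The
    value is meaningful for Hermitian A. *)
Definition hfun n f (A : 'M[C]_n) : 'M[C]_n :=
  let Wd := sval (cid (hfun_subproof A)) in Wd.1^H *m rdiag (f \o Wd.2) *m Wd.1.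

Lemma hfun_spec n (A : 'M[C]_n) : A^H = A -> exists (W : 'M[C]_n) (d : 'I_n -> R),
  [/\ W^H *m W = 1%:M, W *m W^H = 1%:M, A = W^H *m rdiag d *m W &
      forall f, hfun f A = W^H *m rdiag (f \o d) *m W].
Proof.
move=> hA; rewrite /hfun; case: cid => -[W d] /= h.
by have [h1 h2 h3] := h hA; exists W, d; split=> [|||f]; [exact: h1|exact: h2|exact: h3|].
Qed.

Definition mpow n (A : 'M[C]_n) k : 'M[C]_n := iter k (mulmx A) 1%:M.

Lemma spectral_diag_entry n (W : 'M[C]_n) (d : 'I_n -> R) i : W *m W^H = 1%:M ->
  (W *m (W^H *m rdiag d *m W) *m W^H) i i = (d i)%:C.
Proof. by move=> w2; rewrite !mulmxA w2 mul1mx -mulmxA w2 mulmx1 rdiagE. Qed.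

Lemma psd_eigen_ge0 n (W : 'M[C]_n) (d : 'I_n -> R) i : W *m W^H = 1%:M ->
  psdmx (W^H *m rdiag d *m W) -> 0 <= d i.
Proof.
move=> w2 /(psdmx_conj (W^H))/(psdmx_entry i).
by rewrite adjmxK spectral_diag_entry// ler0c.
Qed.

Lemma unitary_gram n (W : 'M[C]_n) (d : 'I_n -> R) (M : R) :
  W^H *m W = 1%:M -> W *m W^H = 1%:M ->
  (M ^+ 2)%:C *: 1%:M - (W^H *m rdiag d *m W)^H *m (W^H *m rdiag d *m W) =
  W^H *m rdiag (fun i => M ^+ 2 - d i ^+ 2) *m W.
Proof.
move=> w1 w2; rewrite (adjmxM _ W) (adjmxM (W^H)) adjmxK adj_rdiag.
rewrite -!mulmxA (mulmxA W) w2 mul1mx (mulmxA (rdiag d)) rdiagM.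
have -> : rdiag (fun i => M ^+ 2 - d i ^+ 2) =
    (M ^+ 2)%:C *: 1%:M - rdiag (fun i => d i * d i) :> 'M[C]_n.
  have -> : (M ^+ 2)%:C *: 1%:M = rdiag (fun=> M ^+ 2) :> 'M[C]_n.
    by rewrite -rdiag1; apply/matrixP => i j; rewrite !mxE mulrnAr mulr1.
  by rewrite rdiagB; congr rdiag; apply/funext => i; rewrite expr2.
by rewrite mulmxBl mulmxBr -scalemxAl -scalemxAr mul1mx w1.
Qed.

Lemma bnd_eigen_le n (W : 'M[C]_n) (d : 'I_n -> R) i M : W^H *m W = 1%:M ->
  W *m W^H = 1%:M -> 0 <= M -> bndmx M (W^H *m rdiag d *m W) -> `|d i| <= M.
Proof.
move=> w1 w2 M0; rewrite /bndmx (unitary_gram _ _ w1 w2) => /(psd_eigen_ge0 i w2).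
rewrite subr_ge0 -[_ ^+ 2]real_normK ?num_real// => h.
by rewrite -(@ler_pXn2r _ 2) ?nnegrE.
Qed.

Lemma hfun_bnd n f (A : 'M[C]_n) M e : psdmx A -> 0 <= M -> bndmx M A -> 0 <= e ->
  (forall t, 0 <= t <= M -> `|f t| <= e) -> bndmx e (hfun f A).
Proof.
move=> A0 M0 AM e0 fe; have [W [d [w1 w2 AE ->]]] := hfun_spec (psdmx_hermitian A0).
rewrite /bndmx (unitary_gram _ _ w1 w2); apply: psdmx_conj; apply: rdiag_psd => i /=.
rewrite subr_ge0 -[_ ^+ 2]real_normK ?num_real// ler_pXn2r ?nnegrE//.
apply: fe; rewrite AE in A0 AM; rewrite (psd_eigen_ge0 i w2 A0)/=.
by apply: le_trans (bnd_eigen_le i w1 w2 M0 AM); rewrite ler_norm.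
Qed.

Lemma hfun_psd n f (A : 'M[C]_n) M : psdmx A -> 0 <= M -> bndmx M A ->
  (forall t, 0 <= t <= M -> 0 <= f t) -> psdmx (hfun f A).
Proof.
move=> A0 M0 AM fe; have [W [d [w1 w2 AE ->]]] := hfun_spec (psdmx_hermitian A0).
apply: psdmx_conj; apply: rdiag_psd => i /=.
apply: fe; rewrite AE in A0 AM; rewrite (psd_eigen_ge0 i w2 A0)/=.
by apply: le_trans (bnd_eigen_le i w1 w2 M0 AM); rewrite ler_norm.
Qed.

Lemma hfunB n f g (A : 'M[C]_n) : A^H = A ->
  hfun f A - hfun g A = hfun (fun t => f t - g t) A.
Proof.
move=> hA; have [W [d [w1 w2 AE E]]] := hfun_spec hA; rewrite !E.
by rewrite -mulmxBl -mulmxBr rdiagB.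
Qed.

Lemma mpow_spectral n (W : 'M[C]_n) (d : 'I_n -> R) k :
  W^H *m W = 1%:M -> W *m W^H = 1%:M ->
  mpow (W^H *m rdiag d *m W) k = W^H *m rdiag (fun i => d i ^+ k) *m W.
Proof.
move=> w1 w2; elim: k => [|k IH].
  have -> : rdiag (fun i => d i ^+ 0) = 1%:M :> 'M[C]_n.
    by rewrite -rdiag1; congr rdiag.
  by rewrite mulmx1 w1.
rewrite /mpow iterS -/(mpow _ k) IH -!mulmxA (mulmxA W) w2 mul1mx (mulmxA (rdiag d)) rdiagM.
by congr (_ *m (rdiag _ *m _)); apply/funext => i; rewrite exprS.
Qed.

Lemma hfun_poly n (q : {poly R}) (A : 'M[C]_n) : A^H = A ->
  hfun (horner q) A = \sum_(k < size q) (q`_k)%:C *: mpow A k.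
Proof.
move=> hA; have [W [d [w1 w2 AE ->]]] := hfun_spec hA.
have -> : rdiag (horner q \o d) =
    \sum_(k < size q) (q`_k)%:C *: rdiag (fun i => d i ^+ k) :> 'M[C]_n.
  apply/matrixP => i j; rewrite summxE !mxE /= horner_coef.
  have [->|/negbTE ij] := eqVneq i j; last first.
    by rewrite mulr0n big1// => k _; rewrite !mxE ij mulr0n mulr0.
  rewrite mulr1n rmorph_sum/=; apply: eq_bigr => k _.
  by rewrite !mxE eqxx mulr1n -rmorphM.
rewrite mulmx_sumr mulmx_suml; apply: eq_bigr => k _.
by rewrite -scalemxAr -scalemxAl AE mpow_spectral.
Qed.

(** Padding by zeros, so that a fixed entry (i, j) can be followed along matrices of growing
    size. *)
Definition iext m n (A : 'M[C]_(m, n)) : imatrix R := fun i j =>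
  if insub i is Some i' then if insub j is Some j' then A i' j' else 0 else 0.

Lemma iextE m n (A : 'M[C]_(m, n)) (i : 'I_m) (j : 'I_n) : iext A i j = A i j.
Proof. by rewrite /iext !valK. Qed.

Lemma iext_out_l m n (A : 'M[C]_(m, n)) i j : (m <= i)%N -> iext A i j = 0.
Proof. by move=> mi; rewrite /iext insubF// ltnNge mi. Qed.

Lemma iext_out_r m n (A : 'M[C]_(m, n)) i j : (n <= j)%N -> iext A i j = 0.
Proof. by move=> nj; rewrite /iext; case: insub => // i'; rewrite insubF// ltnNge nj. Qed.

Lemma iext_sum m n (I : Type) (r : seq I) (F : I -> 'M[C]_(m, n)) (c : I -> C) i j :
  iext (\sum_(k <- r) c k *: F k) i j = \sum_(k <- r) c k * iext (F k) i j.
Proof.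
rewrite /iext; case: insub => [i'|]; last by rewrite big1// => k _; rewrite mulr0.
case: insub => [j'|]; last by rewrite big1// => k _; rewrite mulr0.
by rewrite summxE; apply: eq_bigr => k _; rewrite mxE.
Qed.

Lemma iextB m n (A B : 'M[C]_(m, n)) i j : iext (A - B) i j = iext A i j - iext B i j.
Proof.
rewrite /iext; case: insub => [i'|]; last by rewrite subr0.
by case: insub => [j'|]; rewrite ?subr0// !mxE.
Qed.

Lemma iextM m n k (A : 'M[C]_(m, n)) (B : 'M[C]_(n, k)) i j :
  iext (A *m B) i j = \sum_(l < n) iext A i l * iext B l j.
Proof.
have [mi|im] := leqP m i.
  by rewrite iext_out_l// big1// => l _; rewrite iext_out_l// mul0r.
have [kj|jk] := leqP k j.
  by rewrite iext_out_r// big1// => l _; rewrite (iext_out_r B)// mulr0.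
have -> : iext (A *m B) i j = (A *m B) (Ordinal im) (Ordinal jk) :=
  iextE (A *m B) (Ordinal im) (Ordinal jk).
rewrite mxE; apply: eq_bigr => l _.
by rewrite -(iextE A (Ordinal im) l) -(iextE B l (Ordinal jk)).
Qed.

Lemma bndmx_entry m n e (A : 'M[C]_(m, n)) i j : 0 <= e -> bndmx e A -> nc (A i j) <= e.
Proof.
move=> e0 /(bndmx_col_le j) h.
rewrite -(@ler_pXn2r _ 2) ?nnegrE ?nc_ge0//; apply: le_trans h.
by rewrite (bigD1 i)//= lerDl sumr_ge0// => k _; exact: sqr_ge0.
Qed.

Lemma iext_entry m n e (A : 'M[C]_(m, n)) i j : 0 <= e -> bndmx e A -> nc (iext A i j) <= e.
Proof.
move=> e0 h; rewrite /iext; case: insub => [i'|]; last by rewrite nc0.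
by case: insub => [j'|]; rewrite ?nc0//; exact: bndmx_entry.
Qed.

Lemma bndmx1 n : bndmx 1 (1%:M : 'M[C]_n).
Proof.
rewrite /bndmx expr1n adjmx1 mulmx1 rmorph1 scale1r subrr; exact: psdmx0.
Qed.

Lemma bndmx_mpow n (A : 'M[C]_n) M k : bndmx M A -> bndmx (M ^+ k) (mpow A k).
Proof.
move=> h; elim: k => [|k IH]; first exact: bndmx1.
by rewrite exprS /mpow iterS; exact: bndmx_mul.
Qed.

Lemma bndmx_ssq_col m n e (A : 'M[C]_(m, n)) j N : bndmx e A ->
  ssq N (fun l => iext A l j) <= e ^+ 2.
Proof.
move=> h; have [nj|jn] := leqP n j.
  rewrite /ssq big1 ?sqr_ge0// => l _; by rewrite iext_out_r// nc0 expr0n.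
have h1 : ssq m (fun l => iext A l j) <= e ^+ 2.
  apply: le_trans (bndmx_col_le (Ordinal jn) h); apply: ler_sum => k _.
  by rewrite (iextE A k (Ordinal jn)).
apply: le_trans h1; apply: ssq_finite => l ml; exact: iext_out_l.
Qed.

Lemma ione_obnd : obnd 1 (@ione R).
Proof.
split=> // n; have -> : blk n n (@ione R) = 1%:M.
  by apply/matrixP => i j; rewrite !mxE /ione val_eqE.
exact: bndmx1.
Qed.

Lemma imul1l T M : obnd M T -> imul (@ione R) T = T.
Proof.
move=> hT; apply/funext => i; apply/funext => j.
apply: ctends_unique (@imul_ctends _ _ _ _ _ i j ione_obnd hT) _.
apply: (@ctends_near _ (fun=> T i j) _ _ i.+1) => [|n inn]; first exact: ctends_cst.
rewrite (bigD1 (Ordinal inn))//= /ione eqxx mul1r big1 ?addr0// => k.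
by rewrite -val_eqE/= eq_sym => /negbTE ->; rewrite mul0r.
Qed.

Lemma ipow_obnd T M k : obnd M T -> obnd (M ^+ k) (ipow T k).
Proof.
move=> hT; elim: k => [|k IH]; first exact: ione_obnd.
by rewrite exprS /ipow iterS; exact: obnd_imul hT IH.
Qed.

Lemma ipowD T M k l : obnd M T -> imul (ipow T k) (ipow T l) = ipow T (k + l).
Proof.
move=> hT; elim: k => [|k IH]; first exact: (imul1l (ipow_obnd l hT)).
rewrite addSn [in RHS]/ipow iterS -/(ipow T (k + l)) -IH.
exact: (imulA hT (ipow_obnd k hT) (ipow_obnd l hT)).
Qed.

(** Corners do not multiply like the operator. But row i of T is in l^2, and the columns of the k-th
    powers of the corners are bounded and, by induction, converge coordinatewise: [weak_cvg]
    applies. *)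
Lemma mpow_ctends T M k i j : obnd M T ->
  ctends (fun N => iext (mpow (blk N N T) k) i j) (ipow T k i j).
Proof.
move=> hT; elim: k i j => [|k IH] i j.
  apply: (@ctends_near _ (fun=> ipow T 0 i j) _ _ (maxn i j).+1) => [|n].
    exact: ctends_cst.
  rewrite gtn_max => /andP[inn jn].
  have -> : iext (mpow (blk n n T) 0) i j = 1%:M (Ordinal inn) (Ordinal jn) :=
    iextE (mpow (blk n n T) 0) (Ordinal inn) (Ordinal jn).
  by rewrite mxE.
have [|||h _ _ _] := @weak_cvg _ (T i) (fun N l => iext (mpow (blk N N T) k) l j)
  (fun l => ipow T k l j) (M ^+ 2) ((M ^+ k) ^+ 2) (fun N => obnd_row i N hT).
- by move=> N; apply: bndmx_ssq_col; apply: bndmx_mpow; case: hT.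
- by move=> N l Nl; rewrite iext_out_l.
- by move=> l; exact: IH.
apply: (@ctends_near _ _ _ _ i.+1 h) => n inn.
rewrite /mpow iterS -/(mpow _ k) iextM; apply: eq_bigr => l _; congr (_ * _).
have -> : iext (blk n n T) i l = blk n n T (Ordinal inn) l :=
  iextE (blk n n T) (Ordinal inn) l.
by rewrite mxE.
Qed.

Definition posop T := forall n, psdmx (blk n n T).

Lemma poly_ctends T M (q : {poly R}) i j : obnd M T -> posop T ->
  ctends (fun N => iext (hfun (horner q) (blk N N T)) i j) (ihorner q T i j).
Proof.
move=> hT pT.
have -> : (fun N => iext (hfun (horner q) (blk N N T)) i j) =
    (fun N => \sum_(k < size q) (q`_k)%:C * iext (mpow (blk N N T) k) i j).
  apply/funext => N; rewrite hfun_poly; last exact/psdmx_hermitian.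
  by rewrite iext_sum.
apply: ctends_sum => k; apply: ctendsM; first exact: ctends_cst.
exact: mpow_ctends hT.
Qed.

Lemma opnorm_obnd M T : obnd M T -> obnd (fine (opnorm T)) T /\
  opnorm T = (fine (opnorm T))%:E.
Proof.
move=> [M0 h].
have o0 : (0 <= opnorm T)%E by exact: opnorm_ge0.
have oM : (opnorm T <= M%:E)%E by apply/opnorm_leP.
have oE : opnorm T = (fine (opnorm T))%:E.
  by rewrite fineK// ge0_fin_numE// (le_lt_trans oM)// ltry.
have f0 : 0 <= fine (opnorm T) by exact: fine_ge0.
split; [split; [exact: f0|]|exact: oE].
by apply/(opnorm_leP _ f0); rewrite -oE.
Qed.

Definition fc_spec f T (S : imatrix R) := forall eps : R, 0 < eps ->
  exists q : {poly R},
    (forall t : R, 0 <= t -> (t%:E <= opnorm T)%E -> `|q.[t] - f t| <= eps) /\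
    (opnorm (fun i j => ihorner q T i j - S i j)%R <= eps%:E)%E.

(** The corners of T are positive and of norm at most that of T, so their eigenvalues lie where q is
    close to f. The error is uniform in N. *)
Lemma hfun_close T M f (q : {poly R}) e N : obnd M T -> posop T -> 0 <= e ->
  (forall t : R, 0 <= t -> (t%:E <= opnorm T)%E -> `|q.[t] - f t| <= e) ->
  bndmx e (hfun (horner q) (blk N N T) - hfun f (blk N N T)).
Proof.
move=> hT pT e0 qf; have [[m0 hm] oE] := opnorm_obnd hT.
rewrite hfunB; last exact/psdmx_hermitian.
apply: (hfun_bnd (pT N) m0 (hm N) e0) => t /andP[t0 tm].
by apply: qf => //; rewrite oE lee_fin.
Qed.

Lemma obnd_entry M (a : imatrix R) i j : obnd M a -> nc (a i j) <= M.
Proof.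
move=> [M0 h].
have im : (i < (maxn i j).+1)%N by rewrite ltnS leq_maxl.
have jm : (j < (maxn i j).+1)%N by rewrite ltnS leq_maxr.
by have := bndmx_entry (Ordinal im) (Ordinal jm) M0 (h (maxn i j).+1); rewrite mxE.
Qed.

(** q(T_N) tends to q(T) entrywise, while q(T_N) is close to f(T_N), uniformly in N, and q(T) to S.
    In particular S is determined by f and T. *)
Lemma fc_spec_ctends T M f S : obnd M T -> posop T -> fc_spec f T S ->
  forall i j, ctends (fun N => iext (hfun f (blk N N T)) i j) (S i j).
Proof.
move=> hT pT hS i j; apply/ctendsP => e e0.
have e4 : 0 < e / 4 by rewrite divr_gt0.
have [q [qf /(opnorm_leP _ (ltW e4)) qS]] := hS _ e4.
have /ctendsP/(_ _ e4)[N HN] := @poly_ctends _ _ q i j hT pT.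
exists N => n Nn; have h1 := HN n Nn.
have h2 := iext_entry i j (ltW e4) (@hfun_close _ _ _ _ _ n hT pT (ltW e4) qf).
rewrite iextB in h2.
have h3 : nc (ihorner q T i j - S i j) <= e / 4.
  exact: (@obnd_entry _ (fun i j => ihorner q T i j - S i j) i j (conj (ltW e4) qS)).
set a := iext (hfun f _) i j; set b := iext (hfun (horner q) _) i j in h1 h2.
set c := ihorner q T i j in h1 h3; set d := S i j in h3 *.
rewrite -/a in h2; clearbody a b c d.
have := ncD (a - b) (b - c); rewrite addrA subrK.
have := ncD (a - c) (c - d); rewrite addrA subrK.
by rewrite -(ncN (a - b)) opprB; lra.
Qed.

Lemma ctends_shift (u : nat -> C) l n : ctends u l -> ctends (fun K => u (K + n)%N) l.
Proof.
move=> /ctendsP h; apply/ctendsP => e e0; have [N HN] := h _ e0.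
by exists N => K NK; apply: HN; rewrite (leq_trans NK)// leq_addr.
Qed.

Lemma blk_iext_bnd n N e (A : 'M[C]_N) : 0 <= e -> (n <= N)%N -> bndmx e A ->
  bndmx e (blk n n (iext A)).
Proof.
move=> e0 nN hA.
have wI : injective (widen_ord nN) by move=> i j /(congr1 val) /= h; exact: val_inj.
have := bndmx_colsub e0 wI (bndmx_rowsub wI hA).
suff -> : colsub (widen_ord nN) (rowsub (widen_ord nN) A) = blk n n (iext A) by [].
by apply/matrixP => i j; rewrite !mxE -iextE.
Qed.

Lemma mctends_blk_iext (F : forall N, 'M[C]_N) (S : imatrix R) n :
  (forall i j, ctends (fun N => iext (F N) i j) (S i j)) ->
  mctends (fun K => blk n n (iext (F (K + n)%N))) (blk n n S).
Proof.
move=> h i j; rewrite mxE.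
have -> : (fun K => blk n n (iext (F (K + n)%N)) i j) = (fun K => iext (F (K + n)%N) i j).
  by apply/funext => K; rewrite mxE.
exact: (@ctends_shift (fun N => iext (F N) i j) _ n (h i j)).
Qed.

Lemma obnd_lim (F : forall N, 'M[C]_N) (S : imatrix R) e : 0 <= e ->
  (forall i j, ctends (fun N => iext (F N) i j) (S i j)) ->
  (forall N, bndmx e (F N)) -> obnd e S.
Proof.
move=> e0 h hF; split=> [|n]; first exact: e0.
apply: (bndmx_lim (@mctends_blk_iext F S n h)) => K.
exact: (blk_iext_bnd e0 (leq_addl _ _) (hF _)).
Qed.

(** S collects the entrywise limits of f(T_N). The bound on q(T_N) - f(T_N) holds for all N, hence
    survives in the entrywise limit q(T) - S as an operator norm bound. *)
Lemma fc_spec_exists T M f : obnd M T -> posop T ->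
  poly_approx f (fine (opnorm T)) -> exists S, fc_spec f T S.
Proof.
move=> hT pT fa; have [[m0 hm] oE] := opnorm_obnd hT.
have fa' e : 0 < e -> exists q : {poly R},
    forall t : R, 0 <= t -> (t%:E <= opnorm T)%E -> `|q.[t] - f t| <= e.
  move=> e0; have [q hq] := fa _ e0; exists q => t t0; rewrite oE lee_fin => tm.
  by apply: hq; rewrite t0.
have lim i j : exists l, ctends (fun N => iext (hfun f (blk N N T)) i j) l.
  apply: ccauchy => e e0; have e4 : 0 < e / 4 by rewrite divr_gt0.
  have [q qf] := fa' _ e4.
  have /ctendsP/(_ _ e4)[N HN] := @poly_ctends _ _ q i j hT pT.
  exists N, (ihorner q T i j) => n Nn; have h1 := HN n Nn.
  have := iext_entry i j (ltW e4) (@hfun_close _ _ _ _ _ n hT pT (ltW e4) qf).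
  rewrite iextB; set a := iext (hfun f _) i j; set b := iext (hfun _ _) i j in h1 *.
  set c := ihorner q T i j in h1 *; clearbody a b c.
  move=> h2; have := ncD (a - b) (b - c); rewrite addrA subrK.
  by rewrite -(ncN (a - b)) opprB; lra.
exists (fun i j => sval (cid (lim i j))) => e e0.
have [q qf] := fa' _ e0; exists q; split => //.
apply/(opnorm_leP _ (ltW e0)).
apply: (proj2 (@obnd_lim (fun N => hfun (horner q) (blk N N T) - hfun f (blk N N T)) _ _
  (ltW e0) _ (fun N => @hfun_close _ _ _ _ _ N hT pT (ltW e0) qf))) => i j.
have -> : (fun N => iext (hfun (horner q) (blk N N T) - hfun f (blk N N T)) i j) =
    (fun N => iext (hfun (horner q) (blk N N T)) i j + - iext (hfun f (blk N N T)) i j).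
  by apply/funext => N; rewrite iextB.
apply: ctendsD (@poly_ctends _ _ q i j hT pT) _; apply: ctendsN.
by case: cid.
Qed.

Lemma fun_calc_spec T M f : obnd M T -> posop T ->
  poly_approx f (fine (opnorm T)) -> fc_spec f T (fun_calc f T).
Proof.
move=> hT pT fa; have [S hS] := fc_spec_exists hT pT fa.
exact: (@xgetPex _ (0 : imatrix R) [set S | fc_spec f T S] (ex_intro _ S hS)).
Qed.

Lemma fun_calc_ctends T M f : obnd M T -> posop T ->
  poly_approx f (fine (opnorm T)) ->
  forall i j, ctends (fun N => iext (hfun f (blk N N T)) i j) (fun_calc f T i j).
Proof. by move=> hT pT fa; exact: (fc_spec_ctends hT pT (fun_calc_spec hT pT fa)). Qed.

(** The matrices have size K + n so that a corner of size n fits into each of them. *)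
Lemma fun_calc_blk T M f n : obnd M T -> posop T ->
  poly_approx f (fine (opnorm T)) ->
  mctends (fun K => blk n n (iext (hfun f (blk (K + n) (K + n) T)))) (blk n n (fun_calc f T)).
Proof.
move=> hT pT fa; exact: (@mctends_blk_iext (fun N => hfun f (blk N N T)) _ n
  (@fun_calc_ctends _ _ _ hT pT fa)).
Qed.

Lemma fun_calc_obnd T M f e : obnd M T -> posop T -> poly_approx f (fine (opnorm T)) ->
  0 <= e -> (forall t, 0 <= t <= fine (opnorm T) -> `|f t| <= e) -> obnd e (fun_calc f T).
Proof.
move=> hT pT fa e0 fe; have [[m0 hm] oE] := opnorm_obnd hT.
apply: (@obnd_lim (fun N => hfun f (blk N N T)) _ _ e0 (@fun_calc_ctends _ _ _ hT pT fa)) => N.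
exact: (hfun_bnd (pT _) m0 (hm _) e0 fe).
Qed.

(** The inclusion of the first n coordinates, an isometry for n <= N; conjugating with it makes
    corners compressions ([inclmx_conj]). *)
Definition inclmx n N : 'M[C]_(N, n) := \matrix_(i, j) (val i == val j)%:R.

Lemma inclmx_isometry n N : (n <= N)%N -> (inclmx n N)^H *m inclmx n N = 1%:M.
Proof.
move=> nN; apply/matrixP => i j; rewrite mxE (bigD1 (widen_ord nN j))//= big1 ?addr0.
  rewrite adjmxE !mxE/= eqxx mulr1 eq_sym.
  by case: (i == j) (val_eqE i j) => ->; rewrite ?rmorph1 ?rmorph0.
move=> k kj; rewrite [inclmx n N k j]mxE.
by move: kj; rewrite -val_eqE/= => /negbTE ->; rewrite mulr0.
Qed.

Lemma inclmx_contr n N : (n <= N)%N -> contrmx (inclmx n N).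
Proof. by move=> nN; apply: contrmx_isometry; exact: inclmx_isometry. Qed.

Lemma inclmx_conj m n N (A : 'M[C]_N) : (m <= N)%N -> (n <= N)%N ->
  (inclmx m N)^H *m A *m inclmx n N = blk m n (iext A).
Proof.
move=> mN nN; apply/matrixP => i j; rewrite [RHS]mxE.
have -> : iext A i j = A (widen_ord mN i) (widen_ord nN j) :=
  iextE A (widen_ord mN i) (widen_ord nN j).
rewrite mxE (bigD1 (widen_ord nN j))//= big1 ?addr0; last first.
  move=> k; rewrite [inclmx n N _ _]mxE -val_eqE/= => /negbTE ->.
  by rewrite mulr0.
rewrite [inclmx n N _ _]mxE eqxx mulr1 mxE (bigD1 (widen_ord mN i))//= big1 ?addr0; last first.
  move=> k; rewrite adjmxE [inclmx m N _ _]mxE -val_eqE/= => /negbTE ->.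
  by rewrite rmorph0 mul0r.
by rewrite adjmxE [inclmx m N _ _]mxE eqxx rmorph1 mul1r.
Qed.

Lemma psdmx_blk_iext n N (A : 'M[C]_N) : (n <= N)%N -> psdmx A -> psdmx (blk n n (iext A)).
Proof. by move=> nN; rewrite -inclmx_conj//; exact: psdmx_conj. Qed.

Lemma fun_calc_pos T M f : obnd M T -> posop T -> poly_approx f (fine (opnorm T)) ->
  (forall t, 0 <= t <= fine (opnorm T) -> 0 <= f t) -> posop (fun_calc f T).
Proof.
move=> hT pT fa fe n; have [[m0 hm] oE] := opnorm_obnd hT.
apply: psdmx_lim (@fun_calc_blk _ _ _ n hT pT fa) _ => K.
apply: psdmx_blk_iext; first exact: leq_addl.
exact: (hfun_psd (pT _) m0 (hm _) fe).
Qed.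

End FunctionalCalculus.

(** * Schatten norms of corners *)

Section Corners.
Context {R : realType}.
Local Notation C := R[i].
Implicit Types (a : imatrix R).

(* Stacking c 1 below A_K gives a matrix E with E^* E >= B^* B for K large. *)
Lemma spow_approx k n (m : nat -> nat) (A : forall K, 'M[C]_(m K, n)) (B : 'M[C]_(k, n))
    (X : 'M[C]_n) p L : 1 <= p ->
  mctends (fun K => (A K)^H *m A K) X -> psdmx (X - B^H *m B) ->
  (forall K, spow p (A K) <= L) -> spow p B <= L.
Proof.
move=> p1 AX XB AL; have p0 : 0 < p by lra.
have L0 : 0 <= L by apply: le_trans (AL 0%N); exact: spow_ge0.
suff : snorm p B <= L `^ p^-1.
  move=> h; rewrite -(powRKV p0 L0); apply: spow_le_snorm => //; exact: powR_ge0.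
apply/ler_addgt0Pr => e e0.
pose s1 := snorm p (1%:M : 'M[C]_n).
have s10 : 0 <= s1 by exact: snorm_ge0.
(* c times the norm s1 of the identity is at most e. *)
pose c := e / (s1 + 1).
have c0 : 0 < c by rewrite divr_gt0//; lra.
have c20 : 0 < c ^+ 2 by rewrite exprn_gt0.
have c40 : 0 < (c ^+ 2) ^+ 2 by rewrite exprn_gt0.
pose D K := (A K)^H *m A K - X.
(* The squared Hilbert-Schmidt norm of D K tends to 0. Once it is below c^4, the eigenvalues of D K
   are at least -c^2. *)
have Dlim : ctends (fun K => \sum_i \sum_j (D K i j)^* * D K i j)%R
    (\sum_(i < n) \sum_(j < n) 0^* * 0)%R.
  apply: ctends_sum => i; apply: ctends_sum => j.
  have h : ctends (fun K => D K i j) 0.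
    have -> : (fun K => D K i j) = (fun K => ((A K)^H *m A K) i j + - X i j).
      by apply/funext => K; rewrite addmxE oppmxE.
    rewrite -(subrr (X i j)); exact: (ctendsD (AX i j) (@ctends_cst _ (- X i j))).
  exact: (ctendsM (ctends_conj h) h).
have [K0 HK] := (ctendsP _ _).1 Dlim _ c40.
have := HK K0 (leqnn _); rewrite [X in nc (_ - X)]big1; last first.
  by move=> i _; rewrite big1// => j _; rewrite mulr0.
rewrite subr0 => Dsmall {HK Dlim}.
have Dsq : \sum_i \sum_j nc (D K0 i j) ^+ 2 < (c ^+ 2) ^+ 2.
  apply: le_lt_trans Dsmall.
  have -> : (\sum_i \sum_j (D K0 i j)^* * D K0 i j)%R = (\sum_i \sum_j nc (D K0 i j) ^+ 2)%:C.
    rewrite rmorph_sum/=; apply: eq_bigr => i _; rewrite rmorph_sum/=.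
    by apply: eq_bigr => j _; rewrite nc_conjM.
  by rewrite ncR ler_norm.
have hX : X^H = X.
  apply: psdmx_hermitian; have := psdmxD XB (psdmx_gram B); rewrite subrK; exact.
have hD : (D K0)^H = D K0 by rewrite /D adjmxB hX (adjmxM _ (A K0)) adjmxK.
have Dpsd : psdmx ((c ^+ 2)%:C *: 1%:M + D K0).
  have [W [d [w1 w2 DE]]] := spectral_hermitian hD.
  have h1 := spow_eigen_ge (ler1n R 2) w2 w1 DE.
  rewrite spow2 in h1.
  have di i : - c ^+ 2 <= d i.
    have h2 : `|d i| `^ 2 <= (c ^+ 2) ^+ 2.
      apply: le_trans (ltW Dsq); apply: le_trans h1.
      by rewrite (bigD1 i)//= lerDl sumr_ge0// => j _; exact: powR_ge0.
    rewrite powR_mulrn// ler_pXn2r ?nnegrE ?(ltW c20)// in h2.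
    by move: h2; rewrite ler_norml => /andP[].
  have -> : (c ^+ 2)%:C *: 1%:M + D K0 = W^H *m rdiag (fun i => d i - (- c ^+ 2)) *m W.
    rewrite -rdiagB mulmxBr mulmxBl -DE addrC; congr (_ + _).
    have -> : rdiag (fun=> - c ^+ 2) = - ((c ^+ 2)%:C *: 1%:M) :> 'M[C]_n.
      rewrite -rdiag1; apply/matrixP => i j; rewrite oppmxE scalemxE !mxE mulrnAr mulr1.
      by rewrite rmorphN mulNrn.
    by rewrite mulmxN mulNmx opprK -scalemxAr -scalemxAl mulmx1 w1.
  by apply: psdmx_conj; apply: rdiag_psd => i; rewrite subr_ge0.
clear Dsq Dsmall; pose E := col_mx (A K0) (c%:C *: (1%:M : 'M[C]_n)).
have gram_col k' (U : 'M[C]_(m K0, n)) (V : 'M[C]_(k', n)) :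
    (col_mx U V)^H *m col_mx U V = U^H *m U + V^H *m V.
  have -> : (col_mx U V)^H = row_mx (U^H) (V^H).
    by rewrite /adjmx tr_col_mx map_row_mx.
  by rewrite mul_row_col.
have EE : E^H *m E = (A K0)^H *m A K0 + (c ^+ 2)%:C *: 1%:M.
  rewrite /E gram_col; congr (_ + _).
  by rewrite adjmxZ real_complex_conj adjmx1 -scalemxAl mul1mx scalerA -rmorphM -expr2.
have BE : snorm p B <= snorm p E.
  apply: (snorm_le p0); apply: (spow_mono p1).
  have -> : E^H *m E - B^H *m B = (X - B^H *m B) + ((c ^+ 2)%:C *: 1%:M + D K0).
    rewrite EE /D; move: (_ *m A K0) (B^H *m B) (_ *: _) => U V Y.
    by apply/matrixP => i j; rewrite !(addmxE, oppmxE); ring.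
  exact: (psdmxD XB Dpsd).
apply: le_trans BE _.
have -> : E = col_mx (A K0) 0 + col_mx 0 (c%:C *: 1%:M).
  by rewrite add_col_mx addr0 add0r.
apply: le_trans (snorm_triangle _ _ p1) _.
have n1 : snorm p (col_mx (A K0) (0 : 'M[C]_n)) <= L `^ p^-1.
  apply: powR_mono (spow_ge0 _ _) _; first by rewrite invr_ge0 ltW.
  apply: le_trans (AL K0); apply: (spow_mono p1).
  rewrite gram_col mulmx0 addr0 subrr; exact: psdmx0.
have n2 : snorm p (col_mx (0 : 'M[C]_(m K0, n)) (c%:C *: 1%:M : 'M[C]_n)) <= e.
  apply: (@le_trans _ _ (snorm p (c%:C *: (1%:M : 'M[C]_n)))).
    apply: (snorm_le p0); apply: (spow_mono p1).
    rewrite gram_col mulmx0 add0r subrr; exact: psdmx0.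
  apply: le_trans (snormZ _ _ p1) _.
  rewrite ncR (gtr0_norm c0) -/s1 /c mulrAC ler_pdivrMr; last by lra.
  by rewrite ler_wpM2l ?(ltW e0)//; lra.
exact: (lerD n1 n2).
Qed.

Lemma blk_iext_blk m n N a : (m <= N)%N -> (n <= N)%N ->
  blk m n (iext (blk N N a)) = blk m n a.
Proof.
move=> mN nN; apply/matrixP => i j; rewrite mxE.
have -> : iext (blk N N a) i j = blk N N a (widen_ord mN i) (widen_ord nN j) :=
  iextE (blk N N a) (widen_ord mN i) (widen_ord nN j).
by rewrite !mxE.
Qed.

Lemma spow_blk_iext p m n N (A : 'M[C]_N) : 1 <= p -> (m <= N)%N -> (n <= N)%N ->
  spow p (blk m n (iext A)) <= spow p A.
Proof.
move=> p1 mN nN; rewrite -inclmx_conj//.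
exact: (spow_contr A p1 (contrmx_adj (inclmx_contr mN)) (inclmx_contr nN)).
Qed.

Lemma spow_blk p m n N a : 1 <= p -> (m <= N)%N -> (n <= N)%N ->
  spow p (blk m n a) <= spow p (blk N N a).
Proof.
by move=> p1 mN nN; rewrite -(blk_iext_blk a mN nN); exact: spow_blk_iext.
Qed.

Lemma opnorm_fin_obnd a : (opnorm a < +oo)%E -> exists M, obnd M a.
Proof.
move=> h; have oE : opnorm a = (fine (opnorm a))%:E.
  by rewrite fineK// ge0_fin_numE// opnorm_ge0.
have f0 : 0 <= fine (opnorm a) by apply: fine_ge0; exact: opnorm_ge0.
exists (fine (opnorm a)); split; first exact: f0.
by apply/(opnorm_leP _ f0); rewrite -oE.
Qed.

Definition gramop a := imul (iadj a) a.

Lemma gramop_ctends M a n : obnd M a ->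
  mctends (fun K => (blk K n a)^H *m blk K n a) (blk n n (gramop a)).
Proof.
move=> ha; have := @blk_imul _ _ _ _ _ n n (obnd_iadj ha) ha.
have -> : (fun K => blk n K (iadj a) *m blk K n a) = (fun K => (blk K n a)^H *m blk K n a).
  by apply/funext => K; rewrite blk_iadj.
exact.
Qed.

Lemma gramop_obnd M a : obnd M a -> obnd (M * M) (gramop a).
Proof. by move=> ha; exact: (obnd_imul (obnd_iadj ha) ha). Qed.

Lemma gramop_pos M a : obnd M a -> posop (gramop a).
Proof.
move=> ha n; apply: psdmx_lim (@gramop_ctends _ _ n ha) _ => K.
exact: psdmx_gram.
Qed.

(** The difference is the limit of the Gram matrices of the part of the first n columns that lies
    below row n. *)
Lemma gramop_ge M a n : obnd M a -> psdmx (blk n n (gramop a) - (blk n n a)^H *m blk n n a).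
Proof.
move=> ha.
pose rest K : 'M[C]_(K, n) := \matrix_(i, j) a (n + i)%N j.
have lim : mctends (fun K => (rest K)^H *m rest K + (blk n n a)^H *m blk n n a)
    (blk n n (gramop a)).
  move=> i j.
  have -> : (fun K => ((rest K)^H *m rest K + (blk n n a)^H *m blk n n a) i j) =
      (fun K => ((blk (K + n) n a)^H *m blk (K + n) n a) i j).
    apply/funext => K; rewrite mxE [in RHS]mxE.
    transitivity (\sum_(k < K + n) (a k i)^* * a k j)%R; last first.
      by apply: eq_bigr => k _; rewrite adjmxE !mxE.
    rewrite addnC big_split_ord/= addrC; congr (_ + _).
      by rewrite mxE; apply: eq_bigr => k _; rewrite adjmxE !mxE.
    by rewrite mxE; apply: eq_bigr => k _; rewrite adjmxE !mxE.
  exact: (@ctends_shift _ (fun K => ((blk K n a)^H *m blk K n a) i j) _ n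
    (@gramop_ctends _ _ n ha i j)).
have lim2 := mctendsD lim (mctendsN (@mctends_cst _ _ _ ((blk n n a)^H *m blk n n a))).
apply: psdmx_lim lim2 _ => K; rewrite addrK; exact: psdmx_gram.
Qed.

Lemma imul_sum2 (m n : nat) (c : 'I_m -> C) (d : 'I_n -> C) (F : 'I_m -> imatrix R)
    (G : 'I_n -> imatrix R) (M : 'I_m -> R) (N : 'I_n -> R) i j :
  (forall k, obnd (M k) (F k)) -> (forall l, obnd (N l) (G l)) ->
  imul (fun i j => \sum_k c k * F k i j) (fun i j => \sum_l d l * G l i j) i j =
  \sum_k \sum_l c k * d l * imul (F k) (G l) i j.
Proof.
move=> hF hG; apply: (proj2 (csum_ctends _)).
have -> : (fun K => \sum_(t < K) (\sum_k c k * F k i t) * (\sum_l d l * G l t j)) =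
    (fun K => \sum_k \sum_l c k * d l * \sum_(t < K) F k i t * G l t j).
  apply/funext => K.
  under eq_bigr do rewrite big_distrlr/=.
  rewrite exchange_big/=; apply: eq_bigr => k _.
  rewrite exchange_big/=; apply: eq_bigr => l _.
  by rewrite mulr_sumr; apply: eq_bigr => t _; rewrite mulrACA.
apply: ctends_sum => k; apply: ctends_sum => l; apply: ctendsM; first exact: ctends_cst.
exact: (@imul_ctends _ _ _ _ _ i j (hF k) (hG l)).
Qed.

Lemma hfun_horner_sq n (q : {poly R}) (A : 'M[C]_n) : A^H = A ->
  hfun (fun t => q.[t] * q.[t]) A =
  \sum_(k < size q) \sum_(l < size q) ((q`_k)%:C * (q`_l)%:C) *: mpow A (k + l).
Proof.
move=> hA; have [W [d [w1 w2 AE E]]] := hfun_spec hA; rewrite E.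
have mp k : mpow A k = W^H *m rdiag (fun i => d i ^+ k) *m W by rewrite AE mpow_spectral.
transitivity (W^H *m (\sum_(k < size q) \sum_(l < size q) ((q`_k)%:C * (q`_l)%:C) *:
    rdiag (fun i => d i ^+ (k + l))) *m W).
  congr (_ *m _ *m _); apply/matrixP => i j; rewrite summxE !mxE /=.
  have [->|/negbTE ij] := eqVneq i j; last first.
    rewrite mulr0n big1// => k _; rewrite summxE big1// => l _.
    by rewrite !mxE ij mulr0n mulr0.
  rewrite mulr1n rmorphM/= horner_coef rmorph_sum/= big_distrlr/=.
  apply: eq_bigr => k _; rewrite summxE; apply: eq_bigr => l _.
  by rewrite !mxE eqxx mulr1n exprD !rmorphM/= mulrACA.
rewrite mulmx_sumr mulmx_suml; apply: eq_bigr => k _.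
rewrite mulmx_sumr mulmx_suml; apply: eq_bigr => l _.
by rewrite -scalemxAr -scalemxAl mp.
Qed.

Lemma hfun_id n (A : 'M[C]_n) : A^H = A -> hfun id A = A.
Proof. by move=> hA; have [W [d [w1 w2 AE ->]]] := hfun_spec hA. Qed.

End Corners.

(** * From the norms of the corners to the norm defined by functional calculus *)

Section SchattenNorm.
Context {R : realType}.
Local Notation C := R[i].
Implicit Types (a h T : imatrix R).

(* Approximate h by q(T), for which the identity reduces to T^k T^l = T^(k + l). *)
Lemma sqrt_square T M : obnd M T -> posop T ->
  imul (fun_calc Num.sqrt T) (fun_calc Num.sqrt T) = T.
Proof.
move=> hT pT; set h := fun_calc Num.sqrt T.
have [[m0 hm] oE] := opnorm_obnd hT; set m := fine (opnorm T) in m0 hm oE.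
have fa : poly_approx Num.sqrt m by exact: poly_approx_sqrt.
pose s := Num.sqrt m; have s0 : 0 <= s by exact: sqrtr_ge0.
have sle t : 0 <= t <= m -> 0 <= Num.sqrt t <= s.
  by move=> /andP[t0 tm]; rewrite sqrtr_ge0 ler_wsqrtr.
have hh : obnd s h.
  apply: (fun_calc_obnd hT pT fa s0) => t /sle /andP[? ?].
  by rewrite ger0_norm.
apply/funext => i; apply/funext => j; apply/eqP; rewrite -subr_eq0; apply/eqP.
apply: Normc.eq0_normc; apply/eqP; rewrite eq_le nc_ge0 andbT.
apply/ler_addgt0Pr => e e0; rewrite add0r.
(* The errors below are d (2 s + 1) for Q Q - T, d s for D h and (s + 1) d for Q D, in total d (4 s
   + 2). *)
pose d := Num.min 1 (e / (4 * s + 2)).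
have d0 : 0 < d by rewrite lt_min ltr01 divr_gt0//; lra.
have d1 : d <= 1 by rewrite /d ge_min lexx.
have de : d * (4 * s + 2) <= e.
  rewrite -ler_pdivlMr; last by lra.
  by rewrite /d ge_min lexx orbT.
have [q [qf /(opnorm_leP _ (ltW d0)) qS]] := fun_calc_spec hT pT fa d0.
set Q := ihorner q T.
pose D : imatrix R := fun i j => Q i j - h i j.
have hD : obnd d D by split; [exact: ltW|exact: qS].
have qf' t : 0 <= t <= m -> `|q.[t] - Num.sqrt t| <= d.
  by move=> /andP[t0 tm]; apply: qf => //; rewrite oE lee_fin.
have hQ : obnd (s + 1) Q.
  have s1 : 0 <= s + 1 by lra.
  apply: (@obnd_lim _ (fun N => hfun (horner q) (blk N N T)) _ _ s1) => [i' j'|N].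
    exact: (@poly_ctends _ _ _ q i' j' hT pT).
  apply: (hfun_bnd (pT _) m0 (hm _) s1) => t ht.
  have := qf' t ht; have /andP[r0 rs] := sle t ht.
  by rewrite !ler_norml => /andP[? ?]; apply/andP; split; lra.
have e1 : imul h h i j = imul Q Q i j - imul D h i j - imul Q D i j.
  apply: ctends_unique (@imul_ctends _ _ _ _ _ i j hh hh) _.
  have c1 := @imul_ctends _ _ _ _ _ i j hQ hQ.
  have c2 := @imul_ctends _ _ _ _ _ i j hD hh.
  have c3 := @imul_ctends _ _ _ _ _ i j hQ hD.
  apply: (@ctends_near _ _ _ _ 0 (ctendsD (ctendsD c1 (ctendsN c2)) (ctendsN c3))).
  move=> n _; rewrite -!sumrB; apply: eq_bigr => k _.
  by rewrite /D; ring.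
have n2 := obnd_entry i j (obnd_imul hD hh).
have n3 := obnd_entry i j (obnd_imul hQ hD).
have QE : imul Q Q i j = \sum_(k < size q) \sum_(l < size q)
    (q`_k)%:C * (q`_l)%:C * ipow T (k + l) i j.
  rewrite /Q /ihorner (@imul_sum2 _ _ _ (fun k => (q`_k)%:C) (fun k => (q`_k)%:C)
    (fun k => ipow T k) (fun k => ipow T k) (fun k => M ^+ k) (fun k => M ^+ k) i j).
  - by apply: eq_bigr => k _; apply: eq_bigr => l _; rewrite (ipowD _ _ hT).
  - by move=> k; exact: ipow_obnd.
  - by move=> k; exact: ipow_obnd.
have n1 : nc (imul Q Q i j - T i j) <= d * (2 * s + 1).
  have dd0 : 0 <= d * (2 * s + 1) by rewrite mulr_ge0 ?(ltW d0)//; lra.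
  have lim : ctends (fun N => iext (hfun (fun t => q.[t] * q.[t]) (blk N N T)) i j)
      (imul Q Q i j).
    rewrite QE.
    have -> : (fun N => iext (hfun (fun t => q.[t] * q.[t]) (blk N N T)) i j) =
        (fun N => \sum_(k < size q) \sum_(l < size q)
          (q`_k)%:C * (q`_l)%:C * iext (mpow (blk N N T) (k + l)) i j).
      apply/funext => N; rewrite hfun_horner_sq; last exact/psdmx_hermitian.
      under eq_bigr do rewrite -[\sum_(l < _) _]scale1r.
      rewrite iext_sum; apply: eq_bigr => k _; rewrite mul1r iext_sum.
      by [].
    apply: ctends_sum => k; apply: ctends_sum => l; apply: ctendsM; first exact: ctends_cst.
    exact: (@mpow_ctends _ _ _ (k + l)%N i j hT).
  have lim2 : ctends (fun N => iext (blk N N T) i j) (T i j).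
    apply: (@ctends_near _ (fun=> T i j) _ _ (maxn i j).+1) => [|n].
      exact: ctends_cst.
    rewrite gtn_max => /andP[inn jn].
    have -> : iext (blk n n T) i j = blk n n T (Ordinal inn) (Ordinal jn) :=
      iextE (blk n n T) (Ordinal inn) (Ordinal jn).
    by rewrite mxE.
  apply: (ctends_nc_le (ctendsD lim (ctendsN lim2))) => N.
  have hN : (blk N N T)^H = blk N N T by exact/psdmx_hermitian.
  rewrite -{2}(hfun_id hN) -iextB (hfunB _ _ hN).
  apply: (iext_entry i j dd0); apply: (hfun_bnd (pT N) m0 (hm N) dd0) => t ht.
  have /andP[r0 rs] := sle t ht; have qd := qf' t ht.
  have t0 : 0 <= t by case/andP: ht.
  rewrite -{3}(sqr_sqrtr t0) -expr2 subr_sqr normrM.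
  apply: ler_pM => //; move: qd; rewrite !ler_norml => /andP[? ?]; apply/andP; split; lra.
have := ncD (imul Q Q i j - T i j) (- imul D h i j - imul Q D i j).
have := ncD (- imul D h i j) (- imul Q D i j); rewrite !ncN => n4 n5.
have -> : imul h h i j - T i j = imul Q Q i j - T i j + (- imul D h i j - imul Q D i j).
  by rewrite e1; ring.
have dE : d * (2 * s + 1) + (d * s + (s + 1) * d) = d * (4 * s + 2) by ring.
apply: (le_trans n5); apply: (le_trans _ de); rewrite -dE.
apply: (lerD n1); apply: (le_trans n4); exact: (lerD n2 n3).
Qed.

Lemma ReC (x : R) : complex.Re (x%:C) = x. Proof. by []. Qed.

Lemma Re_sum (I : Type) (r : seq I) (F : I -> C) :
  complex.Re (\sum_(i <- r) F i) = \sum_(i <- r) complex.Re (F i).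
Proof.
elim: r => [|i r IH]; first by rewrite !big_nil.
by rewrite !big_cons -IH; case: (F i) (\sum_(j <- r) F j) => [a b] [c d].
Qed.

Lemma rdiag_conjE m n (B : 'M[C]_(m, n)) (d : 'I_m -> R) i :
  (B^H *m rdiag d *m B) i i = (\sum_k d k * nc (B k i) ^+ 2)%:C.
Proof.
rewrite -mulmxA mxE rmorph_sum/=; apply: eq_bigr => k _.
by rewrite adjmxE mul_diag_mx !mxE rmorphM/= nc_conjM mulrCA.
Qed.

Lemma conj_spectral m n (W : 'M[C]_m) (Z : 'M[C]_(m, n)) (e : 'I_m -> R) :
  Z^H *m (W^H *m rdiag e *m W) *m Z = (W *m Z)^H *m rdiag e *m (W *m Z).
Proof. by rewrite adjmxM !mulmxA. Qed.

(** (Z^H A Z)_ii is the sum of the eigenvalues of A with weights |(W Z)_ki|^2, whose total mass is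
    at most 1 as W Z is a contraction. *)
Lemma jensen_conj m n (A : 'M[C]_m) (Z : 'M[C]_(m, n)) p i : 1 <= p -> psdmx A ->
  contrmx Z ->
  complex.Re ((Z^H *m A *m Z) i i) `^ p <=
  complex.Re ((Z^H *m hfun (@powR R ^~ p) A *m Z) i i).
Proof.
move=> p1 A0 cZ; have [W [d [w1 w2 AE ->]]] := hfun_spec (psdmx_hermitian A0).
have d0 k : 0 <= d k by rewrite AE in A0; exact: (psd_eigen_ge0 k w2 A0).
pose e : 'I_m -> R := (@powR R ^~ p) \o d; have eE k : e k = d k `^ p by [].
rewrite -/e AE; clearbody e.
have E f : exists2 S, (Z^H *m (W^H *m rdiag f *m W) *m Z) i i = S%:C &
    S = \sum_k f k * nc ((W *m Z) k i) ^+ 2.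
  by exists (\sum_k f k * nc ((W *m Z) k i) ^+ 2) => //; rewrite conj_spectral rdiag_conjE.
have [S1 E1 S1E] := E d; have [S2 E2 S2E] := E e.
refine (eq_ind_r (fun x : C => complex.Re x `^ p <= _) _ E1).
refine (eq_ind_r (fun x : C => _ <= complex.Re x) _ E2).
rewrite !ReC {}S1E {}S2E {E1 E2}.
have s1 := contrmx_col_le i (contrmxM (contrmx_isometry w1) cZ).
move: (W *m Z) s1 => B s1 {W w1 w2 AE A0 cZ E}.
under eq_bigr do rewrite mulrC; under [leRHS]eq_bigr do rewrite mulrC eE.
apply: (powR_jensen p1) => //.
by move=> k; exact: sqr_ge0.
Qed.

(** Peierls' inequality for t^p: [jensen_conj] in an eigenbasis of Z^H A Z, the trace being
    independent of the basis. *)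
Lemma peierls m n (A : 'M[C]_m) (Z : 'M[C]_(m, n)) p : 1 <= p -> psdmx A ->
  contrmx Z ->
  spow p (Z^H *m A *m Z) <=
  \sum_i complex.Re ((Z^H *m hfun (@powR R ^~ p) A *m Z) i i).
Proof.
move=> p1 A0 cZ; have Y0 : psdmx (Z^H *m A *m Z) by exact: psdmx_conj.
have [W [y [w1 w2 YE y0]]] := spectral_psd Y0.
apply: le_trans (spow_hermitian_le p1 w2 w1 YE) _.
set G := Z^H *m hfun _ A *m Z.
have -> : \sum_i complex.Re (G i i) = complex.Re (\tr (W *m G *m W^H)).
  rewrite mxtrace_mulC mulmxA w1 mul1mx /mxtrace Re_sum.
  by [].
rewrite /mxtrace Re_sum.
apply: ler_sum => i _; rewrite ger0_norm//.
have -> : y i = complex.Re (((Z *m W^H)^H *m A *m (Z *m W^H)) i i).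
  rewrite (adjmxM Z (W^H)) adjmxK.
  have -> : W *m Z^H *m A *m (Z *m W^H) = W *m (Z^H *m A *m Z) *m W^H by rewrite !mulmxA.
  by rewrite YE spectral_diag_entry.
have -> : W *m G *m W^H = (Z *m W^H)^H *m hfun (@powR R ^~ p) A *m (Z *m W^H).
  by rewrite (adjmxM Z (W^H)) adjmxK /G !mulmxA.
by apply: (jensen_conj i p1 A0); apply: (contrmxM cZ (contrmx_adj (contrmx_isometry w1))).
Qed.

(** The same weights are now summed over i, where their mass is again at most 1. With [peierls] this
    encloses the trace of a compression of A^p between [spow p] of the compression and of A. *)
Lemma trace_hfun_le m n (A : 'M[C]_m) (Z : 'M[C]_(m, n)) p : 1 <= p -> psdmx A ->
  contrmx Z ->
  \sum_i complex.Re ((Z^H *m hfun (@powR R ^~ p) A *m Z) i i) <= spow p A.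
Proof.
move=> p1 A0 cZ; have [W [d [w1 w2 AE ->]]] := hfun_spec (psdmx_hermitian A0).
have d0 k : 0 <= d k by rewrite AE in A0; exact: (psd_eigen_ge0 k w2 A0).
apply: le_trans (spow_eigen_ge p1 w2 w1 AE).
under eq_bigr do rewrite conj_spectral rdiag_conjE ReC.
rewrite exchange_big/=; apply: ler_sum => k _.
rewrite -mulr_sumr ger0_norm//.
rewrite -[leRHS]mulr1 ler_wpM2l ?powR_ge0//.
exact: (contrmx_row_le k (contrmxM (contrmx_isometry w1) cZ)).
Qed.

Lemma itrace_leP T L : (forall i, 0 <= complex.Re (T i i)) ->
  ((itrace T <= L%:E)%E <-> forall n, \sum_(i < n) complex.Re (T i i) <= L).
Proof.
move=> T0; rewrite /itrace.
have T0' n (_ : (0 <= n)%N) (_ : true) : (0%:E <= (complex.Re (T n n))%:E)%E by rewrite lee_fin.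
split=> [h n|h].
  rewrite -lee_fin -sumEFin; apply: le_trans h.
  rewrite -(big_mkord xpredT (fun i => (complex.Re (T i i))%:E)).
  by apply: (nneseries_lim_ge n) => i _ _; rewrite lee_fin.
apply: lime_le; first exact: is_cvg_nneseries.
apply: nearW => n; rewrite big_mkord sumEFin lee_fin; exact: h.
Qed.

Lemma posop_entry h i : posop h -> 0 <= complex.Re (h i i).
Proof.
move=> /(_ i.+1)/(psdmx_entry (Ordinal (ltnSn i))); rewrite mxE/=.
by case: (h i i) => x y; rewrite lecE/= => /andP[].
Qed.

Lemma posop_iadj h : posop h -> iadj h = h.
Proof.
move=> ph; apply/funext => i; apply/funext => j.
have im : (i < (maxn i j).+1)%N by rewrite ltnS leq_maxl.
have jm : (j < (maxn i j).+1)%N by rewrite ltnS leq_maxr.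
have := psdmx_hermitian (ph (maxn i j).+1).
move=> /matrixP/(_ (Ordinal im) (Ordinal jm)); rewrite adjmxE !mxE; exact.
Qed.

Lemma psdmx_trace n (A : 'M[C]_n) : psdmx A -> \sum_i A i i = (\sum_i complex.Re (A i i))%:C.
Proof.
move=> A0; rewrite rmorph_sum/=; apply: eq_bigr => i _; rewrite complexRe_id//.
by rewrite -adjmxE (psdmx_hermitian A0).
Qed.

Lemma psdmx_hfun_powR n (A : 'M[C]_n) p : psdmx A -> psdmx (hfun (@powR R ^~ p) A).
Proof.
move=> A0; have [W [d [w1 w2 AE ->]]] := hfun_spec (psdmx_hermitian A0).
by apply: psdmx_conj; apply: rdiag_psd => i; exact: powR_ge0.
Qed.

(** [peierls] for the inclusion of n into K + n coordinates, then K to infinity; [trace_blk_le] does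
    the same with [trace_hfun_le]. *)
Lemma blk_trace_le M h p n : obnd M h -> posop h -> 1 <= p ->
  spow p (blk n n h) <= \sum_(i < n) complex.Re (fun_calc (@powR R ^~ p) h i i).
Proof.
move=> hh ph p1; set g := fun_calc _ h.
have lim := @fun_calc_blk _ _ _ _ n hh ph (poly_approx_powR (fine (opnorm h)) p1).
have lim2 : ctends (fun K =>
    \sum_i (blk n n (iext (hfun (@powR R ^~ p) (blk (K + n) (K + n) h)))) i i
    + - (spow p (blk n n h))%:C) (\sum_i (blk n n g) i i + - (spow p (blk n n h))%:C).
  apply: ctendsD (@ctends_cst _ _).
  by apply: ctends_sum => i; exact: lim.
have := ctends_ge0 lim2 _; set b := spow p _.
have -> : \sum_(i < n) complex.Re (g i i) = complex.Re (\sum_i (blk n n g) i i).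
  by rewrite Re_sum; apply: eq_bigr => i _; rewrite mxE.
move=> h1; have {}h1 : 0 <= \sum_i (blk n n g) i i + - b%:C.
  apply: h1 => K; rewrite /b => {b lim lim2}.
  set A := blk (K + n) (K + n) h; have A0 : psdmx A by exact: ph.
  have nK := leq_addl K n.
  rewrite -(blk_iext_blk h nK nK) -/A -!inclmx_conj//.
  have c := @inclmx_contr R _ _ nK; have pe := peierls p1 A0 c.
  set G := _ *m hfun _ A *m _ in pe *.
  have G0 : psdmx G by apply: psdmx_conj; exact: psdmx_hfun_powR.
  rewrite (psdmx_trace G0).
  by rewrite -rmorphB ler0c subr_ge0.
case: (\sum_i _) h1 => x y; rewrite lecE/= => /andP[_]; rewrite subr_ge0; exact.
Qed.

Lemma trace_blk_le M h p n L : obnd M h -> posop h -> 1 <= p ->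
  (forall N, spow p (blk N N h) <= L) ->
  \sum_(i < n) complex.Re (fun_calc (@powR R ^~ p) h i i) <= L.
Proof.
move=> hh ph p1 hL; set g := fun_calc _ h.
have lim := @fun_calc_blk _ _ _ _ n hh ph (poly_approx_powR (fine (opnorm h)) p1).
have lim2 : ctends (fun K => L%:C +
    - \sum_i (blk n n (iext (hfun (@powR R ^~ p) (blk (K + n) (K + n) h)))) i i)
    (L%:C + - \sum_i (blk n n g) i i).
  apply: ctendsD (@ctends_cst _ _) _; apply: ctendsN.
  by apply: ctends_sum => i; exact: lim.
have -> : \sum_(i < n) complex.Re (g i i) = complex.Re (\sum_i (blk n n g) i i).
  by rewrite Re_sum; apply: eq_bigr => i _; rewrite mxE.
have h1 : 0 <= L%:C + - \sum_i (blk n n g) i i.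
  apply: (ctends_ge0 lim2) => K.
  set A := blk (K + n) (K + n) h; have A0 : psdmx A by exact: ph.
  have nK := leq_addl K n; rewrite -!inclmx_conj//.
  have c := @inclmx_contr R _ _ nK; have pe := trace_hfun_le p1 A0 c.
  set G := _ *m hfun _ A *m _ in pe *.
  have G0 : psdmx G by apply: psdmx_conj; exact: psdmx_hfun_powR.
  rewrite (psdmx_trace G0).
  rewrite -rmorphB ler0c subr_ge0; apply: le_trans pe _; exact: hL.
case: (\sum_i _) h1 => x y; rewrite lecE/= => /andP[_]; rewrite subr_ge0; exact.
Qed.

(** Bounds that are uniform over the corners depend on the operator only through its Gram operator.
    Used between a and |a| in both directions, this replaces the polar decomposition. *)
Lemma spow_gramop_eq a b Ma Mb p L n : 1 <= p -> obnd Ma a -> obnd Mb b ->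
  gramop a = gramop b -> (forall N, spow p (blk N N a) <= L) -> spow p (blk n n b) <= L.
Proof.
move=> p1 ha hb ab aL.
apply: (spow_approx p1 (@gramop_ctends _ _ _ n ha)).
  rewrite ab; exact: gramop_ge hb.
move=> K; apply: le_trans (aL (maxn K n)).
exact: (spow_blk a p1 (leq_maxl K n) (leq_maxr K n)).
Qed.

Lemma iabs_spec M a : obnd M a ->
  [/\ exists M', obnd M' (iabs a), posop (iabs a) & gramop (iabs a) = gramop a].
Proof.
move=> ha; have hT := gramop_obnd ha; have pT := gramop_pos ha.
have fa := poly_approx_sqrt (fine (opnorm (gramop a))).
have [[m0 _] _] := opnorm_obnd hT.
have ph : posop (iabs a).
  by apply: (fun_calc_pos hT pT fa) => t _; exact: sqrtr_ge0.
split.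
- exists (Num.sqrt (fine (opnorm (gramop a)))).
  apply: (fun_calc_obnd hT pT fa (sqrtr_ge0 _)) => t /andP[t0 tm].
  by rewrite ger0_norm ?sqrtr_ge0// ler_wsqrtr.
- exact: ph.
- rewrite {1}/gramop posop_iadj//; exact: sqrt_square hT pT.
Qed.

(** No singular value exceeds the l^p norm of all of them. Hence bounded Schatten norms of the
    corners make a bounded operator, without which [schatten_norm] is infinite. *)
Lemma bndmx_snorm n (A : 'M[C]_n) p L : 1 <= p -> snorm p A <= L -> bndmx L A.
Proof.
move=> p1 h; have p0 : 0 < p by lra.
have L0 : 0 <= L := le_trans (snorm_ge0 _ _) h.
have [U [W [cU w1 w2 AE UA]]] := svd A.
rewrite /bndmx.
have -> : A^H *m A = (W^H *m rdiag (svals A) *m W)^H *m (W^H *m rdiag (svals A) *m W).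
  rewrite {1}AE !adjmxM adj_rdiag adjmxK -!mulmxA UA (mulmxA W) w2 mul1mx.
  by [].
rewrite (unitary_gram _ _ w1 w2); apply: psdmx_conj; apply: rdiag_psd => i.
have s0 := svals_ge0 A i; rewrite subr_ge0 lerXn2r ?nnegrE//.
rewrite -(powRVK p0 s0); apply: le_trans h; apply: powR_mono (powR_ge0 _ _) _.
  by rewrite invr_ge0 ltW.
by rewrite /spow (bigD1 i)//= lerDl sumr_ge0// => j _; exact: powR_ge0.
Qed.

Lemma poweRVK (x : \bar R) p L : 0 < p -> 0 <= L -> (0 <= x)%E ->
  (x `^ p^-1 <= L%:E)%E = (x <= (L `^ p)%:E)%E.
Proof.
move=> p0 L0 x0; have i0 : 0 < p^-1 by rewrite invr_gt0.
case: x x0 => [x| |]//; last first.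
  by move=> _; rewrite poweRyr ?gt_eqF// !leye_eq.
rewrite lee_fin => x0; rewrite poweR_EFin !lee_fin; apply/idP/idP => h.
  by rewrite -(powRKV p0 x0); apply: (powR_mono (ltW p0) (powR_ge0 _ _) h).
by rewrite -(powRVK p0 L0); apply: (powR_mono (ltW i0) x0 h).
Qed.

(** The bound passes from the corners of a to those of |a| by [spow_gramop_eq], and to the partial
    traces of |a|^p by [trace_blk_le]. [schatten_ge] runs the chain backwards. *)
Lemma schatten_le a p L : 1 <= p -> 0 <= L ->
  (forall n, snorm p (blk n n a) <= L) -> (schatten_norm p a <= L%:E)%E.
Proof.
move=> p1 L0 h; have p0 : 0 < p by lra.
have ha : obnd L a by split=> // n; exact: (bndmx_snorm p1 (h n)).
have [[M' hh] ph hg] := iabs_spec ha.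
have -> : schatten_norm p a = (itrace (fun_calc (@powR R ^~ p) (iabs a)) `^ p^-1)%E.
  rewrite /schatten_norm ifT//; apply: (@le_lt_trans _ _ L%:E); last exact: ltry.
  by apply/(opnorm_leP _ L0); case: ha.
have g0 i : 0 <= complex.Re (fun_calc (@powR R ^~ p) (iabs a) i i).
  apply: posop_entry; apply: (fun_calc_pos hh ph (poly_approx_powR _ p1)) => t _.
  exact: powR_ge0.
have t0 : (0 <= itrace (fun_calc (@powR R ^~ p) (iabs a)))%E.
  by apply: nneseries_ge0 => n _ _; rewrite lee_fin.
rewrite (poweRVK p0 L0 t0); apply/(itrace_leP _ g0) => n.
apply: (trace_blk_le n hh ph p1) => N.
apply: (spow_gramop_eq N p1 ha hh (esym hg)) => N'.
exact: (spow_le_snorm p0 L0 (h N')).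
Qed.

Lemma schatten_ge a p n : 1 <= p -> (opnorm a < +oo)%E ->
  ((snorm p (blk n n a))%:E <= schatten_norm p a)%E.
Proof.
move=> p1 afin; have p0 : 0 < p by lra.
have [M ha] := opnorm_fin_obnd afin.
have [[M' hh] ph hg] := iabs_spec ha.
rewrite /schatten_norm afin.
have g0 i : 0 <= complex.Re (fun_calc (@powR R ^~ p) (iabs a) i i).
  apply: posop_entry; apply: (fun_calc_pos hh ph (poly_approx_powR _ p1)) => t _.
  exact: powR_ge0.
have t0 : (0 <= itrace (fun_calc (@powR R ^~ p) (iabs a)))%E.
  by apply: nneseries_ge0 => i _ _; rewrite lee_fin.
have tE := itrace_leP _ g0.
case: (itrace _) t0 tE => [t| |]//; last first.
  by move=> _ _; rewrite poweRyr ?leey// gt_eqF ?invr_gt0.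
rewrite lee_fin => t0 /(_ t)[/(_ (lexx _)) tE _].
rewrite poweR_EFin lee_fin; apply: powR_mono (spow_ge0 _ _) _.
  by rewrite invr_ge0 ltW.
apply: (spow_gramop_eq n p1 hh ha hg) => N.
exact: le_trans (blk_trace_le N hh ph p1) (tE N).
Qed.

End SchattenNorm.

(** * Fourier matrices *)

Section FourierMatrices.
Context {R : realType}.
Local Notation C := R[i].
Implicit Types (x : R) (N : nat).

Definition expi x : C := (cos x +i* sin x)%C.

Lemma expi0 : expi 0 = 1.
Proof. by rewrite /expi cos0 sin0. Qed.

Lemma expiD x y : expi (x + y) = expi x * expi y.
Proof. by rewrite /expi cosD sinD; simpc; congr (_ +i* _)%C; ring. Qed.

Lemma expiMn x k : expi (x *+ k) = expi x ^+ k.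
Proof. by elim: k => [|k IH]; rewrite ?mulr0n ?expi0// mulrS expiD IH exprS. Qed.

Lemma conj_expi x : (expi x)^* = expi (- x).
Proof. by rewrite /expi cosN sinN. Qed.

Lemma conj_expiM x : (expi x)^* * expi x = 1.
Proof. by rewrite conj_expi -expiD addNr expi0. Qed.

Lemma expi_2pi : expi (pi *+ 2) = 1.
Proof. by rewrite /expi cos2pi sin2pi. Qed.

Lemma expi_neq1 x : 0 < x < pi *+ 2 -> expi x != 1.
Proof.
move=> /andP[x0 x2]; apply/eqP => /(congr1 (@complex.Re R)) /=.
have xE : x = (x / 2) *+ 2 by rewrite -mulr_natr divfK.
rewrite {1}xE cos_mulr2n => h.
have : 0 < sin (x / 2).
  by apply: sin_gt0_pi; rewrite divr_gt0//= ltr_pdivrMr// mulr_natr.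
move=> s0; have := cos2Dsin2 (x / 2); rewrite mulr2n in h.
have := exprn_gt0 2 s0; lra.
Qed.

Lemma sin_le x : 0 <= x -> sin x <= x.
Proof.
move=> x0; have [|c _] := @MVT_segment R sin cos 0 x x0.
  by apply: continuous_subspaceT; exact: continuous_sin.
rewrite sin0 !subr0 => ->; rewrite -[leRHS]mul1r ler_wpM2r// cos_le1.
Qed.

Lemma nc_expi_sub1 x : 0 <= x <= pi -> nc (1 - expi x) <= x.
Proof.
move=> /andP[x0 xpi]; have xE : x = (x / 2) *+ 2 by rewrite -mulr_natr divfK.
have s0 : 0 <= sin (x / 2).
  apply: sin_ge0_pi; rewrite divr_ge0//= ler_pdivrMr// mulr_natr mulr2n.
  by have := @pi_ge0 R; lra.
have sl : sin (x / 2) <= x / 2 by apply: sin_le; rewrite divr_ge0.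
rewrite -(@ler_pXn2r _ 2) ?nnegrE ?nc_ge0//.
have -> : nc (1 - expi x) ^+ 2 = 4 * sin (x / 2) ^+ 2.
  rewrite /nc /expi; simpc => /=; rewrite sqr_sqrtr ?addr_ge0 ?sqr_ge0//.
  have h1 := cos2Dsin2 x; have h2 := cos2Dsin2 (x / 2).
  have h3 : cos x = cos (x / 2) ^+ 2 *+ 2 - 1 by rewrite {1}xE cos_mulr2n.
  rewrite mulr2n in h3; nra.
have : sin (x / 2) ^+ 2 <= (x / 2) ^+ 2 by rewrite ler_pXn2r ?nnegrE// divr_ge0.
by rewrite expr_div_n -natrX; lra.
Qed.

Definition fourier_arg N : R := pi *+ 2 / N%:R.

Lemma fourier_arg_bnd N k : (0 < k < N)%N -> 0 < fourier_arg N *+ k < pi *+ 2.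
Proof.
move=> /andP[k0 kN]; have N0 : (0 < N%:R :> R) by rewrite ltr0n (leq_trans _ kN).
have p0 : 0 < pi *+ 2 :> R by rewrite pmulrn_lgt0// pi_gt0.
rewrite pmulrn_rgt0 ?divr_gt0// k0/= -mulr_natr mulrAC ltr_pdivrMr//.
by rewrite ltr_pM2l// ltr_nat.
Qed.

Definition omega N : C := expi (fourier_arg N).

Lemma omega_unity N : (0 < N)%N -> omega N ^+ N = 1.
Proof.
move=> N0; rewrite -expiMn -mulr_natr /fourier_arg divfK ?expi_2pi//.
by rewrite pnatr_eq0 -lt0n.
Qed.

Lemma omega_neq1 N k : (0 < k < N)%N -> omega N ^+ k != 1.
Proof. by move=> /fourier_arg_bnd h; rewrite -expiMn expi_neq1. Qed.

Lemma conj_omegaM N k : (omega N ^+ k)^* * omega N ^+ k = 1.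
Proof. by rewrite -expiMn conj_expiM. Qed.

(** [nc_expi_sub1] covers angles up to pi, hence the angle of omega as N >= 2. Higher powers follow
    from 1 - w^(k + 1) = (1 - w) + w (1 - w^k). *)
Lemma nc_omega_sub1 N k : (2 <= N)%N -> nc (1 - omega N ^+ k) <= k%:R * fourier_arg N.
Proof.
move=> N2; elim: k => [|k IH]; first by rewrite expr0 subrr nc0 mul0r.
have N0 : (0 < N%:R :> R) by rewrite ltr0n (leq_trans _ N2).
have -> : 1 - omega N ^+ k.+1 = (1 - omega N) + omega N * (1 - omega N ^+ k).
  by rewrite exprS; ring.
apply: le_trans (ncD _ _) _; rewrite ncM -natr1 mulrDl mul1r addrC lerD//.
  have -> : nc (omega N) = 1.
    apply: complexI; rewrite -normcC; apply/eqP.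
    rewrite -(@pexpr_eq1 _ _ 2)// normCKC; apply/eqP.
    by have := conj_omegaM N 1; rewrite expr1.
  by rewrite mul1r.
apply: nc_expi_sub1; apply/andP; split.
  by rewrite divr_ge0// mulrn_wge0// pi_ge0.
rewrite ler_pdivrMr// -[pi *+ 2]mulr_natr ler_wpM2l ?pi_ge0// ler_nat; exact: N2.
Qed.

Definition fourier_mx N : 'M[C]_N :=
  ((Num.sqrt N%:R)^-1)%:C *: \matrix_(s, k) omega N ^+ (s * k).

Lemma geometric_omega N (z : C) : z ^+ N = 1 -> z != 1 -> \sum_(s < N) z ^+ s = 0.
Proof.
move=> zN z1; have := subrX1 z N; rewrite zN subrr => /esym/eqP.
by rewrite mulf_eq0 subr_eq0 (negbTE z1) => /eqP.
Qed.

Lemma fourier_unitary N : (0 < N)%N -> (fourier_mx N)^H *m fourier_mx N = 1%:M.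
Proof.
move=> N0; have NR0 : (0 < N%:R :> R) by rewrite ltr0n.
rewrite /fourier_mx adjmxZ real_complex_conj -scalemxAl -scalemxAr scalerA -rmorphM.
rewrite -invfM -expr2 sqr_sqrtr ?(ltW NR0)//.
apply/matrixP => k l; rewrite !mxE.
under eq_bigr do rewrite adjmxE !mxE.
have [->|kl] := eqVneq k l.
  under eq_bigr do rewrite conj_omegaM.
  rewrite sumr_const card_ord -[1 *+ N]/(N%:R) -(rmorph_nat (real_complex R)) -rmorphM.
  by rewrite mulVf// gt_eqF.
pose w := (omega N ^+ k)^* * omega N ^+ l.
have -> : \sum_(s < N) (omega N ^+ (s * k))^* * omega N ^+ (s * l) = \sum_(s < N) w ^+ s.
  apply: eq_bigr => s _; rewrite exprMn -rmorphXn -!exprM.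
  by rewrite (mulnC k) (mulnC l).
rewrite (geometric_omega (z := w)) ?mulr0//.
  by rewrite exprMn -rmorphXn -!exprM mulnC (mulnC l) !exprM omega_unity// !expr1n rmorph1 mulr1.
rewrite /w; have [lk|lk|/val_inj lk] := ltngtP (val k) (val l).
- rewrite -(subnKC (ltnW lk)) exprD mulrA conj_omegaM mul1r.
  by rewrite omega_neq1// subn_gt0 lk/= (leq_ltn_trans (leq_subr _ _))//.
- rewrite -[in X in X * _](subnK (ltnW lk)) exprD rmorphM/= -mulrA conj_omegaM mulr1.
  rewrite -conjC1 (inj_eq (inv_inj conjCK)) omega_neq1//.
  by rewrite subn_gt0 lk/= (leq_ltn_trans (leq_subr _ _))//.
- by rewrite lk eqxx in kl.
Qed.

Definition uptri N : 'M[C]_N := \matrix_(s, t) (s <= t)%N%:R.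

(** With z = w^k, row s contributes sum_(t >= s) z^t = (z^s - 1) / (1 - z), since the full sum
    vanishes. Summed against the conjugate of z^s, the products with z^s give N and the rest
    cancels; normalization divides by N. *)
Lemma fourier_uptri N (k : 'I_N) : (0 < k)%N ->
  ((fourier_mx N)^H *m uptri N *m fourier_mx N) k k = (1 - omega N ^+ k)^-1.
Proof.
move=> k0; have N0 : (0 < N)%N by apply: leq_trans (ltn_ord k).
have NR0 : (0 < N%:R :> R) by rewrite ltr0n.
rewrite /fourier_mx adjmxZ real_complex_conj -!scalemxAl -scalemxAr scalerA -rmorphM.
rewrite -invfM -expr2 sqr_sqrtr ?(ltW NR0)// mxE.
set z := omega N ^+ k; have z1 : z != 1 by rewrite omega_neq1// k0/=.
have zN : z ^+ N = 1 by rewrite /z -exprM mulnC exprM omega_unity// expr1n.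
have d0 : 1 - z != 0 by rewrite subr_eq0 eq_sym.
have zE s : omega N ^+ (s * k) = z ^+ s by rewrite /z -exprM mulnC.
have N0' : (N%:R : C) != 0 by rewrite pnatr_eq0 -lt0n.
have tail (s : nat) : (s <= N)%N -> \sum_(t < N) (s <= t)%N%:R * z ^+ t = (z ^+ s - 1) / (1 - z).
  move=> sN; apply: (mulIf d0); rewrite divfK//.
  have : \sum_(t < N) (1 - (s <= t)%N%:R) * z ^+ t = \sum_(t < s) z ^+ t.
    rewrite (big_ord_widen_cond N xpredT (fun t => z ^+ t) sN) [RHS]big_mkcond/=.
    apply: eq_bigr => t _; rewrite ltnNge; case: (s <= t)%N => /=; ring.
  under eq_bigr do rewrite mulrBl mul1r.
  rewrite sumrB (geometric_omega zN z1) sub0r => /eqP; rewrite eqr_oppLR => /eqP ->.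
  by rewrite mulNr mulrC -opprB mulNr opprK -subrX1.
have -> : ((\matrix_(s, k0) omega N ^+ (s * k0))^H *m uptri N *m
    \matrix_(s, k0) omega N ^+ (s * k0)) k k = N%:R / (1 - z).
  rewrite -mulmxA mxE.
  transitivity (\sum_(s < N) (z ^+ s)^* * ((z ^+ s - 1) / (1 - z))).
    apply: eq_bigr => s _; rewrite adjmxE !mxE zE; congr (_ * _).
    rewrite -(tail s (ltnW (ltn_ord s))); apply: eq_bigr => t _.
    by rewrite !mxE zE.
  have zz s : (z ^+ s)^* * z ^+ s = 1 by rewrite -zE conj_omegaM.
  under eq_bigr do rewrite mulrA mulrBr mulr1 zz.
  rewrite -mulr_suml; congr (_ / _); rewrite sumrB sumr_const card_ord.
  by rewrite -rmorph_sum/= (geometric_omega zN z1) rmorph0 subr0.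
by rewrite mulrA fmorphV rmorph_nat mulVf// mul1r.
Qed.

End FourierMatrices.

(** * Lower bounds *)

Section LowerBounds.
Context {R : realType}.
Local Notation C := R[i].
Implicit Types (x t p K : R) (N : nat).

Lemma contrmx_nsq m n (A : 'M[C]_(m, n)) (x : 'cV[C]_n) : contrmx A -> nsq (A *m x) <= nsq x.
Proof.
move=> h; have := (bndmxP 1 A).1 ((bndmx_contr A).2 h) x; rewrite expr1n mul1r; exact.
Qed.

(** The diagonal entries of (U x) (V^H y)^H have moduli of sum at most (|U x|^2 + |V^H y|^2) / 2,
    and an l^p norm is at most the l^1 norm. *)
Lemma spow_rank1 m n (x : 'cV[C]_m) (y : 'cV[C]_n) p M : 1 <= p ->
  nsq x <= M -> nsq y <= M -> spow p (x *m y^H) <= M `^ p.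
Proof.
move=> p1 xM yM; have [U [V [cU cV ->]]] := spow_attained (x *m y^H).
have M0 : 0 <= M by apply: le_trans xM; exact: nsq_ge0.
have p0 : 0 <= p by lra.
apply: le_trans (sum_powR_le p1 _) _; first by move=> j; exact: nc_ge0.
apply: powR_mono p0 _ _; first by apply: sumr_ge0 => j _; exact: nc_ge0.
have hx := contrmx_nsq x cU; have hy := contrmx_nsq y (contrmx_adj cV).
apply: (@le_trans _ _ (2^-1 * (nsq (U *m x) + nsq (V^H *m y)))); last by lra.
rewrite /nsq -big_split/= mulr_sumr; apply: ler_sum => j _.
have -> : U *m (x *m y^H) *m V = (U *m x) *m (V^H *m y)^H.
  by rewrite adjmxM adjmxK !mulmxA.
rewrite mxE big_ord1 adjmxE ncM ncJ.
set a := nc _; set b := nc _; have := sqr_ge0 (a - b); rewrite sqrrB; lra.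
Qed.

Lemma spow_mxsub m n m' n' (f : 'I_m' -> 'I_m) (g : 'I_n' -> 'I_n) (A : 'M[C]_(m, n)) p :
  1 <= p -> injective f -> injective g -> spow p (mxsub f g A) <= spow p A.
Proof.
move=> p1 fI gI.
have -> : mxsub f g A = rowsub f 1%:M *m A *m colsub g 1%:M.
  by rewrite -rowsubE mulmx_colsub mulmx1; apply/matrixP => i j; rewrite !mxE.
have c1 k : bndmx 1 (1%:M : 'M[C]_k) by apply/bndmx_contr; exact: (@contrmx1 _ k).
have cf : contrmx (rowsub f (1%:M : 'M[C]_m)) := (bndmx_contr _).1 (bndmx_rowsub fI (c1 m)).
have cg : contrmx (colsub g (1%:M : 'M[C]_n)) :=
  (bndmx_contr _).1 (bndmx_colsub ler01 gI (c1 n)).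
exact: (spow_contr A p1 cf cg).
Qed.

Definition sum_inv_pow p N : R := \sum_(1 <= k < N) k%:R `^ (- p).

(** The tangent inequality at 1 for the exponent 1 / t, applied to x^t. *)
Lemma powR_le_affine t x : 0 < t <= 1 -> 0 <= x -> x `^ t <= 1 + t * (x - 1).
Proof.
move=> /andP[t0 t1] x0.
have i1 : 1 <= t^-1 by rewrite invf_ge1.
have := powR_tangent i1 (powR_ge0 x t) (@ler01 R).
rewrite !powR1 mulr1 (powRVK t0 x0) => h.
rewrite -lerBlDl -ler_pdivrMl//; lra.
Qed.

(** The left-hand side is the integral of x^(-1 - t) over [1, N]. The comparison is an induction on
    N whose step is Bernoulli's inequality (1 + 1/n)^t <= 1 + t / n. *)
Lemma sum_inv_pow_ge t N : 0 < t <= 1 -> (0 < N)%N ->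
  (1 - N%:R `^ (- t)) / t <= sum_inv_pow (1 + t) N.
Proof.
move=> /andP[t0 t1]; case: N => // N _; elim: N => [|N IH].
  by rewrite /sum_inv_pow big_geq// powR1 subrr mul0r.
rewrite /sum_inv_pow big_nat_recr//=; apply: le_trans (lerD IH (lexx _)).
rewrite ler_pdivrMr// mulrDl divfK ?gt_eqF//.
set n : R := N.+1%:R; have n0 : 0 < n by rewrite ltr0n.
have -> : N.+2%:R = n * (1 + n^-1) by rewrite mulrDr mulr1 mulfV ?gt_eqF// -natr1.
have i0 : 0 < n^-1 by rewrite invr_gt0.
clearbody n; have i1 : 0 < 1 + n^-1 by rewrite addr_gt0.
have -> : n `^ (- (1 + t)) = n `^ (- t) * n^-1.
  rewrite opprD addrC powRD; last by rewrite (gt_eqF n0) implybT.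
  by rewrite (powR_inv1 (ltW n0)).
rewrite powRM ?(ltW n0)//; last exact: ltW.
rewrite [(1 + n^-1) `^ _]powRN.
have a0 : 0 <= n `^ (- t) by exact: powR_ge0.
have u0 : 0 < (1 + n^-1) `^ t by rewrite powR_gt0.
have := @powR_le_affine t (1 + n^-1); rewrite t0 t1 => /(_ isT).
set u := (1 + n^-1) `^ t in u0 *; set a := n `^ (- t) in a0 *; move=> hu.
have {}hu : u <= 1 + t / n by move: hu; rewrite addrAC subrr add0r; apply; exact: ltW.
have h : 1 - t / n <= u^-1.
  rewrite -[u^-1]mul1r ler_pdivlMr//.
  have y0 : 0 <= t / n by rewrite divr_ge0// ltW.
  move: (t / n) y0 hu => y y0 hu.
  have [y1|y1] := leP y 1.
    have : (1 - y) * u <= (1 - y) * (1 + y) by rewrite ler_wpM2l// subr_ge0.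
    nra.
  nra.
have : a * (1 - t / n) <= a * u^-1 by rewrite ler_wpM2l.
lra.
Qed.

Definition fin_bound p K := forall (nn mm : nat -> bool) n (A : 'M[C]_n),
  snorm p (hadmx (max_mx nn mm) A) <= K * snorm p A.

Lemma fin_bound_ge1 p K : 1 <= p -> fin_bound p K -> 1 <= K.
Proof.
move=> p1 h; have p0 : 0 < p by lra.
have := h xpredT xpredT 1%N 1%:M.
have -> : hadmx (max_mx xpredT xpredT) 1%:M = 1%:M :> 'M[C]_1.
  by apply/matrixP => i j; rewrite !mxE /max_mx if_same mul1r.
have : 0 < snorm p (1%:M : 'M[C]_1).
  rewrite powR_gt0//; have := spow_pinching 1%:M p1 (@contrmx1 C 1) (@contrmx1 C 1).
  rewrite big_ord1 !mul1mx mxE eqxx -[1%:R]/((1 : R)%:C) ncR normr1 powR1.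
  by apply: lt_le_trans.
set s := snorm p _; move=> s0; rewrite -[leLHS]mul1r ler_pM2r//.
Qed.

(** Supported at rows 2 s and columns 2 t + 1, hence away from the diagonal. *)
Definition chess N : 'M[C]_(N.*2) := \matrix_(r, c) ((~~ odd r) && odd c)%:R.

Lemma sum_odd N (b : bool) : \sum_(r < N.*2) (odd r == b)%:R = N%:R :> R.
Proof.
elim: N => [|N IH]; first by rewrite big_ord0.
rewrite doubleS !big_ord_recr/= IH odd_double -addrA -[RHS]natr1; congr (_ + _).
by case: b {IH}; rewrite /= ?addr0 ?add0r.
Qed.

Lemma spow_chess p N : 1 <= p -> spow p (chess N) <= N%:R `^ p.
Proof.
move=> p1.
pose x : 'cV[C]_(N.*2) := \col_r (odd r == false)%:R.
pose y : 'cV[C]_(N.*2) := \col_r (odd r == true)%:R.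
have sq (b : bool) : nc (b%:R : C) ^+ 2 = b%:R.
  by case: b; [rewrite -[1%:R]/((1 : R)%:C) ncR normr1 expr1n|rewrite nc0 expr0n].
have hx : nsq x <= N%:R by rewrite -(sum_odd N false) /nsq; apply: ler_sum => r _; rewrite mxE sq.
have hy : nsq y <= N%:R by rewrite -(sum_odd N true) /nsq; apply: ler_sum => r _; rewrite mxE sq.
have -> : chess N = x *m y^H; last exact: (spow_rank1 p1 hx hy).
apply/matrixP => r c; rewrite mxE [RHS]mxE big_ord1 adjmxE !mxE rmorph_nat -natrM.
by case: (odd r) (odd c) => [] [].
Qed.

(** Take m_k = 1 for odd k. The larger of 2 s and 2 t + 1 is odd exactly when s <= t, so these rows
    and columns of the Schur product form [uptri N]. *)
Lemma spow_uptri_le p N : 1 <= p ->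
  spow p (uptri N : 'M[C]_N) <= spow p (hadmx (max_mx xpredT odd) (chess N)).
Proof.
move=> p1.
have fp (s : 'I_N) : (s.*2 < N.*2)%N by rewrite ltn_double.
have gp (s : 'I_N) : (s.*2.+1 < N.*2)%N by rewrite ltn_Sdouble.
pose f (s : 'I_N) : 'I_(N.*2) := Ordinal (fp s).
pose g (s : 'I_N) : 'I_(N.*2) := Ordinal (gp s).
have fI : injective f by move=> s s' /(congr1 val)/= /double_inj/val_inj.
have gI : injective g by move=> s s' /(congr1 val)/= [] /double_inj/val_inj.
have -> : uptri N = mxsub f g (hadmx (max_mx xpredT odd) (chess N)); last first.
  exact: spow_mxsub.
apply/matrixP => s t; rewrite !mxE /= odd_double /= odd_double mulr1 /max_mx.
rewrite ifF; last by apply/negP => /eqP/(congr1 odd); rewrite /= !odd_double.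
congr (_%:R); congr nat_of_bool; have [st|ts] := leqP s t.
  by rewrite (maxn_idPr _)/= ?odd_double// leqW// leq_double.
by rewrite (maxn_idPl _) ?odd_double// ltn_double.
Qed.

(** [chess N] has norm at most N, so [uptri N] has norm at most K N. Its diagonal entries in the
    Fourier basis have moduli 1 / |1 - w^k| >= N / (2 pi k), and the powers of N cancel. *)
Lemma fin_bound_sum p K N : 1 <= p -> (2 <= N)%N -> fin_bound p K ->
  sum_inv_pow p N <= (2 * pi * K) `^ p.
Proof.
move=> p1 N2 h; have K1 := fin_bound_ge1 p1 h; have p0 : 0 < p by lra.
have N0 : (0 < N)%N by exact: leq_trans N2.
have NR0 : (0 < N%:R :> R) by rewrite ltr0n.
have pp : 0 < 2 * pi :> R by rewrite mulr_gt0// pi_gt0.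
have cF : contrmx (fourier_mx N : 'M[C]_N).
  by apply: contrmx_isometry; exact: fourier_unitary.
have h1 : spow p (uptri N : 'M[C]_N) <= (K * N%:R) `^ p.
  apply: le_trans (spow_uptri_le N p1) _.
  apply: (spow_le_snorm p0); first by rewrite mulr_ge0//; lra.
  apply: le_trans (h _ _ _ _) _; rewrite ler_wpM2l//; first by lra.
  by apply: (snorm_le_spow p0 (ltW NR0)); exact: spow_chess.
have h2 := spow_pinching (uptri N) p1 (contrmx_adj cF) cF.
have h3 : N%:R `^ p * sum_inv_pow p N <= (2 * pi) `^ p * (K * N%:R) `^ p.
  apply: (@le_trans _ _ ((2 * pi) `^ p * spow p (uptri N : 'M[C]_N))); last first.
    by rewrite ler_wpM2l ?powR_ge0.
  apply: (le_trans _ (ler_wpM2l (powR_ge0 (2 * pi) p) h2)).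
  have -> : sum_inv_pow p N = \sum_(k < N | (0 < k)%N) k%:R `^ (- p).
    rewrite -(big_mkord (fun k => (0 < k)%N) (fun k => k%:R `^ (- p))) /sum_inv_pow.
    by rewrite [RHS]big_ltn_cond//= big_nat [RHS]big_nat_cond;
      apply: eq_bigl => k; rewrite andbAC andbb.
  rewrite !mulr_sumr [leRHS](bigID (fun k : 'I_N => (0 < k)%N))/=.
  apply: ler_wpDr.
    by apply: sumr_ge0 => k _; rewrite mulr_ge0 ?powR_ge0.
  apply: ler_sum => k k0; rewrite fourier_uptri// -powRM ?nc_ge0 ?(ltW pp)//.
  have kR : 0 < k%:R :> R by rewrite ltr0n.
  rewrite powRN -powR_inv1 ?powR_ge0// -powRrM mulrN1 -[- p]mulN1r powRrM powR_inv1 ?(ltW kR)//.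
  rewrite -powRM ?invr_ge0 ?(ltW NR0) ?(ltW kR)//.
  apply: powR_mono (ltW p0) _ _; first by rewrite divr_ge0// ltW.
  have d := @nc_omega_sub1 R _ k N2.
  have z1 : (1 - omega N ^+ k : C) != 0.
    by rewrite subr_eq0 eq_sym omega_neq1// k0/=.
  have c0 : 0 < nc (1 - omega N ^+ k : C).
    by rewrite lt_neqAle nc_ge0 andbT eq_sym; apply: contra z1 => /eqP/Normc.eq0_normc ->.
  have -> : nc (1 - omega N ^+ k : C)^-1 = (nc (1 - omega N ^+ k : C))^-1.
    apply: (mulfI (lt0r_neq0 c0)); rewrite -ncM mulfV// mulfV ?lt0r_neq0//.
    by rewrite -[1 : C]/((1 : R)%:C) ncR normr1.
  rewrite ler_pdivlMr// mulrAC ler_pdivrMr//.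
  apply: le_trans (ler_wpM2l (ltW NR0) d) _.
  rewrite le_eqVlt; apply/predU1P; left; rewrite /fourier_arg mulr2n.
  by field; rewrite gt_eqF.
have K0 : 0 <= K by lra.
rewrite (powRM _ (ltW pp) K0); rewrite (powRM _ K0 (ltW NR0)) in h3.
have n0 : 0 < N%:R `^ p :> R by rewrite powR_gt0.
rewrite -(ler_pM2l n0); apply: (le_trans h3).
by rewrite le_eqVlt; apply/predU1P; left; ring.
Qed.

Lemma powR_1D x t : 0 < x -> x `^ (1 + t) = x * x `^ t.
Proof. by move=> x0; rewrite powRD ?powRr1 ?(ltW x0)// (gt_eqF x0) implybT. Qed.

Lemma fin_bound_ge t K : 0 < t <= 1 -> fin_bound (1 + t) K -> (8 * pi)^-1 / t <= K.
Proof.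
move=> t01 h; have /andP[t0 t1] := t01; have p1 : 1 <= 1 + t by lra.
have K1 := fin_bound_ge1 p1 h; have pp := @pi_gt0 R.
(* N >= 2^(1/t), so that N^-t <= 1/2 and the sum is at least 1 / (2 t). *)
pose N := maxn 2 (Num.bound (2 `^ t^-1 : R)).
have N2 : (2 <= N)%N by rewrite leq_maxl.
have N0 : (0 < N)%N by exact: leq_trans N2.
have NR0 : (0 < N%:R :> R) by rewrite ltr0n.
have Nt : N%:R `^ (- t) <= 2^-1 :> R.
  rewrite powRN lef_pV2 ?posrE ?powR_gt0//.
  rewrite -[leLHS](@powRKV _ t 2)//.
  apply: powR_mono (ltW t0) (powR_ge0 _ _) _.
  apply: le_trans (ltW (archi_boundP (powR_ge0 _ _))) _.
  by rewrite ler_nat leq_maxr.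
have h1 := le_trans (sum_inv_pow_ge t01 N0) (fin_bound_sum p1 N2 h).
have h2 : (2 * t)^-1 <= (2 * pi * K) `^ (1 + t).
  apply: le_trans h1; rewrite invfM ler_wpM2r ?invr_ge0 ?(ltW t0)//; lra.
have tt : t^-1 `^ t <= 2.
  have ti : 0 <= t^-1 by rewrite invr_ge0 ltW.
  have := powR_le_affine t01 ti; rewrite mulrBr mulfV ?gt_eqF//; lra.
(* Prepares the root of order 1 + t: (1 / (4 t))^(1 + t) <= 1 / (2 t), because 4^-(1 + t) <= 1/4 and
   (1/t)^t <= 2. *)
have h3 : (4^-1 / t) `^ (1 + t) <= (2 * pi * K) `^ (1 + t).
  apply: le_trans h2; rewrite powRM ?invr_ge0 ?(ltW t0)//.
  have -> : t^-1 `^ (1 + t) = t^-1 * t^-1 `^ t.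
    by rewrite powR_1D// invr_gt0.
  have q : 4^-1 `^ (1 + t) <= 4^-1 :> R.
    rewrite powR_1D// -[leRHS]mulr1 ler_wpM2l//.
    have f0 : 0 <= 4^-1 :> R by [].
    have := powR_le_affine t01 f0; move: (4^-1 `^ t) => v; lra.
  have ti : 0 < t^-1 by rewrite invr_gt0.
  rewrite invfM.
  apply: (@le_trans _ _ (4^-1 * (t^-1 * 2))); last by lra.
  apply: ler_pM => //; first by rewrite mulr_ge0 ?powR_ge0// ltW.
  by rewrite ler_wpM2l// ltW.
have p0 : 0 < 1 + t by lra.
have a0 : 0 <= 4^-1 / t by rewrite divr_ge0// ltW.
have b0 : 0 <= 2 * pi * K by rewrite !mulr_ge0//; lra.
have h4 : 4^-1 / t <= 2 * pi * K.
  rewrite -(powRVK p0 a0) -(powRVK p0 b0).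
  by apply: powR_mono (powR_ge0 _ _) h3; rewrite invr_ge0 ltW.
have E (c : R) : 0 < c -> (8 * c)^-1 / t = (2 * c)^-1 * (4^-1 / t).
  by move=> c0; field; rewrite !gt_eqF.
rewrite (E _ pp).
by rewrite ler_pdivrMl ?mulr_gt0.
Qed.

(** The exponent conjugate to p is 1 + t with t = 1 / (p - 1). There [fin_bound_ge] gives (p - 1) /
    (8 pi), which is at least p / (16 pi) for p >= 2. *)
Lemma fin_bound_ge_infty p K : 2 <= p -> fin_bound p K -> (16 * pi)^-1 * p <= K.
Proof.
move=> p2 h; have p1 : 1 <= p by lra.
have K1 := fin_bound_ge1 p1 h; have pp := @pi_gt0 R.
pose t := (p - 1)^-1; have t0 : 0 < t by rewrite invr_gt0; lra.
have t1 : t <= 1 by rewrite invf_le1; lra.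
have h' : fin_bound (1 + t) K.
  move=> nn mm n; apply: (@snorm_hadmx_dual _ _ _ _ p); [lra|lra| |lra| |].
  - by rewrite /t; field; rewrite !gt_eqF//; lra.
  - by move=> i j; rewrite /max_mx rmorph_nat.
  - exact: h.
have := fin_bound_ge _ h'; rewrite t0 t1 /t invrK => /(_ isT); apply: le_trans.
have E (c : R) : 0 < c -> (16 * c)^-1 = (8 * c)^-1 / 2.
  by move=> c0; field; rewrite gt_eqF.
rewrite (E _ pp).
by rewrite -mulrA ler_wpM2l ?invr_ge0 ?mulr_ge0 ?(ltW pp)//; lra.
Qed.

End LowerBounds.

(** * Constants *)

Section Constants.
Context {R : realType}.
Local Notation C := R[i].
Implicit Types (a : imatrix R) (t p K : R).

Definition cst_lt2 p : R := 4 * (5 + 2 * tri_cst p).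

Lemma cst_lt2_ge0 p : 0 <= cst_lt2 p.
Proof. by have : 0 <= tri_cst p := powR_ge0 _ _; rewrite /cst_lt2; lra. Qed.

(** [cst_lt2] is unbounded as p increases to 2, so 2 gets a value of its own; beyond 2 the conjugate
    exponent is used. Away from 1 and infinity only finiteness counts. *)
Definition max_cst p : R :=
  if p < 2 then cst_lt2 p else if p == 2 then 1 else cst_lt2 (p / (p - 1)).

Lemma max_cst_ge0 p : 0 <= max_cst p.
Proof.
rewrite /max_cst; case: ifP => _; first exact: cst_lt2_ge0.
by case: ifP => _ //; exact: cst_lt2_ge0.
Qed.

Lemma fin_bound_max_cst p : 1 < p -> fin_bound p (max_cst p).
Proof.
move=> p1 nn mm n A; rewrite /max_cst.
have [p2|p2|->] := ltgtP p 2.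
- by apply: snorm_hadmx_lt2; rewrite p1 p2.
- have q1 : 1 < p / (p - 1) by rewrite ltr_pdivlMr; lra.
  have q2 : p / (p - 1) < 2 by rewrite ltr_pdivrMr; lra.
  apply: (snorm_hadmx_dual p1 q1 _ (cst_lt2_ge0 _)).
  + by field; rewrite !gt_eqF//; lra.
  + by move=> i j; rewrite /max_mx rmorph_nat.
  + by move=> B; apply: snorm_hadmx_lt2; rewrite q1 q2.
- rewrite mul1r; exact: snorm_hadmx_2.
Qed.

(** The first summand is at most 3, as 2^(1 - t) >= 2 / (1 + t) >= 4/3. The order 1 / t comes from
    the second alone, through 1 - 2^-t >= t / 2. *)
Lemma dyadic_cst_le t : 0 < t <= 2^-1 -> dyadic_cst (1 + t) <= 4 / t.
Proof.
move=> /andP[t0 t2]; have t1 : 0 < t <= 1 by rewrite t0/=; lra.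
have h1 : 2 `^ t <= 1 + t.
  by have := powR_le_affine t1 (ler0n R 2); lra.
have p0 : 0 < 2 `^ t :> R by rewrite powR_gt0.
have h2 : 2^-1 * t <= 1 - 2 `^ (- t).
  rewrite powRN; have f0 : 0 <= 2^-1 :> R by [].
  have E : 2^-1 `^ t = (2 `^ t)^-1 by rewrite -[2^-1]powR_inv1// -powRrM mulN1r powRN.
  by have := powR_le_affine t1 f0; rewrite E; lra.
rewrite /dyadic_cst.
have -> : 1 - (1 + t) = - t by ring.
have -> : 2 - (1 + t) = 1 + - t by ring.
rewrite powR_1D//.
have h3 : 4 / 3 <= 2 * 2 `^ (- t).
  rewrite powRN ler_pdivlMr//; lra.
have i1 : (2 * 2 `^ (- t) - 1)^-1 <= 3.
  by rewrite invf_ple ?posrE//; lra.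
have i2 : (1 - 2 `^ (- t))^-1 <= 2 / t.
  have -> : 2 / t = (2^-1 * t)^-1 by field; rewrite gt_eqF.
  rewrite lef_pV2 ?posrE//; lra.
have i3 : 4 <= 2 / t by rewrite ler_pdivlMr//; lra.
have -> : 4 / t = 2 / t + 2 / t by field; rewrite gt_eqF.
lra.
Qed.

(** A crude removal of the p-th root in [tri_cst], harmless for the order as p tends to 1. *)
Lemma powR_le_1D p x : 1 <= p -> 0 <= x -> x `^ p^-1 <= 1 + x.
Proof.
move=> p1 x0; have p0 : 0 < p^-1 by rewrite invr_gt0; lra.
have pi1 : 0 < p^-1 <= 1 by rewrite p0/= invf_le1//; lra.
have := powR_le_affine pi1 x0; nra.
Qed.

(** [riesz_cst] is at most 64 (4 / t) = 256 / t, hence [tri_cst] at most 257 / t, and 4 (5 + 514 /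
    t) <= 2100 / t as 1 / t >= 2. *)
Lemma cst_lt2_le t : 0 < t <= 2^-1 -> cst_lt2 (1 + t) <= 2100 / t.
Proof.
move=> t02; have /andP[t0 t2] := t02; have d := dyadic_cst_le t02.
have p4 : 2 `^ (1 + t) <= 4 :> R.
  have t1 : 0 < t <= 1 by rewrite t0/=; lra.
  by rewrite powR_1D//; have := powR_le_affine t1 (ler0n R 2); lra.
have p0 : 0 <= 2 `^ (1 + t) :> R by exact: powR_ge0.
have it : 2 <= t^-1 by rewrite -[2]invrK lef_pV2// posrE.
have r : riesz_cst (1 + t) <= 256 / t.
  rewrite /riesz_cst.
  have q0 : 0 <= 4 * 2 `^ (1 + t) * 2 `^ (1 + t) :> R by rewrite !mulr_ge0.
  have q64 : 4 * 2 `^ (1 + t) * 2 `^ (1 + t) <= 64 :> R by nra.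
  apply: (@le_trans _ _ (4 * 2 `^ (1 + t) * 2 `^ (1 + t) * (4 / t))).
    by rewrite ler_wpM2l.
  apply: (@le_trans _ _ (64 * (4 / t))); last by lra.
  by rewrite ler_wpM2r// divr_ge0// ltW.
have r0 : 0 <= riesz_cst (1 + t) by apply: riesz_cst_ge0; apply/andP; split; lra.
have p1 : 1 <= 1 + t by lra.
have : tri_cst (1 + t) <= 257 / t.
  apply: le_trans (powR_le_1D p1 r0) _; lra.
rewrite /cst_lt2; lra.
Qed.

Lemma blk_ischur (m : imatrix R) n a : blk n n (ischur m a) = hadmx m (blk n n a).
Proof. by apply/matrixP => i j; rewrite !mxE. Qed.

Lemma schatten_fin p a : schatten p a -> schatten_norm p a = (fine (schatten_norm p a))%:E.
Proof.
move=> h; rewrite fineK// ge0_fin_numE// /schatten_norm.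
by case: ifP => // _; exact: poweR_ge0.
Qed.

Lemma schatten_opnorm p a : schatten p a -> (opnorm a < +oo)%E.
Proof. by rewrite /schatten /= /schatten_norm; case: ifP. Qed.

(** Schur products commute with taking corners, and Schatten norms are suprema over corners. *)
Lemma schur_bound_fin p K (m : imatrix R) : 1 <= p -> 0 <= K ->
  (forall n (A : 'M[C]_n), snorm p (hadmx m A) <= K * snorm p A) -> schur_bound p m K.
Proof.
move=> p1 K0 h a ha; rewrite (schatten_fin ha) -EFinM.
have f0 : 0 <= fine (schatten_norm p a).
  rewrite fine_ge0// /schatten_norm.
  by case: ifP => // _; exact: poweR_ge0.
apply: (schatten_le p1); first by rewrite mulr_ge0.
move=> k; rewrite blk_ischur; apply: le_trans (h _ _) _; rewrite ler_wpM2l//.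
by rewrite -lee_fin -(schatten_fin ha); exact: (schatten_ge k p1 (schatten_opnorm ha)).
Qed.

Lemma blk_iext n (A : 'M[C]_n) : blk n n (iext A) = A.
Proof. by apply/matrixP => i j; rewrite mxE iextE. Qed.

Lemma inclmx_sum n N (i : 'I_N) (F : 'I_n -> C) :
  \sum_l inclmx n N i l * F l = oapp F 0 (insub (val i)).
Proof.
have E l : inclmx n N i l = (val i == val l)%:R :> C by rewrite mxE.
case: insubP => [i' _ /= ii'|]/=.
  rewrite (bigD1 i')//= E /= ii' eqxx mul1r big1 ?addr0// => l.
  by rewrite E -val_eqE /= ii' eq_sym => /negbTE ->; rewrite mul0r.
rewrite -leqNgt => ni; rewrite big1// => l _; rewrite E gtn_eqF ?mul0r//.
exact: leq_trans (ltn_ord l) ni.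
Qed.

Lemma snorm_blk_iext_le p n N (A : 'M[C]_n) : 1 <= p -> snorm p (blk N N (iext A)) <= snorm p A.
Proof.
move=> p1; have p0 : 0 < p by lra.
apply: (snorm_le p0); have [Nn|nN] := leqP N n; first exact: spow_blk_iext.
apply: le_trans (spow_contr A p1 (inclmx_contr (ltnW nN)) (contrmx_adj (inclmx_contr (ltnW nN)))).
suff -> : blk N N (iext A) = inclmx n N *m A *m (inclmx n N)^H by [].
apply/matrixP => i j; rewrite [LHS]mxE mxE.
under eq_bigr do rewrite mxE inclmx_sum mulrC adjmxE.
have conj_incl (k : 'I_n) : (inclmx n N j k : C)^* = inclmx n N j k by rewrite !mxE rmorph_nat.
under eq_bigr do rewrite conj_incl.
by rewrite inclmx_sum /iext; case: insub => //; case: insub.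
Qed.

(** A finite matrix padded by zeros has its own norm as Schatten norm, so it can be fed to the
    infinite multiplier. *)
Lemma fin_schur_bound p K (m : imatrix R) : 1 <= p -> schur_bound p m K ->
  forall n (A : 'M[C]_n), snorm p (hadmx m A) <= K * snorm p A.
Proof.
move=> p1 h n A.
have s1 : (schatten_norm p (iext A) <= (snorm p A)%:E)%E.
  by apply: (schatten_le p1 (snorm_ge0 _ _)) => N; exact: snorm_blk_iext_le.
have fA : schatten p (iext A) by apply: le_lt_trans s1 _; exact: ltry.
have s2 : schatten_norm p (iext A) = (snorm p A)%:E.
  apply/eqP; rewrite eq_le s1/= -{1}(blk_iext A).
  exact: (schatten_ge n p1 (schatten_opnorm fA)).
have := h _ fA; rewrite s2 -EFinM => h1.
have fS : schatten p (ischur m (iext A)) by apply: le_lt_trans h1 _; exact: ltry.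
have := schatten_ge n p1 (schatten_opnorm fS).
by rewrite blk_ischur blk_iext => /le_trans/(_ h1); rewrite lee_fin.
Qed.

Lemma best_constant_ge p c : 1 <= p ->
  (forall K, fin_bound p K -> c <= K) -> (c%:E <= @best_constant R p)%E.
Proof.
move=> p1 h; apply: le_ereal_inf_tmp => _ [K hK <-]; rewrite lee_fin; apply: h => nn mm.
exact: (fin_schur_bound p1 (hK nn mm)).
Qed.

End Constants.

Theorem theorem5p11 (R : realType) :
  (exists C : R -> R,
    [/\ exists K : R, \forall p \near +oo, `|C p| <= K * p,
        exists K : R, \forall p \near 1^'+, `|C p| <= K * (p - 1)^-1 &
        forall n m : nat -> bool, forall p : R, 1 < p ->
          schur_multiplier p (max_mx n m) /\
          schur_bound p (max_mx n m) (C p)]) /\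
  (exists2 c : R, 0 < c &
    (\forall p \near +oo, ((c * p)%:E <= best_constant p)%E) /\
    (\forall p \near 1^'+, ((c * (p - 1)^-1)%:E <= best_constant p)%E)).
Proof.
split.
  exists max_cst; split.
  - exists 2100; near=> p; rewrite ger0_norm ?max_cst_ge0// /max_cst.
    (* The conjugate exponent is 1 + 1 / (p - 1), and p >= 3 brings 1 / (p - 1) into the range of
       [cst_lt2_le]. *)
    have p3 : 3 <= p by near: p; exact: nbhs_pinfty_ge.
    rewrite ifF; last by apply/negbTE; rewrite -leNgt; lra.
    rewrite ifF; last by rewrite gt_eqF//; lra.
    have -> : p / (p - 1) = 1 + (p - 1)^-1 by field; rewrite gt_eqF//; lra.
    apply: le_trans (cst_lt2_le _) _; last by rewrite invrK; lra.
    by rewrite invr_gt0 lef_pV2 ?posrE; lra.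
  - exists 2100; near=> p; rewrite ger0_norm ?max_cst_ge0// /max_cst.
    have p1 : 1 < p by near: p; exact: nbhs_right_gt.
    have p2 : p <= 3 / 2 by near: p; apply: nbhs_right_le; lra.
    rewrite ifT; last by lra.
    have {1}-> : p = 1 + (p - 1) by ring.
    by apply: cst_lt2_le; lra.
  - move=> n m p p1; suff h : schur_bound p (max_mx n m) (max_cst p).
      by split => //; exists (max_cst p).
    apply: (schur_bound_fin (ltW p1) (max_cst_ge0 p)) => k A.
    exact: fin_bound_max_cst.
(* The smaller of the constants 1 / (8 pi) near 1 and 1 / (16 pi) near infinity. *)
exists (16 * pi)^-1; first by rewrite invr_gt0 mulr_gt0// pi_gt0.
split; near=> p.
- have p2 : 2 <= p by near: p; exact: nbhs_pinfty_ge.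
  apply: best_constant_ge => [|K]; first lra.
  exact: fin_bound_ge_infty.
- have p1 : 1 < p by near: p; exact: nbhs_right_gt.
  have p2 : p <= 2 by near: p; apply: nbhs_right_le; lra.
  apply: best_constant_ge => [|K]; first lra.
  have -> : p = 1 + (p - 1) by ring.
  have t01 : 0 < p - 1 <= 1 by lra.
  move=> /(fin_bound_ge t01); apply: le_trans.
  have t0 : 0 <= (p - 1)^-1 by rewrite invr_ge0; lra.
  rewrite [1 + (p - 1)]addrC subrK; apply: ler_wpM2r => //.
  have pp := @pi_gt0 R.
  by rewrite lef_pV2 ?posrE ?mulr_gt0//; lra.
Unshelve. all: by end_near.
Qed.
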